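(* Fix $\alpha>0$. There exist constants $C_1,C_2>0$, independent of $\Lambda$ and $\alpha$, such that for all sufficiently large ultraviolet cutoffs $\Lambda$ the ground state energy $E_0=\inf_{\Psi\neq 0}\langle\Psi,H\Psi\rangle/\langle\Psi,\Psi\rangle$ of the operator $$H=\tfrac12\big(p+\sqrt{\alpha}\,A(x)\big)^2+H_f,\qquad p=-i\nabla,$$ acting on $L^2(\mathbb{R}^3)\otimes\mathcal F$, satisfies $$C_1\,\alpha^{1/2}\Lambda^{3/2}<E_0<C_2\,\alpha^{2/7}\Lambda^{12/7}.$$
   Context: Units: energy in units of $mc^2$, length in units of $\hbar/mc$, $\alpha=e^2/\hbar c$ is the fine structure constant. The radiation field lives in a box of side $L$, volume $V=L^3$. Modes are $k\in(2\pi/L)\mathbb{Z}^3$ with $|k|<\Lambda$ (ultraviolet cutoff $\Lambda$) and polarizations $\lambda\in\{1,2\}$; $\varepsilon_\lambda(k)\in\mathbb{R}^3$ are polarization vectors with $\varepsilon_i(k)\cdot\varepsilon_j(k)=\delta_{ij}$, $\varepsilon_i(k)\cdot k=0$. $\mathcal F$ is the photon Fock space generated by polynomials in creation operators $a^*_\lambda(k)$ acting on the vacuum $|0\rangle$, with $[a_\lambda(k),a^*_{\lambda'}(k')]=\delta_{\lambda\lambda'}\delta(k,k')$ and all other pairs commuting. The quantized vector potential is $$A(x)=\frac{1}{\sqrt{2V}}\sum_{|k|<\Lambda}\sum_{\lambda=1,2}\frac{1}{\sqrt{|k|}}\varepsilon_\lambda(k)\big[a_\lambda(k)e^{ix\cdot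 k}+a^*_\lambda(k)e^{-ix\cdot k}\big],$$ and the field energy is $H_f=\sum_{|k|<\Lambda}\sum_{\lambda=1,2}|k|\,a^*_\lambda(k)a_\lambda(k)$. *)

(* Defs.v *)
From Stdlib Require Import Reals Lra List ZArith Bool.
From Coquelicot Require Import Coquelicot.
Import ListNotations.
Open Scope R_scope.

Definition R3 := (R * R * R)%type.
Definition vcomp (v : R3) (j : nat) : R :=
  match v with (a, b, c) => match j with 0%nat => a | 1%nat => b | _ => c end end.
Definition dot3 (u v : R3) : R :=
  vcomp u 0 * vcomp v 0 + vcomp u 1 * vcomp v 1 + vcomp u 2 * vcomp v 2.
Definition norm3 (v : R3) : R := sqrt (dot3 v v).
Definition shift (x : R3) (j : nat) (t : R) : R3 :=
  match x with (a, b, c) =>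
    match j with 0%nat => (a + t, b, c) | 1%nat => (a, b + t, c) | _ => (a, b, c + t) end end.

Definition pd (j : nat) (f : R3 -> C) (x : R3) : C :=
  (Derive (fun t => fst (f (shift x j t))) 0, Derive (fun t => snd (f (shift x j t))) 0).

Fixpoint Ck (k : nat) (f : R3 -> C) : Prop :=
  match k with
  | O => forall x : R3, continuous f x
  | S k' => (forall x : R3, continuous f x) /\
            (forall (j : nat) (x : R3), (j < 3)%nat ->
               ex_derive (fun t => fst (f (shift x j t))) 0 /\
               ex_derive (fun t => snd (f (shift x j t))) 0) /\
            (forall j : nat, (j < 3)%nat -> Ck k' (pd j f))
  end.
Definition smooth (f : R3 -> C) : Prop := forall k, Ck k f.
Definition compact_support (f : R3 -> C) : Prop :=
  exists M : R, forall x : R3,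
    (M < Rabs (vcomp x 0) \/ M < Rabs (vcomp x 1) \/ M < Rabs (vcomp x 2)) -> f x = 0%C.

(* Lebesgue integral over R^3 (as an iterated improper Riemann integral; used
   only for continuous compactly supported integrands) *)
Definition integral3 (g : R3 -> R) : R :=
  RInt_gen (fun a =>
    RInt_gen (fun b =>
      RInt_gen (fun c => g (a, b, c)) (Rbar_locally m_infty) (Rbar_locally p_infty))
    (Rbar_locally m_infty) (Rbar_locally p_infty))
  (Rbar_locally m_infty) (Rbar_locally p_infty).

(* a mode (n, lam): momentum k = (2 pi / L) n, n in Z^3, polarization lam
   (false <-> lambda = 1, true <-> lambda = 2) *)
Definition mode := ((Z * Z * Z) * bool)%type.
Definition kvec (L : R) (n : Z * Z * Z) : R3 :=
  match n with (a, b, c) =>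
    (2 * PI * IZR a / L, 2 * PI * IZR b / L, 2 * PI * IZR c / L) end.
Definition Z3_nonzero (n : Z * Z * Z) : bool :=
  match n with (a, b, c) => negb (Z.eqb a 0 && Z.eqb b 0 && Z.eqb c 0) end.
Definition allowedb (L Lam : R) (m : mode) : bool :=
  Z3_nonzero (fst m) && (if Rlt_dec (norm3 (kvec L (fst m))) Lam then true else false).

Definition zrange (K : nat) : list Z :=
  map (fun i => (Z.of_nat i - Z.of_nat K)%Z) (seq 0 (2 * K + 1)).
Definition box_modes (K : nat) : list mode :=
  flat_map (fun a => flat_map (fun b => flat_map (fun c =>
     [((a, b, c), false); ((a, b, c), true)]) (zrange K)) (zrange K)) (zrange K).
Definition cutoffK (L Lam : R) : nat := Z.to_nat (up (Lam * L / (2 * PI))).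
(* finite sum over all allowed modes (the box |n_i| <= cutoffK contains them all) *)
Definition sum_modes (L Lam : R) (f : mode -> C) : C :=
  fold_right Cplus 0%C
    (map (fun m => if allowedb L Lam m then f m else 0%C) (box_modes (cutoffK L Lam))).

Definition polarization (L : R) (eps : mode -> R3) : Prop :=
  forall n : Z * Z * Z, Z3_nonzero n = true ->
    (forall l l' : bool, dot3 (eps (n, l)) (eps (n, l')) = if Bool.eqb l l' then 1 else 0) /\
    (forall l : bool, dot3 (eps (n, l)) (kvec L n) = 0).

(* A vector of L^2(R^3) (x) F is Psi = sum_c Psi_c (x) |c>, where
   |c> = prod_m (a*_m)^(c m) / sqrt(c m !) |0> *)
Definition config := mode -> nat.
Definition mode_eqb (m m' : mode) : bool :=
  match m, m' with ((a, b, c), l), ((a', b', c'), l') =>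
    Z.eqb a a' && Z.eqb b b' && Z.eqb c c' && Bool.eqb l l' end.
Definition cincr (c : config) (m : mode) : config :=
  fun m' => if mode_eqb m m' then S (c m') else c m'.
Definition cdecr (c : config) (m : mode) : config :=
  fun m' => if mode_eqb m m' then Nat.pred (c m') else c m'.

Definition state := config -> R3 -> C.

Definition expi (t : R) : C := (cos t, sin t).

Definition Aop (L Lam : R) (eps : mode -> R3) (j : nat) (Psi : state) : state :=
  fun c x => sum_modes L Lam (fun m =>
    let k := kvec L (fst m) in
    Cmult (RtoC (vcomp (eps m) j / sqrt (2 * (L ^ 3) * norm3 k)))
      (Cplus (Cmult (RtoC (sqrt (INR (S (c m))))) (Cmult (expi (dot3 k x)) (Psi (cincr c m) x)))
             (Cmult (RtoC (sqrt (INR (c m)))) (Cmult (expi (- dot3 k x)) (Psi (cdecr c m) x))))).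

Definition pop (j : nat) (Psi : state) : state :=
  fun c x => Cmult (Copp Ci) (pd j (Psi c) x).

Definition Piop (alpha L Lam : R) (eps : mode -> R3) (j : nat) (Psi : state) : state :=
  fun c x => Cplus (pop j Psi c x) (Cmult (RtoC (sqrt alpha)) (Aop L Lam eps j Psi c x)).

(* sum over all configurations of a nonnegative family, i.e. sup of finite partial sums *)
Definition sum_configs (w : config -> R) : Rbar :=
  Lub_Rbar (fun r => exists l : list config, NoDup l /\
                     r = fold_right Rplus 0 (map w l)).

Definition normsq (Phi : state) : Rbar :=
  sum_configs (fun c => integral3 (fun x => Cmod (Phi c x) ^ 2)).

(* <Psi, H_f Psi>, H_f = sum_m |k| a*_m a_m *)
Definition field_energy (L Lam : R) (Psi : state) : Rbar :=
  sum_configs (fun c =>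
    fst (sum_modes L Lam (fun m => RtoC (norm3 (kvec L (fst m)) * INR (c m))))
    * integral3 (fun x => Cmod (Psi c x) ^ 2)).

Definition trial (L Lam : R) (Psi : state) : Prop :=
  (exists S : list config, forall c, (exists x, Psi c x <> 0%C) -> In c S) /\
  (forall c, (exists x, Psi c x <> 0%C) -> forall m, c m <> 0%nat -> allowedb L Lam m = true) /\
  (forall c, smooth (Psi c) /\ compact_support (Psi c)).

Definition rayleigh_set (alpha L Lam : R) (eps : mode -> R3) (r : R) : Prop :=
  exists Psi : state, trial L Lam Psi /\
  exists n q0 q1 q2 h : R,
    normsq Psi = Finite n /\ 0 < n /\
    normsq (Piop alpha L Lam eps 0 Psi) = Finite q0 /\
    normsq (Piop alpha L Lam eps 1 Psi) = Finite q1 /\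
    normsq (Piop alpha L Lam eps 2 Psi) = Finite q2 /\
    field_energy L Lam Psi = Finite h /\
    r = ((q0 + q1 + q2) / 2 + h) / n.

Definition E0 (alpha L Lam : R) (eps : mode -> R3) : Rbar :=
  Glb_Rbar (rayleigh_set alpha L Lam eps).

(* Main.v *)
Require Import Defs.
From Stdlib Require Import Reals Lra Lia List ZArith Bool Permutation.
From Stdlib Require Import ClassicalEpsilon FunctionalExtensionality.
From Coquelicot Require Import Coquelicot.
Import ListNotations.
Open Scope R_scope.

(** Lower bound.  Let [T_j = a(h_j) - a*(h_j)], [h_j = sqrt |k| eps_j e^{-ikx}], be the
    (anti-Hermitian) momentum conjugate to [A_j].  In the expansion of
    [0 <= sum_j |(p + sqrt alpha A)_j Psi + s T_j Psi|^2] the cross term of [p] and [T] is a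
    total divergence because [k . eps = 0], the commutator of [A] and [T] is a multiple of the
    number [N ~ V Lam^3] of modes, and [|T Psi|^2] is controlled by [N (H_f + Lam)].
    With [s^2 = 1 / (2 N)] the energy is at least [c sqrt (alpha N / V) - Lam / 2].

    Upper bound.  Take a product state with the electron confined to a ball of radius [l].
    There [A(x)] is, up to exponentially small errors, a real combination of
    [O((l Lam)^3)] Taylor coefficients, which are commuting field operators.  Squeezing these
    quadratures by a factor [k] lowers [<A^2>] from [Lam^2] to [Lam^2 / k] and creates [O(k)]
    photons for each of them, so the energy is of order
    [l^-2 + alpha Lam^2 / k + k Lam (l Lam)^3]; choose [k ~ alpha (l Lam)^2] and
    [l = alpha^(-1/7) Lam^(-6/7)]. *)

(** Two obstacles shape the upper bound. A true squeezed state occupies infinitely many photon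
    numbers, while [trial] admits finitely many configurations; it is replaced by a finite
    superposition with a tent profile, whose norm, quadrature and photon number are elementary sums.
    Moreover, squeezing one quadrature inflates the conjugate one, so all components of A(x) near
    the origin must have real inner products with the squeezed waves. They do: the sum over
    polarizations is delta_ij - k_i k_j / |k|^2 for every choice of [eps], hence even in k, and the
    waves involved go over into their conjugates under k -> -k.

    The exponents: with squeezing factor alpha (l Lam)^2 the A^2 term is of order l^-2 and the
    photons cost alpha l^5 Lam^6; this equals l^-2 when l^-7 = alpha Lam^6, and then l^-2 =
    alpha^(2/7) Lam^(12/7). In the lower bound the loss Lam / 2 is of lower order than Lam^(3/2).
    Absorbing it, and having enough lattice points below the cutoff, makes the threshold for Lam
    depend on alpha and L, but not the constants. *)

(** * Finite sums over lists *)

Definition rsum {T : Type} (l : list T) (f : T -> R) : R :=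
  fold_right Rplus 0 (map f l).
Definition csum {T : Type} (l : list T) (f : T -> C) : C :=
  fold_right Cplus (RtoC 0) (map f l).

Lemma C_eq (z w : C) : fst z = fst w -> snd z = snd w -> z = w.
Proof. destruct z, w; simpl; intros -> ->; reflexivity. Qed.

Section ListSums.
Context {T : Type}.
Implicit Types (l : list T).

Lemma rsum_cons t l f : rsum (t :: l) f = f t + rsum l f.
Proof. reflexivity. Qed.
Lemma csum_cons t l f : csum (t :: l) f = (f t + csum l f)%C.
Proof. reflexivity. Qed.
Lemma rsum_app l l' f : rsum (l ++ l') f = rsum l f + rsum l' f.
Proof. induction l; simpl app; rewrite ?rsum_cons, ?IHl; [unfold rsum; simpl; ring | ring]. Qed.
Lemma csum_app l l' f : csum (l ++ l') f = (csum l f + csum l' f)%C.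
Proof. induction l; simpl app; rewrite ?csum_cons, ?IHl; [unfold csum; simpl; ring | ring]. Qed.

Lemma rsum_ext l f g : (forall t, In t l -> f t = g t) -> rsum l f = rsum l g.
Proof.
  induction l; intros H; [reflexivity|]; rewrite !rsum_cons, H, IHl; simpl; auto.
  intros; apply H; simpl; auto.
Qed.
Lemma csum_ext l f g : (forall t, In t l -> f t = g t) -> csum l f = csum l g.
Proof.
  induction l; intros H; [reflexivity|]; rewrite !csum_cons, H, IHl; simpl; auto.
  intros; apply H; simpl; auto.
Qed.

Lemma rsum_plus l f g : rsum l (fun t => f t + g t) = rsum l f + rsum l g.
Proof. induction l; rewrite ?rsum_cons, ?IHl; [unfold rsum; simpl|]; ring. Qed.
Lemma csum_plus l f g : csum l (fun t => (f t + g t)%C) = (csum l f + csum l g)%C.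
Proof. induction l; rewrite ?csum_cons, ?IHl; [unfold csum; simpl|]; ring. Qed.
Lemma rsum_scal l a f : rsum l (fun t => a * f t) = a * rsum l f.
Proof. induction l; rewrite ?rsum_cons, ?IHl; [unfold rsum; simpl|]; ring. Qed.
Lemma csum_scal l a f : csum l (fun t => (a * f t)%C) = (a * csum l f)%C.
Proof. induction l; rewrite ?csum_cons, ?IHl; [unfold csum; simpl|]; ring. Qed.

Lemma rsum_zero l f : (forall t, In t l -> f t = 0) -> rsum l f = 0.
Proof.
  intros H; rewrite (rsum_ext l f (fun _ => 0 * 0)).
  - rewrite (rsum_scal l 0 (fun _ => 0)); ring.
  - intros t Ht; rewrite (H t Ht); ring.
Qed.
Lemma csum_zero l (f : T -> C) : (forall t, In t l -> f t = 0%C) -> csum l f = 0%C.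
Proof.
  intros H; rewrite (csum_ext l f (fun _ => (0 * 0)%C)).
  - rewrite (csum_scal l 0 (fun _ => 0%C)); ring.
  - intros t Ht; rewrite (H t Ht); ring.
Qed.

Lemma csum_conj l f : csum l (fun t => Cconj (f t)) = Cconj (csum l f).
Proof.
  induction l; rewrite ?csum_cons, ?IHl.
  - unfold csum; simpl; apply C_eq; simpl; ring.
  - apply C_eq; simpl; ring.
Qed.
Lemma csum_fst l f : fst (csum l f) = rsum l (fun t => fst (f t)).
Proof. induction l; [reflexivity|]; rewrite csum_cons, rsum_cons, <- IHl; reflexivity. Qed.
Lemma csum_snd l f : snd (csum l f) = rsum l (fun t => snd (f t)).
Proof. induction l; [reflexivity|]; rewrite csum_cons, rsum_cons, <- IHl; reflexivity. Qed.
Lemma csum_RtoC l (f : T -> R) : csum l (fun t => RtoC (f t)) = RtoC (rsum l f).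
Proof.
  apply C_eq; rewrite ?csum_fst, ?csum_snd; simpl; [reflexivity | now apply rsum_zero].
Qed.

Lemma rsum_le l f g : (forall t, In t l -> f t <= g t) -> rsum l f <= rsum l g.
Proof.
  induction l; intros H; [apply Rle_refl|]; rewrite !rsum_cons.
  apply Rplus_le_compat; [apply H; simpl; auto | apply IHl; intros; apply H; simpl; auto].
Qed.
Lemma rsum_nonneg l f : (forall t, In t l -> 0 <= f t) -> 0 <= rsum l f.
Proof.
  intros H; rewrite <- (rsum_zero l (fun _ => 0)); [now apply rsum_le | reflexivity].
Qed.
Lemma rsum_const l a : rsum l (fun _ => a) = INR (length l) * a.
Proof.
  induction l; [unfold rsum; simpl; ring|]; rewrite rsum_cons, IHl.
  simpl length; rewrite S_INR; ring.
Qed.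

Lemma rsum_perm l l' f : Permutation l l' -> rsum l f = rsum l' f.
Proof. induction 1; rewrite ?rsum_cons; try lra; auto. Qed.
Lemma csum_perm l l' f : Permutation l l' -> csum l f = csum l' f.
Proof. intros H; apply C_eq; rewrite ?csum_fst, ?csum_snd; now apply rsum_perm. Qed.

Lemma rsum_incl_le l l' f : NoDup l -> incl l l' -> (forall t, 0 <= f t) ->
  rsum l f <= rsum l' f.
Proof.
  intros Hl; revert l'; induction Hl as [|t l Ht Hl IH]; intros l' Hinc Hf.
  - now apply rsum_nonneg.
  - destruct (in_split t l') as [l1 [l2 ->]]; [apply Hinc; simpl; auto|].
    rewrite rsum_cons, rsum_app, rsum_cons.
    assert (rsum l f <= rsum (l1 ++ l2) f); [|rewrite rsum_app in *; lra].
    apply IH; auto; intros s Hs; specialize (Hinc s (or_intror Hs)).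
    apply in_app_or in Hinc; apply in_or_app; destruct Hinc as [| [-> | ]]; auto; easy.
Qed.

Lemma rsum_filter l (p : T -> bool) f :
  rsum (filter p l) f = rsum l (fun t => if p t then f t else 0).
Proof.
  induction l; [reflexivity|]; simpl filter; rewrite rsum_cons, <- IHl.
  destruct (p a); rewrite ?rsum_cons; ring.
Qed.
Lemma csum_filter l (p : T -> bool) f :
  csum (filter p l) f = csum l (fun t => if p t then f t else 0%C).
Proof.
  induction l; [reflexivity|]; simpl filter; rewrite csum_cons, <- IHl.
  destruct (p a); rewrite ?csum_cons; ring.
Qed.

Lemma rsum_single l f t : NoDup l -> In t l ->
  (forall s, s <> t -> f s = 0) -> rsum l f = f t.
Proof.
  intros Hnd Hin Hf; induction Hnd as [|a l Ha Hnd IH]; [easy|].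
  rewrite rsum_cons; destruct Hin as [-> | Hin].
  - rewrite rsum_zero; [ring|]; intros s Hs; apply Hf; intros ->; easy.
  - rewrite IH, (Hf a); [ring | intros -> | ]; easy.
Qed.
Lemma csum_single l (f : T -> C) t : NoDup l -> In t l ->
  (forall s, s <> t -> f s = 0%C) -> csum l f = f t.
Proof.
  intros Hnd Hin Hf; apply C_eq; rewrite ?csum_fst, ?csum_snd;
    erewrite rsum_single; eauto; intros s Hs; now rewrite (Hf s Hs).
Qed.

Lemma rsum_cauchy_schwarz l f g :
  (rsum l (fun t => f t * g t)) ^ 2 <= rsum l (fun t => f t ^ 2) * rsum l (fun t => g t ^ 2).
Proof.
  induction l; [unfold rsum; simpl; lra|].
  rewrite !rsum_cons.
  set (P := rsum l (fun t => f t * g t)) in *.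
  set (F := rsum l (fun t => f t ^ 2)) in *.
  set (G := rsum l (fun t => g t ^ 2)) in *.
  assert (HF : 0 <= F) by (apply rsum_nonneg; intros; nra).
  assert (HG : 0 <= G) by (apply rsum_nonneg; intros; nra).
  (* After squaring: by induction P^2 <= F G, and what remains is (f^2 G - g^2 F)^2 >= 0. *)
  assert (2 * (f a * g a) * P <= f a ^ 2 * G + g a ^ 2 * F).
  { assert (Hf : 0 <= f a ^ 2) by nra; assert (Hg : 0 <= g a ^ 2) by nra.
    assert (H1 : 0 <= f a ^ 2 * G) by nra; assert (H2 : 0 <= g a ^ 2 * F) by nra.
    destruct (Rle_lt_dec ((f a * g a) * P) 0) as [Hn | Hp]; [lra|].
    apply Rsqr_incr_0_var; [unfold Rsqr | lra].
    assert (H3 : 0 <= (f a * g a) ^ 2) by nra.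
    pose proof (Rmult_le_compat_l _ _ _ H3 IHl).
    assert (0 <= (f a ^ 2 * G - g a ^ 2 * F) ^ 2) by apply pow2_ge_0.
    lra. }
  lra.
Qed.
End ListSums.

Lemma rsum_map {S T : Type} (s : S -> T) l f : rsum (map s l) f = rsum l (fun t => f (s t)).
Proof. induction l; [reflexivity|]; simpl map; rewrite !rsum_cons, IHl; reflexivity. Qed.
Lemma csum_map {S T : Type} (s : S -> T) l f : csum (map s l) f = csum l (fun t => f (s t)).
Proof. induction l; [reflexivity|]; simpl map; rewrite !csum_cons, IHl; reflexivity. Qed.
Lemma rsum_flat_map {S T : Type} (s : S -> list T) l f :
  rsum (flat_map s l) f = rsum l (fun t => rsum (s t) f).
Proof. induction l; [reflexivity|]; simpl flat_map; rewrite rsum_app, rsum_cons, IHl; reflexivity. Qed.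
Lemma rsum_exchange {S T : Type} (l : list S) (l' : list T) f :
  rsum l (fun s => rsum l' (f s)) = rsum l' (fun t => rsum l (fun s => f s t)).
Proof.
  induction l; [symmetry; now apply rsum_zero|].
  rewrite rsum_cons, IHl, <- rsum_plus; apply rsum_ext; reflexivity.
Qed.
Lemma csum_exchange {S T : Type} (l : list S) (l' : list T) f :
  csum l (fun s => csum l' (f s)) = csum l' (fun t => csum l (fun s => f s t)).
Proof.
  induction l; [symmetry; now apply csum_zero|].
  rewrite csum_cons, IHl, <- csum_plus; apply csum_ext; reflexivity.
Qed.

(** * Sums of finitely supported families over an arbitrary index type *)

Section FiniteSupport.
Context {T : Type}.
Implicit Types (f g : T -> C) (l : list T).

Definition supp_in l f := forall t, f t <> 0%C -> In t l.
Definition finsupp f := exists l, supp_in l f.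

Definition eq_dec_classic (x y : T) : {x = y} + {x <> y} :=
  excluded_middle_informative (x = y).

Lemma finsupp_NoDup f : finsupp f -> exists l, NoDup l /\ supp_in l f.
Proof.
  intros [l Hl]; exists (nodup eq_dec_classic l); split; [apply NoDup_nodup|].
  intros t Ht; apply nodup_In; auto.
Qed.

Definition nonzero f (t : T) : bool :=
  if excluded_middle_informative (f t = 0%C) then false else true.

Lemma csum_nonzero l f : csum (filter (nonzero f) l) f = csum l f.
Proof.
  rewrite csum_filter; apply csum_ext; intros t _; unfold nonzero.
  destruct excluded_middle_informative as [e | _]; [now rewrite e | reflexivity].
Qed.

Lemma csum_supp_eq l l' f :
  NoDup l -> NoDup l' -> supp_in l f -> supp_in l' f -> csum l f = csum l' f.
Proof.
  intros Hl Hl' Hs Hs'; rewrite <- (csum_nonzero l), <- (csum_nonzero l').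
  apply csum_perm, NoDup_Permutation; try (now apply NoDup_filter).
  intros t; rewrite !filter_In; unfold nonzero.
  destruct excluded_middle_informative; split; intros [? ?]; split; auto; discriminate.
Qed.

(* Junk value [0] when [f] has infinite support. *)
Definition fsum f : C :=
  match excluded_middle_informative (exists l, NoDup l /\ supp_in l f) with
  | left h => csum (proj1_sig (constructive_indefinite_description _ h)) f
  | right _ => 0%C
  end.

Lemma fsum_list l f : NoDup l -> supp_in l f -> fsum f = csum l f.
Proof.
  intros Hl Hs; unfold fsum; destruct excluded_middle_informative as [h | n].
  - destruct constructive_indefinite_description as [l' [Hl' Hs']]; simpl.
    now apply csum_supp_eq.
  - destruct n; eauto.
Qed.

Lemma supp_in_mono l l' f : incl l l' -> supp_in l f -> supp_in l' f.
Proof. intros H Hs t Ht; auto. Qed.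

Lemma finsupp_plus f g : finsupp f -> finsupp g -> finsupp (fun t => (f t + g t)%C).
Proof.
  intros [l Hl] [l' Hl']; exists (l ++ l'); intros t Ht; apply in_or_app.
  destruct (excluded_middle_informative (f t = 0%C)) as [H0 | H0]; [right | left]; auto.
  apply Hl'; intros H1; apply Ht; rewrite H0, H1; ring.
Qed.

Lemma finsupp_sub f g : (forall t, f t = 0%C -> g t = 0%C) -> finsupp f -> finsupp g.
Proof. intros H [l Hl]; exists l; intros t Ht; apply Hl; auto. Qed.

Lemma fsum_ext f g : (forall t, f t = g t) -> fsum f = fsum g.
Proof. intros H; f_equal; now apply functional_extensionality. Qed.

Lemma fsum_plus f g : finsupp f -> finsupp g ->
  fsum (fun t => (f t + g t)%C) = (fsum f + fsum g)%C.
Proof.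
  intros [l Hl] [l' Hl'].
  set (L := nodup eq_dec_classic (l ++ l')).
  assert (HL : NoDup L) by apply NoDup_nodup.
  assert (Hf : supp_in L f)
    by (intros t Ht; apply nodup_In, in_or_app; auto).
  assert (Hg : supp_in L g)
    by (intros t Ht; apply nodup_In, in_or_app; auto).
  rewrite (fsum_list L f), (fsum_list L g), (fsum_list L), csum_plus; auto.
  intros t Ht.
  destruct (excluded_middle_informative (f t = 0%C)) as [H0 | H0]; auto.
  apply Hg; intros H1; apply Ht; rewrite H0, H1; ring.
Qed.

Lemma fsum_scal a f : finsupp f -> fsum (fun t => (a * f t)%C) = (a * fsum f)%C.
Proof.
  intros Hf; destruct (finsupp_NoDup f Hf) as [l [Hl Hs]].
  rewrite (fsum_list l f), (fsum_list l), csum_scal; auto.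
  intros t Ht; apply Hs; intros H; apply Ht; rewrite H; ring.
Qed.

Lemma Cconj_0 : Cconj 0 = 0%C.
Proof. apply C_eq; simpl; ring. Qed.

Lemma fsum_conj f : finsupp f -> fsum (fun t => Cconj (f t)) = Cconj (fsum f).
Proof.
  intros Hf; destruct (finsupp_NoDup f Hf) as [l [Hl Hs]].
  rewrite (fsum_list l f), (fsum_list l), csum_conj; auto.
  intros t Ht; apply Hs; intros H; apply Ht; rewrite H; apply Cconj_0.
Qed.

Lemma fsum_zero : fsum (fun _ : T => 0%C) = 0%C.
Proof. rewrite (fsum_list []); [reflexivity | constructor | easy]. Qed.

Lemma fsum_csum {S : Type} (ls : list S) (F : S -> T -> C) :
  (forall s, In s ls -> finsupp (F s)) ->
  finsupp (fun t => csum ls (fun s => F s t)) /\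
  fsum (fun t => csum ls (fun s => F s t)) = csum ls (fun s => fsum (F s)).
Proof.
  induction ls as [|s ls IH]; intros H.
  - split; [exists []; easy | apply fsum_zero].
  - destruct IH as [IH1 IH2]; [intros; apply H; simpl; auto|]; split.
    + apply finsupp_plus; [apply H; simpl; auto | exact IH1].
    + rewrite csum_cons, <- IH2, <- fsum_plus; auto; apply H; simpl; auto.
Qed.
End FiniteSupport.

(** Injectivity of [s] suffices: adding a photon, for which this is used, misses the configurations
    whose mode is empty, and there the summand vanishes. *)
Lemma fsum_reindex {S T : Type} (s : S -> T) (f : T -> C) :
  (forall x y, s x = s y -> x = y) ->
  (forall t, f t <> 0%C -> exists x, t = s x) ->
  finsupp f -> fsum f = fsum (fun x => f (s x)).
Proof.
  intros Hinj Him Hf; destruct (finsupp_NoDup f Hf) as [l [Hl Hs]].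
  set (L := filter (nonzero f) l).
  assert (HL : exists l', map s l' = L).
  { assert (H : forall t, In t L -> exists x, t = s x).
    { intros t Ht; apply filter_In in Ht as [_ Ht]; apply Him.
      unfold nonzero in Ht; now destruct excluded_middle_informative. }
    induction L as [|t L IH]; [now exists []|].
    destruct IH as [l' Hl']; [intros; apply H; simpl; auto|].
    destruct (H t) as [x Hx]; [simpl; auto|].
    exists (x :: l'); simpl; congruence. }
  destruct HL as [l' Hl'].
  assert (HND : NoDup (map s l')) by (rewrite Hl'; now apply NoDup_filter).
  assert (HS : supp_in L f).
  { intros t Ht; apply filter_In; split; auto; unfold nonzero.
    now destruct excluded_middle_informative. }
  rewrite (fsum_list L f), <- Hl', csum_map, (fsum_list l'); auto.
  - now apply NoDup_map_inv in HND.
  - intros x Hx; apply HS in Hx; rewrite <- Hl' in Hx.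
    apply in_map_iff in Hx as [y [Hy Hin]]; apply Hinj in Hy; now subst.
  - now apply NoDup_filter.
Qed.

(** * Fock space *)

(** A Fock vector is its family of coefficients in the occupation number basis. A [state] at a fixed
    x is such a vector, so operator identities and estimates are proved at fixed x and integrated
    afterwards. *)
Definition vec := config -> C.
Definition vadd (u v : vec) : vec := fun c => (u c + v c)%C.
Definition vscal (a : C) (u : vec) : vec := fun c => (a * u c)%C.
Definition vzero : vec := fun _ => 0%C.
Definition ip (u v : vec) : C := fsum (fun c => (Cconj (u c) * v c)%C).
Definition Nsq (u : vec) : R := fst (ip u u).

Ltac vring :=
  apply functional_extensionality; intro; unfold vadd, vscal, vzero; ring.

Lemma Cconj_mult (z w : C) : Cconj (z * w) = (Cconj z * Cconj w)%C.
Proof. apply C_eq; simpl; ring. Qed.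
Lemma Cconj_plus (z w : C) : Cconj (z + w) = (Cconj z + Cconj w)%C.
Proof. apply C_eq; simpl; ring. Qed.
Lemma Cconj_Cconj (z : C) : Cconj (Cconj z) = z.
Proof. apply C_eq; simpl; ring. Qed.
Lemma Cconj_R (r : R) : Cconj (RtoC r) = RtoC r.
Proof. apply C_eq; simpl; ring. Qed.

Lemma finsupp_ip_l u v : finsupp u -> finsupp (fun c : config => (Cconj (u c) * v c)%C).
Proof. apply finsupp_sub; intros c ->; rewrite Cconj_0; ring. Qed.
Lemma finsupp_ip_r u v : finsupp v -> finsupp (fun c : config => (Cconj (u c) * v c)%C).
Proof. apply finsupp_sub; intros c ->; ring. Qed.

Lemma ip_addl u u' v : finsupp v -> ip (vadd u u') v = (ip u v + ip u' v)%C.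
Proof.
  intros H; unfold ip, vadd; rewrite <- fsum_plus by now apply finsupp_ip_r.
  apply fsum_ext; intros; rewrite Cconj_plus; ring.
Qed.
Lemma ip_addr u v v' : finsupp u -> ip u (vadd v v') = (ip u v + ip u v')%C.
Proof.
  intros H; unfold ip, vadd; rewrite <- fsum_plus by now apply finsupp_ip_l.
  apply fsum_ext; intros; ring.
Qed.
Lemma ip_scall a u v : finsupp u -> ip (vscal a u) v = (Cconj a * ip u v)%C.
Proof.
  intros H; unfold ip, vscal; rewrite <- fsum_scal by now apply finsupp_ip_l.
  apply fsum_ext; intros; rewrite Cconj_mult; ring.
Qed.
Lemma ip_scalr a u v : finsupp u -> ip u (vscal a v) = (a * ip u v)%C.
Proof.
  intros H; unfold ip, vscal; rewrite <- fsum_scal by now apply finsupp_ip_l.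
  apply fsum_ext; intros; ring.
Qed.
Lemma ip_conj u v : finsupp u -> Cconj (ip u v) = ip v u.
Proof.
  intros H; unfold ip; rewrite <- fsum_conj by now apply finsupp_ip_l.
  apply fsum_ext; intros; rewrite Cconj_mult, Cconj_Cconj; ring.
Qed.
Lemma ip_zerol v : ip vzero v = 0%C.
Proof.
  etransitivity; [|apply (@fsum_zero config)]; apply fsum_ext; intros.
  unfold vzero; rewrite Cconj_0; ring.
Qed.
Lemma ip_zeror v : ip v vzero = 0%C.
Proof.
  etransitivity; [|apply (@fsum_zero config)]; apply fsum_ext; intros.
  unfold vzero; ring.
Qed.

Lemma ip_list l u v : NoDup l -> supp_in l u ->
  ip u v = csum l (fun c => (Cconj (u c) * v c)%C).
Proof.
  intros Hl Hs; apply fsum_list; auto; intros c Hc; apply Hs; intros H; apply Hc.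
  rewrite H, Cconj_0; ring.
Qed.

Lemma Cconj_mult_self (z : C) : (Cconj z * z)%C = RtoC (Cmod z ^ 2).
Proof. rewrite Cmod2_alt; apply C_eq; unfold Re, Im; simpl; ring. Qed.

Lemma Nsq_list l u : NoDup l -> supp_in l u -> Nsq u = rsum l (fun c => Cmod (u c) ^ 2).
Proof.
  intros; unfold Nsq; rewrite (ip_list l), csum_fst; auto.
  apply rsum_ext; intros; rewrite Cconj_mult_self; reflexivity.
Qed.
Lemma Nsq_nonneg u : finsupp u -> 0 <= Nsq u.
Proof.
  intros H; destruct (finsupp_NoDup u H) as [l [Hl Hs]].
  rewrite (Nsq_list l); auto; apply rsum_nonneg; intros; apply pow2_ge_0.
Qed.
Lemma ip_self u : finsupp u -> ip u u = RtoC (Nsq u).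
Proof.
  intros H; destruct (finsupp_NoDup u H) as [l [Hl Hs]].
  rewrite (Nsq_list l), (ip_list l), <- csum_RtoC; auto.
  apply csum_ext; intros; apply Cconj_mult_self.
Qed.

Lemma finsupp_vzero : finsupp vzero.
Proof. exists []; easy. Qed.
Lemma finsupp_vadd u v : finsupp u -> finsupp v -> finsupp (vadd u v).
Proof. apply finsupp_plus. Qed.
Lemma finsupp_vscal a u : finsupp u -> finsupp (vscal a u).
Proof. apply finsupp_sub; unfold vscal; intros c ->; ring. Qed.

Lemma Nsq_add u v : finsupp u -> finsupp v ->
  Nsq (vadd u v) = Nsq u + Nsq v + 2 * fst (ip u v).
Proof.
  intros Hu Hv; unfold Nsq.
  rewrite ip_addr, !ip_addl; auto using finsupp_vadd.
  rewrite <- (ip_conj u v); auto; simpl; ring.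
Qed.
Lemma Nsq_scal a u : finsupp u -> Nsq (vscal a u) = Cmod a ^ 2 * Nsq u.
Proof.
  intros Hu; unfold Nsq; rewrite ip_scalr, ip_scall, ip_self; auto using finsupp_vscal.
  rewrite Cmod2_alt; unfold Re, Im; simpl; ring.
Qed.
(** The difference of the two sides is the squared norm of u - v. *)
Lemma Nsq_add_le u v : finsupp u -> finsupp v ->
  Nsq (vadd u v) <= 2 * Nsq u + 2 * Nsq v.
Proof.
  intros Hu Hv; pose proof (Nsq_add u v Hu Hv).
  pose proof (Nsq_nonneg _ (finsupp_vadd _ _ Hu (finsupp_vscal (RtoC (-1)) _ Hv))) as H0.
  rewrite Nsq_add, ip_scalr, Nsq_scal, Cmod_R in H0; auto using finsupp_vscal.
  simpl in H0; rewrite Rabs_left in H0; lra.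
Qed.

(** * Creation and annihilation operators *)

Definition an (m : mode) (u : vec) : vec :=
  fun c => (RtoC (sqrt (INR (S (c m)))) * u (cincr c m))%C.
Definition cr (m : mode) (u : vec) : vec :=
  fun c => (RtoC (sqrt (INR (c m))) * u (cdecr c m))%C.

Lemma mode_eqb_spec m m' : reflect (m = m') (mode_eqb m m').
Proof.
  destruct m as [[[a b] c] l], m' as [[[a' b'] c'] l']; simpl.
  destruct (Z.eqb_spec a a'), (Z.eqb_spec b b'), (Z.eqb_spec c c'), (Bool.eqb_spec l l');
    simpl; constructor; congruence.
Qed.
Lemma mode_eqb_refl m : mode_eqb m m = true.
Proof. destruct (mode_eqb_spec m m); congruence. Qed.

Ltac config_ext :=
  apply functional_extensionality; intro; unfold cincr, cdecr;
  repeat match goal with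
  | |- context [mode_eqb ?m ?m'] => destruct (mode_eqb_spec m m'); subst
  end; simpl; try congruence; try lia.

Lemma cdecr_cincr c m : cdecr (cincr c m) m = c.
Proof. config_ext. Qed.
Lemma cincr_cdecr c m : c m <> 0%nat -> cincr (cdecr c m) m = c.
Proof. intros H; config_ext. Qed.
Lemma cincr_comm c m m' : cincr (cincr c m) m' = cincr (cincr c m') m.
Proof. config_ext. Qed.
Lemma cdecr_comm c m m' : cdecr (cdecr c m) m' = cdecr (cdecr c m') m.
Proof. config_ext. Qed.
Lemma cincr_cdecr_comm c m m' : m <> m' -> cincr (cdecr c m) m' = cdecr (cincr c m') m.
Proof. intros H; config_ext. Qed.
Lemma cincr_same c m : cincr c m m = S (c m).
Proof. unfold cincr; now rewrite mode_eqb_refl. Qed.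
Lemma cdecr_same c m : cdecr c m m = Nat.pred (c m).
Proof. unfold cdecr; now rewrite mode_eqb_refl. Qed.
Lemma cincr_other c m m' : m <> m' -> cincr c m m' = c m'.
Proof. unfold cincr; destruct (mode_eqb_spec m m'); congruence. Qed.
Lemma cdecr_other c m m' : m <> m' -> cdecr c m m' = c m'.
Proof. unfold cdecr; destruct (mode_eqb_spec m m'); congruence. Qed.

Lemma sqrt_INR_0 : RtoC (sqrt (INR 0)) = 0%C.
Proof. simpl; now rewrite sqrt_0. Qed.
Lemma sqrt_INR_sqr n : (RtoC (sqrt (INR n)) * RtoC (sqrt (INR n)))%C = RtoC (INR n).
Proof. rewrite <- RtoC_mult, sqrt_sqrt; auto using pos_INR. Qed.

(** The configurations one photon away from [l]: a finite list that carries a field operator applied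
    to a vector supported in [l]. *)
Definition spread (ms : list mode) (l : list config) : list config :=
  flat_map (fun m => map (fun c => cdecr c m) l ++ map (fun c => cincr c m) l) ms.

Lemma supp_an ms m l u : In m ms -> supp_in l u -> supp_in (spread ms l) (an m u).
Proof.
  intros Hm Hl c Hc; apply in_flat_map; exists m; split; auto.
  apply in_or_app; left; rewrite <- (cdecr_cincr c m).
  apply (in_map (fun c => cdecr c m)), Hl.
  intros H; apply Hc; unfold an; rewrite H; ring.
Qed.
Lemma supp_cr ms m l u : In m ms -> supp_in l u -> supp_in (spread ms l) (cr m u).
Proof.
  intros Hm Hl c Hc; apply in_flat_map; exists m; split; auto.
  apply in_or_app; right; unfold cr in Hc.
  destruct (Nat.eq_dec (c m) 0) as [H0 | H0].
  { destruct Hc; rewrite H0, sqrt_INR_0; ring. }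
  rewrite <- (cincr_cdecr c m H0); apply (in_map (fun c => cincr c m)), Hl.
  intros H; apply Hc; rewrite H; ring.
Qed.
Lemma finsupp_an m u : finsupp u -> finsupp (an m u).
Proof. intros [l Hl]; exists (spread [m] l); apply supp_an; simpl; auto. Qed.
Lemma finsupp_cr m u : finsupp u -> finsupp (cr m u).
Proof. intros [l Hl]; exists (spread [m] l); apply supp_cr; simpl; auto. Qed.

(** Adjointness is the change of variables c -> [cincr c m]; configurations without a photon in m
    are not reached, but there the factor sqrt 0 of [cr] vanishes. *)
Lemma ip_an m u v : finsupp v -> ip (an m u) v = ip u (cr m v).
Proof.
  intros H; unfold ip; rewrite (fsum_reindex (fun c => cincr c m)
    (fun c => (Cconj (u c) * cr m v c)%C)).
  - apply fsum_ext; intros c; unfold an, cr.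
    rewrite cincr_same, cdecr_cincr, Cconj_mult, Cconj_R; ring.
  - intros x y E; rewrite <- (cdecr_cincr x m), E; apply cdecr_cincr.
  - intros c Hc; exists (cdecr c m); symmetry; apply cincr_cdecr; intros H0.
    apply Hc; unfold cr; rewrite H0, sqrt_INR_0; ring.
  - apply finsupp_ip_r; now apply finsupp_cr.
Qed.

Lemma an_cr_same m u : an m (cr m u) = vadd (cr m (an m u)) u.
Proof.
  apply functional_extensionality; intro c; unfold an, cr, vadd.
  rewrite cincr_same, cdecr_cincr, cdecr_same, Cmult_assoc, sqrt_INR_sqr.
  destruct (Nat.eq_dec (c m) 0) as [H0 | H0].
  - rewrite H0, sqrt_INR_0; simpl; ring.
  - rewrite cincr_cdecr, Nat.succ_pred, Cmult_assoc, sqrt_INR_sqr, S_INR, RtoC_plus by easy.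
    ring.
Qed.
Lemma an_cr_other m m' u : m <> m' -> an m (cr m' u) = cr m' (an m u).
Proof.
  intros H; apply functional_extensionality; intro c; unfold an, cr.
  rewrite cincr_other, cdecr_other, cincr_cdecr_comm by congruence; ring.
Qed.
Lemma an_comm m m' u : an m (an m' u) = an m' (an m u).
Proof.
  apply functional_extensionality; intro c; unfold an; rewrite cincr_comm.
  destruct (mode_eqb_spec m m') as [-> | H]; [reflexivity|].
  rewrite !cincr_other by congruence; ring.
Qed.
Lemma cr_comm m m' u : cr m (cr m' u) = cr m' (cr m u).
Proof.
  apply functional_extensionality; intro c; unfold cr; rewrite cdecr_comm.
  destruct (mode_eqb_spec m m') as [-> | H]; [reflexivity|].
  rewrite !cdecr_other by congruence; ring.
Qed.

(** * Smeared creation and annihilation operators and their commutation relations *)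

Section Field.
Variable ms : list mode.
Hypothesis Hms : NoDup ms.

(** One-photon wave functions in the mode basis. As usual a(f) is antilinear and a*(f) linear in
    f. *)
Definition wave := mode -> C.
Definition aF (f : wave) (u : vec) : vec :=
  fun c => csum ms (fun m => (Cconj (f m) * an m u c)%C).
Definition cF (f : wave) (u : vec) : vec :=
  fun c => csum ms (fun m => (f m * cr m u c)%C).
Definition wip (f g : wave) : C := csum ms (fun m => (Cconj (f m) * g m)%C).
Definition wnsq (f : wave) : R := rsum ms (fun m => Cmod (f m) ^ 2).
Definition wadd (f g : wave) : wave := fun m => (f m + g m)%C.
Definition wscal (a : C) (f : wave) : wave := fun m => (a * f m)%C.

Lemma supp_aF l f u : supp_in l u -> supp_in (spread ms l) (aF f u).
Proof.
  intros Hl c Hc; destruct (excluded_middle_informative (In c (spread ms l))) as [|Hn]; auto.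
  destruct Hc; unfold aF, cF. apply csum_zero; intros m Hm.
  destruct (excluded_middle_informative (an m u c = 0%C)) as [-> | H]; [ring|].
  destruct Hn; now apply (supp_an ms m l u).
Qed.
Lemma supp_cF l f u : supp_in l u -> supp_in (spread ms l) (cF f u).
Proof.
  intros Hl c Hc; destruct (excluded_middle_informative (In c (spread ms l))) as [|Hn]; auto.
  destruct Hc; unfold aF, cF. apply csum_zero; intros m Hm.
  destruct (excluded_middle_informative (cr m u c = 0%C)) as [-> | H]; [ring|].
  destruct Hn; now apply (supp_cr ms m l u).
Qed.
Lemma finsupp_aF f u : finsupp u -> finsupp (aF f u).
Proof. intros [l Hl]; exists (spread ms l); now apply supp_aF. Qed.
Lemma finsupp_cF f u : finsupp u -> finsupp (cF f u).
Proof. intros [l Hl]; exists (spread ms l); now apply supp_cF. Qed.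

Lemma aF_add f u v : aF f (vadd u v) = vadd (aF f u) (aF f v).
Proof.
  apply functional_extensionality; intro c; unfold aF, vadd; rewrite <- csum_plus.
  apply csum_ext; intros; unfold an; ring.
Qed.
Lemma aF_scal f a u : aF f (vscal a u) = vscal a (aF f u).
Proof.
  apply functional_extensionality; intro c; unfold aF, vscal; rewrite <- csum_scal.
  apply csum_ext; intros; unfold an; ring.
Qed.
Lemma cF_add f u v : cF f (vadd u v) = vadd (cF f u) (cF f v).
Proof.
  apply functional_extensionality; intro c; unfold cF, vadd; rewrite <- csum_plus.
  apply csum_ext; intros; unfold cr; ring.
Qed.
Lemma cF_scal f a u : cF f (vscal a u) = vscal a (cF f u).
Proof.
  apply functional_extensionality; intro c; unfold cF, vscal; rewrite <- csum_scal.
  apply csum_ext; intros; unfold cr; ring.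
Qed.
Lemma aF_zero f : aF f vzero = vzero.
Proof.
  apply functional_extensionality; intro c; unfold aF, cF; apply csum_zero; intros.
  unfold an, vzero; ring.
Qed.
Lemma cF_zero f : cF f vzero = vzero.
Proof.
  apply functional_extensionality; intro c; unfold aF, cF; apply csum_zero; intros.
  unfold cr, vzero; ring.
Qed.
Lemma aF_wadd f g u : aF (wadd f g) u = vadd (aF f u) (aF g u).
Proof.
  apply functional_extensionality; intro c; unfold aF, vadd; rewrite <- csum_plus.
  apply csum_ext; intros; unfold wadd; rewrite Cconj_plus; ring.
Qed.
Lemma cF_wadd f g u : cF (wadd f g) u = vadd (cF f u) (cF g u).
Proof.
  apply functional_extensionality; intro c; unfold cF, vadd; rewrite <- csum_plus.
  apply csum_ext; intros; unfold wadd; ring.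
Qed.
Lemma aF_wscal a f u : aF (wscal a f) u = vscal (Cconj a) (aF f u).
Proof.
  apply functional_extensionality; intro c; unfold aF, vscal; rewrite <- csum_scal.
  apply csum_ext; intros; unfold wscal; rewrite Cconj_mult; ring.
Qed.
Lemma cF_wscal a f u : cF (wscal a f) u = vscal a (cF f u).
Proof.
  apply functional_extensionality; intro c; unfold cF, vscal; rewrite <- csum_scal.
  apply csum_ext; intros; unfold wscal; ring.
Qed.

Lemma wip_addr f g h : wip f (wadd g h) = (wip f g + wip f h)%C.
Proof. unfold wip; rewrite <- csum_plus; apply csum_ext; intros; unfold wadd; ring. Qed.
Lemma wip_addl f g h : wip (wadd f g) h = (wip f h + wip g h)%C.
Proof.
  unfold wip; rewrite <- csum_plus; apply csum_ext; intros; unfold wadd.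
  rewrite Cconj_plus; ring.
Qed.
Lemma wip_scalr f a g : wip f (wscal a g) = (a * wip f g)%C.
Proof. unfold wip; rewrite <- csum_scal; apply csum_ext; intros; unfold wscal; ring. Qed.
Lemma wip_scall f a g : wip (wscal a f) g = (Cconj a * wip f g)%C.
Proof.
  unfold wip; rewrite <- csum_scal; apply csum_ext; intros; unfold wscal.
  rewrite Cconj_mult; ring.
Qed.
Lemma wip_conj f g : Cconj (wip f g) = wip g f.
Proof.
  unfold wip; rewrite <- csum_conj; apply csum_ext; intros.
  rewrite Cconj_mult, Cconj_Cconj; ring.
Qed.
Lemma wip_self f : wip f f = RtoC (wnsq f).
Proof.
  unfold wnsq; rewrite <- csum_RtoC; apply csum_ext; intros; apply Cconj_mult_self.
Qed.
Lemma wnsq_nonneg f : 0 <= wnsq f.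
Proof. apply rsum_nonneg; intros; apply pow2_ge_0. Qed.

Lemma ip_csum_l {S : Type} (l : list S) (F : S -> vec) v : finsupp v ->
  ip (fun c => csum l (fun s => F s c)) v = csum l (fun s => ip (F s) v).
Proof.
  intros Hv; unfold ip.
  rewrite <- (proj2 (fsum_csum l (fun s c => (Cconj (F s c) * v c)%C)
    (fun s _ => finsupp_ip_r _ _ Hv))).
  apply fsum_ext; intros c; rewrite <- csum_conj, Cmult_comm, <- csum_scal.
  apply csum_ext; intros; ring.
Qed.
Lemma ip_csum_r {S : Type} (l : list S) (F : S -> vec) u : finsupp u ->
  ip u (fun c => csum l (fun s => F s c)) = csum l (fun s => ip u (F s)).
Proof.
  intros Hu; unfold ip.
  rewrite <- (proj2 (fsum_csum l (fun s c => (Cconj (u c) * F s c)%C)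
    (fun s _ => finsupp_ip_l _ _ Hu))).
  apply fsum_ext; intros c; rewrite <- csum_scal; reflexivity.
Qed.

Lemma ip_aF f u v : finsupp u -> finsupp v -> ip (aF f u) v = ip u (cF f v).
Proof.
  intros Hu Hv; unfold aF, cF.
  rewrite (ip_csum_l ms (fun m => vscal (Cconj (f m)) (an m u))) by auto.
  rewrite (ip_csum_r ms (fun m => vscal (f m) (cr m v))) by auto.
  apply csum_ext; intros m _; rewrite ip_scall, ip_scalr, Cconj_Cconj, ip_an;
    auto using finsupp_an.
Qed.
Lemma ip_cF f u v : finsupp u -> finsupp v -> ip (cF f u) v = ip u (aF f v).
Proof.
  intros Hu Hv; rewrite <- (ip_conj v), <- (ip_conj (aF f v)), ip_aF;
    auto using finsupp_aF, finsupp_cF.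
Qed.

Lemma aF_comm f g u : aF f (aF g u) = aF g (aF f u).
Proof.
  apply functional_extensionality; intro c; unfold aF.
  transitivity (csum ms (fun m => csum ms (fun m' =>
    (Cconj (f m) * Cconj (g m') * an m (an m' u) c)%C))).
  - apply csum_ext; intros m _; unfold an at 1.
    rewrite <- csum_scal, <- csum_scal; apply csum_ext; intros; unfold an; ring.
  - rewrite csum_exchange; apply csum_ext; intros m _; unfold an at 3.
    rewrite <- csum_scal, <- csum_scal; apply csum_ext; intros m' _.
    rewrite an_comm; unfold an; ring.
Qed.
Lemma cF_comm f g u : cF f (cF g u) = cF g (cF f u).
Proof.
  apply functional_extensionality; intro c; unfold cF.
  transitivity (csum ms (fun m => csum ms (fun m' =>
    (f m * g m' * cr m (cr m' u) c)%C))).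
  - apply csum_ext; intros m _; unfold cr at 1.
    rewrite <- csum_scal, <- csum_scal; apply csum_ext; intros; unfold cr; ring.
  - rewrite csum_exchange; apply csum_ext; intros m _; unfold cr at 3.
    rewrite <- csum_scal, <- csum_scal; apply csum_ext; intros m' _.
    rewrite cr_comm; unfold cr; ring.
Qed.
(** The canonical commutation relation. The modes in [ms] being distinct, each m meets exactly one
    equal m' in the double sum, and these diagonal terms make up [wip f g]. *)
Lemma aF_cF f g u : aF f (cF g u) = vadd (cF g (aF f u)) (vscal (wip f g) u).
Proof.
  apply functional_extensionality; intro c; unfold aF, cF, vadd, vscal, wip.
  transitivity (csum ms (fun m => csum ms (fun m' =>
    (Cconj (f m) * g m' * an m (cr m' u) c)%C))).
  { apply csum_ext; intros m _; unfold an at 1.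
    rewrite <- csum_scal, <- csum_scal; apply csum_ext; intros; unfold an; ring. }
  transitivity (csum ms (fun m => csum ms (fun m' =>
    (Cconj (f m) * g m' * cr m' (an m u) c)%C)) + csum ms (fun m => Cconj (f m) * g m * u c))%C.
  - rewrite <- csum_plus; apply csum_ext; intros m Hm.
    replace (Cconj (f m) * g m * u c)%C with
      (csum ms (fun m' => if mode_eqb m m' then Cconj (f m) * g m' * u c else 0)%C).
    + rewrite <- csum_plus; apply csum_ext; intros m' _.
      destruct (mode_eqb_spec m m') as [<- | H].
      * rewrite an_cr_same; unfold vadd; ring.
      * rewrite an_cr_other by auto; ring.
    + rewrite (csum_single ms _ m); auto; [now rewrite mode_eqb_refl|].
      intros m' H; destruct (mode_eqb_spec m m'); congruence.
  - f_equal.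
    + rewrite csum_exchange; apply csum_ext; intros m _; unfold cr at 2.
      rewrite <- csum_scal, <- csum_scal; apply csum_ext; intros m' _; unfold cr; ring.
    + rewrite Cmult_comm, <- csum_scal; apply csum_ext; intros; ring.
Qed.
End Field.

Lemma vadd_zero_r u : vadd u vzero = u.
Proof. vring. Qed.
Lemma vadd_zero_l u : vadd vzero u = u.
Proof. vring. Qed.
Lemma vscal_zero a : vscal a vzero = vzero.
Proof. vring. Qed.

Lemma rsum_seq_S n f : rsum (seq 0 (S n)) f = rsum (seq 0 n) f + f n.
Proof. rewrite seq_S, rsum_app; unfold rsum at 2; simpl; ring. Qed.

(** * Squeezed states *)

Definition vac : vec :=
  fun c => if excluded_middle_informative (c = fun _ => 0%nat) then 1%C else 0%C.

Lemma supp_vac : supp_in [fun _ => 0%nat] vac.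
Proof.
  intros c Hc; unfold vac in Hc; destruct excluded_middle_informative as [-> | _]; simpl; auto.
Qed.
Lemma finsupp_vac : finsupp vac.
Proof. eexists; apply supp_vac. Qed.
Lemma Nsq_vac : Nsq vac = 1.
Proof.
  rewrite (Nsq_list [fun _ => 0%nat]); [| repeat constructor; easy | apply supp_vac].
  unfold rsum, vac; simpl; destruct excluded_middle_informative; [rewrite Cmod_1; ring | easy].
Qed.

Section Squeeze.
Variable ms : list mode.
Hypothesis Hms : NoDup ms.
Notation aF := (aF ms).
Notation cF := (cF ms).
Notation wip := (wip ms).
Notation wnsq := (wnsq ms).

Lemma aF_vac f : aF f vac = vzero.
Proof.
  apply functional_extensionality; intro c; unfold aF; apply csum_zero; intros m _.
  unfold an, vac; destruct excluded_middle_informative as [H | _]; [| ring].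
  assert (H0 := f_equal (fun c => c m) H); cbv beta in H0; rewrite cincr_same in H0; discriminate.
Qed.
Lemma Nsq_cF_vac f : Nsq (cF f vac) = wnsq f.
Proof.
  unfold Nsq; rewrite ip_cF, aF_cF, aF_vac, cF_zero, vadd_zero_l, ip_scalr, wip_self, ip_self;
    auto using finsupp_vac, finsupp_cF.
  rewrite Nsq_vac; simpl; ring.
Qed.

(* [excite e n u] is [(a*(e))^n u / sqrt n!]. *)
Fixpoint excite (e : wave) (n : nat) (u : vec) : vec :=
  match n with
  | O => u
  | S n => vscal (RtoC (/ sqrt (INR (S n)))) (cF e (excite e n u))
  end.

Fixpoint superpose (e : wave) (g : nat -> R) (N : nat) (u : vec) : vec :=
  match N with
  | O => vzero
  | S n => vadd (superpose e g n u) (vscal (RtoC (g n)) (excite e n u))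
  end.

(** Annihilation and creation in the direction e, read off on the amplitudes of [superpose e]; their
    sum is the quadrature of e. *)
Definition lower (g : nat -> R) (n : nat) : R := sqrt (INR (S n)) * g (S n).
Definition raise (g : nat -> R) (n : nat) : R :=
  match n with O => 0 | S k => sqrt (INR n) * g k end.

Lemma sqrt_S_pos n : 0 < sqrt (INR (S n)).
Proof. apply sqrt_lt_R0, lt_0_INR; lia. Qed.
Lemma sqrt_S_sqr n : sqrt (INR (S n)) * sqrt (INR (S n)) = INR n + 1.
Proof. rewrite sqrt_sqrt, S_INR; [ring | apply pos_INR]. Qed.

Lemma finsupp_excite e n u : finsupp u -> finsupp (excite e n u).
Proof. intros; induction n; simpl; auto using finsupp_vscal, finsupp_cF. Qed.
Lemma finsupp_superpose e g N u : finsupp u -> finsupp (superpose e g N u).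
Proof.
  intros; induction N; simpl;
    auto using finsupp_vzero, finsupp_vadd, finsupp_vscal, finsupp_excite.
Qed.

Lemma cF_excite e n u : cF e (excite e n u) = vscal (RtoC (sqrt (INR (S n)))) (excite e (S n) u).
Proof.
  apply functional_extensionality; intro c; cbn [excite]; unfold vscal.
  rewrite Cmult_assoc, <- RtoC_mult, Rinv_r by apply Rgt_not_eq, sqrt_S_pos; ring.
Qed.
Lemma cF_excite_comm e g n u : cF g (excite e n u) = excite e n (cF g u).
Proof. induction n; cbn [excite]; [easy|]; rewrite cF_scal, cF_comm, IHn; auto. Qed.

(** Commuting a(g) through the power of a*(e) produces n + 1 equal terms; the normalization of
    [excite] turns the factor n + 1 into its square root. *)
Lemma aF_excite e g n u :
  aF g (excite e (S n) u) =
  vadd (excite e (S n) (aF g u)) (vscal (RtoC (sqrt (INR (S n))) * wip g e)%C (excite e n u)).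
Proof.
  induction n.
  - cbn [excite]; rewrite aF_scal, aF_cF by auto.
    replace (INR 1) with 1 by reflexivity; rewrite sqrt_1, Rinv_1; vring.
  - assert (E : forall v, excite e (S (S n)) v =
      vscal (RtoC (/ sqrt (INR (S (S n))))) (cF e (excite e (S n) v))) by reflexivity.
    rewrite !E; clear E.
    rewrite aF_scal, aF_cF, IHn, cF_add, cF_scal, (cF_excite e n u) by auto.
    apply functional_extensionality; intro c; unfold vadd, vscal.
    pose proof (sqrt_S_pos (S n)).
    set (w := wip g e); set (z := excite e (S n) u c).
    replace (RtoC (sqrt (INR (S n))) * w * (RtoC (sqrt (INR (S n))) * z))%C with
      (RtoC (INR n + 1) * w * z)%C by (rewrite <- sqrt_S_sqr, RtoC_mult; ring).
    replace (RtoC (sqrt (INR (S (S n))))) with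
      (RtoC (/ sqrt (INR (S (S n))) * (INR n + 1 + 1))).
    + rewrite RtoC_mult, !RtoC_plus; ring.
    + f_equal; rewrite <- S_INR, <- sqrt_S_sqr; field; lra.
Qed.

Lemma excite_add e n u v : excite e n (vadd u v) = vadd (excite e n u) (excite e n v).
Proof.
  induction n; cbn [excite]; [easy|]; rewrite IHn, cF_add; vring.
Qed.
Lemma superpose_add e g N u v :
  superpose e g N (vadd u v) = vadd (superpose e g N u) (superpose e g N v).
Proof.
  induction N; cbn [superpose]; [vring|]; rewrite IHN, excite_add; vring.
Qed.
Lemma superpose_plus e g h N u :
  superpose e (fun n => g n + h n) N u = vadd (superpose e g N u) (superpose e h N u).
Proof.
  induction N; cbn [superpose]; [vring|]; rewrite IHN.
  apply functional_extensionality; intro c; unfold vadd, vscal; rewrite RtoC_plus; ring.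
Qed.
Lemma excite_zero e n : excite e n vzero = vzero.
Proof. induction n; cbn [excite]; [easy|]; rewrite IHn, cF_zero, vscal_zero; easy. Qed.
Lemma superpose_zero e g N : superpose e g N vzero = vzero.
Proof.
  induction N; cbn [superpose]; [easy|]; rewrite IHN, excite_zero, vscal_zero; apply vadd_zero_r.
Qed.

Lemma cF_superpose_comm e g f N u : cF f (superpose e g N u) = superpose e g N (cF f u).
Proof.
  induction N; cbn [superpose]; [apply cF_zero|].
  rewrite cF_add, cF_scal, IHN, cF_excite_comm; easy.
Qed.
Lemma cF_superpose e g N u : cF e (superpose e g N u) = superpose e (raise g) (S N) u.
Proof.
  induction N.
  - cbn [superpose excite raise]; rewrite cF_zero; vring.
  - cbn [superpose] in *; rewrite cF_add, cF_scal, IHN, cF_excite.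
    cbn [superpose raise]; apply functional_extensionality; intro c; unfold vadd, vscal.
    rewrite !RtoC_mult; ring.
Qed.
Lemma aF_superpose e g f N u :
  aF f (superpose e g (S N) u) =
  vadd (superpose e g (S N) (aF f u)) (vscal (wip f e) (superpose e (lower g) N u)).
Proof.
  induction N.
  - cbn [superpose excite]; rewrite aF_add, aF_zero, aF_scal; vring.
  - remember (S N) as M; cbn [superpose]; rewrite aF_add, aF_scal, IHN; subst M.
    rewrite aF_excite; cbn [superpose]; unfold lower.
    apply functional_extensionality; intro c; unfold vadd, vscal.
    rewrite !RtoC_mult; ring.
Qed.

Section OneMode.
Variable e : wave.
Hypothesis He : wip e e = 1%C.

(** Number states of the direction e are orthonormal on top of any vectors annihilated by a(e), not
    only of the vacuum; this permits squeezing one direction after another. *)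
Lemma ip_excite n k u v : finsupp u -> finsupp v -> aF e u = vzero -> aF e v = vzero ->
  ip (excite e n u) (excite e k v) = if Nat.eqb n k then ip u v else 0%C.
Proof.
  intros Hu Hv Hau Hav.
  assert (H0 : forall n u v, finsupp u -> finsupp v -> aF e v = vzero ->
    ip (excite e (S n) u) v = 0%C).
  { clear -ms Hms; intros n u v Hu Hv Hav; cbn [excite].
    rewrite ip_scall, ip_cF, Hav, ip_zeror; auto using finsupp_cF, finsupp_excite; ring. }
  revert k; induction n; intros [|k]; cbn [Nat.eqb]; auto.
  - change (excite e 0 u) with u; rewrite <- ip_conj, H0 by auto using finsupp_excite.
    apply Cconj_0.
  - change (excite e (S n) u) with (vscal (RtoC (/ sqrt (INR (S n)))) (cF e (excite e n u))).
    rewrite ip_scall, ip_cF, aF_excite, Hav, excite_zero, vadd_zero_l, ip_scalr, He, IHn;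
      auto using finsupp_cF, finsupp_excite.
    destruct (Nat.eqb_spec n k) as [<- | _]; [| ring].
    rewrite Cconj_R, Cmult_1_r, Cmult_assoc, <- RtoC_mult, Rinv_l;
      [ring | apply Rgt_not_eq, sqrt_S_pos].
Qed.

Lemma ip_superpose_excite g N k u v : finsupp u -> finsupp v -> aF e u = vzero -> aF e v = vzero ->
  (N <= k)%nat -> ip (superpose e g N u) (excite e k v) = 0%C.
Proof.
  intros Hu Hv Hau Hav; induction N; intros Hk; cbn [superpose]; [apply ip_zerol|].
  rewrite ip_addl, ip_scall, IHN, ip_excite; auto using finsupp_excite; [|lia].
  destruct (Nat.eqb_spec N k); [lia|]; ring.
Qed.

Lemma ip_superpose g h N u v : finsupp u -> finsupp v -> aF e u = vzero -> aF e v = vzero ->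
  ip (superpose e g N u) (superpose e h N v) =
  (RtoC (rsum (seq 0 N) (fun n => g n * h n)%R) * ip u v)%C.
Proof.
  intros Hu Hv Hau Hav; induction N.
  - cbn [superpose]; rewrite ip_zerol; unfold rsum; simpl; ring.
  - rewrite rsum_seq_S; cbn [superpose].
    rewrite ip_addl, !ip_addr, !ip_scalr, !ip_scall, IHN, ip_superpose_excite;
      auto using finsupp_vadd, finsupp_vscal, finsupp_excite, finsupp_superpose.
    rewrite <- (ip_conj (superpose e h N v)), ip_superpose_excite, ip_excite, Nat.eqb_refl;
      auto using finsupp_superpose.
    rewrite Cconj_0, Cconj_R, RtoC_plus, RtoC_mult; ring.
Qed.
Lemma Nsq_superpose g N u : finsupp u -> aF e u = vzero ->
  Nsq (superpose e g N u) = rsum (seq 0 N) (fun n => g n ^ 2) * Nsq u.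
Proof.
  intros; unfold Nsq; rewrite ip_superpose, ip_self by auto.
  rewrite (rsum_ext _ _ (fun n => g n ^ 2)); [|intros; ring]; simpl; ring.
Qed.
End OneMode.

Fixpoint orthonormal (es : list wave) : Prop :=
  match es with
  | [] => True
  | e :: l => wip e e = 1%C /\ (forall e', In e' l -> wip e e' = 0%C) /\ orthonormal l
  end.

(* Waves are compared on the modes of [ms] only. *)
Fixpoint rspan (es : list wave) (w : wave) : Prop :=
  match es with
  | [] => forall m, In m ms -> w m = 0%C
  | e :: l => exists (r : R) (w' : wave), rspan l w' /\
      forall m, In m ms -> w m = (RtoC r * e m + w' m)%C
  end.

Variables (g : nat -> R) (M : nat).
Hypothesis g_vanish : forall n, (M <= n)%nat -> g n = 0.
(** Neighbouring photon numbers are never both occupied, so shifting the photon number by one leads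
    to orthogonal amplitudes and no cross terms survive. The profile used below lives on the even
    numbers. *)
Hypothesis g_sparse : forall n, g n * g (S n) = 0.
(** One place more than the support of [g], so that the raised amplitudes still fit. Of the one-mode
    state with amplitudes [g], [nu] is the squared norm, [sq] the second moment of the quadrature
    and [mu] the photon number, the last two not divided by [nu]. *)
Notation L := (S M).
Let nu := rsum (seq 0 L) (fun n => g n ^ 2).
Let sq := rsum (seq 0 L) (fun n => (lower g n + raise g n) ^ 2).
Let mu := rsum (seq 0 L) (fun n => lower g n ^ 2).

Fixpoint squeezed (es : list wave) : vec :=
  match es with [] => vac | e :: l => superpose e g L (squeezed l) end.

Lemma finsupp_squeezed es : finsupp (squeezed es).
Proof. induction es; [apply finsupp_vac | now apply finsupp_superpose]. Qed.

Lemma aF_superpose_full e f u :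
  aF f (superpose e g L u) =
  vadd (superpose e g L (aF f u)) (vscal (wip f e) (superpose e (lower g) L u)).
Proof.
  rewrite aF_superpose; do 2 f_equal; cbn [superpose].
  replace (lower g M) with 0 by (unfold lower; rewrite g_vanish by lia; ring); vring.
Qed.
Lemma cF_superpose_full e u : cF e (superpose e g L u) = superpose e (raise g) L u.
Proof.
  rewrite cF_superpose; remember L as K; cbn [superpose]; subst K.
  cbn [raise]; rewrite (g_vanish M), Rmult_0_r by lia; vring.
Qed.

(** An annihilator orthogonal to all of [es] passes the excitations and meets the vacuum. In
    particular each new orthogonal direction finds the vector built so far annihilated, as
    [Nsq_superpose] requires. *)
Lemma aF_squeezed es f : (forall e, In e es -> wip f e = 0%C) -> aF f (squeezed es) = vzero.
Proof.
  induction es as [|e l IH]; intros H; [apply aF_vac|]; cbn [squeezed].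
  rewrite aF_superpose_full, IH, superpose_zero, (H e); simpl; auto.
  - vring.
  - intros; apply H; simpl; auto.
Qed.

Lemma Nsq_squeezed es : orthonormal es -> Nsq (squeezed es) = nu ^ length es.
Proof.
  induction es as [|e l IH]; intros H; [apply Nsq_vac|]; destruct H as [H1 [H2 H3]].
  cbn [squeezed]; rewrite Nsq_superpose, IH;
    auto using finsupp_squeezed, aF_squeezed.
Qed.

Lemma lower_raise_orth : rsum (seq 0 L) (fun n => (lower g n + raise g n) * g n) = 0.
Proof.
  apply rsum_zero; intros n _; unfold lower, raise.
  pose proof (g_sparse n); destruct n.
  - replace ((sqrt (INR 1) * g 1%nat + 0) * g 0%nat) with (sqrt (INR 1) * (g 0%nat * g 1%nat)) by ring.
    rewrite H; ring.
  - pose proof (g_sparse n).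
    replace ((sqrt (INR (S (S n))) * g (S (S n)) + sqrt (INR (S n)) * g n) * g (S n)) with
      (sqrt (INR (S (S n))) * (g (S n) * g (S (S n))) + sqrt (INR (S n)) * (g n * g (S n))) by ring.
    rewrite H, H0; ring.
Qed.
Lemma lower_orth : rsum (seq 0 L) (fun n => g n * lower g n) = 0.
Proof.
  apply rsum_zero; intros n _; unfold lower.
  replace (g n * (sqrt (INR (S n)) * g (S n))) with (sqrt (INR (S n)) * (g n * g (S n))) by ring.
  rewrite g_sparse; ring.
Qed.

Definition field (f : wave) (u : vec) : vec := vadd (aF f u) (cF f u).

Lemma finsupp_field f u : finsupp u -> finsupp (field f u).
Proof. intros; apply finsupp_vadd; auto using finsupp_aF, finsupp_cF. Qed.

(** For real c the field of c e is c times the quadrature of e and acts on the amplitudes alone,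
    while the field of f, orthogonal to e, passes through the superposition. The two resulting
    vectors are orthogonal by [lower_raise_orth]. *)
Lemma Nsq_field_superpose e f (c : R) u : wip e e = 1%C -> wip e f = 0%C ->
  finsupp u -> aF e u = vzero ->
  Nsq (field (wadd (wscal (RtoC c) e) f) (superpose e g L u)) =
  c ^ 2 * (sq * Nsq u) + nu * Nsq (field f u).
Proof.
  intros He Hf Hu Hau.
  assert (Hfe : wip f e = 0%C) by (rewrite <- wip_conj, Hf; apply Cconj_0).
  set (h n := lower g n + raise g n).
  assert (E : field (wadd (wscal (RtoC c) e) f) (superpose e g L u) =
    vadd (vscal (RtoC c) (superpose e h L u)) (superpose e g L (field f u))).
  { unfold field; rewrite aF_wadd, cF_wadd, aF_wscal, cF_wscal, !aF_superpose_full,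
      cF_superpose_full, cF_superpose_comm, He, Hfe, Hau, superpose_zero, Cconj_R.
    rewrite superpose_add; unfold h; rewrite superpose_plus; vring. }
  assert (Hk : aF e (field f u) = vzero).
  { unfold field; rewrite aF_add, aF_comm, aF_cF, Hau, aF_zero, cF_zero, Hf by auto; vring. }
  rewrite E, Nsq_add, Nsq_scal, !Nsq_superpose, ip_scall, ip_superpose;
    auto using finsupp_vscal, finsupp_superpose, finsupp_field.
  change (rsum (seq 0 L) (fun n => h n * g n)) with
    (rsum (seq 0 L) (fun n => (lower g n + raise g n) * g n)).
  rewrite lower_raise_orth, Cmod_R, <- Rsqr_pow2, <- Rsqr_abs.
  unfold sq, nu, h; rewrite Cmult_0_l, Cmult_0_r; unfold Rsqr; simpl; ring.
Qed.

Lemma wip_rspan_0 f es w : (forall e, In e es -> wip f e = 0%C) -> rspan es w -> wip f w = 0%C.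
Proof.
  revert w; induction es as [|e l IH]; intros w H Hw.
  - apply csum_zero; intros m Hm; rewrite Hw by auto; ring.
  - destruct Hw as [r [w' [Hw' E]]].
    transitivity (wip f (wadd (wscal (RtoC r) e) w')).
    + apply csum_ext; intros m Hm; rewrite E by auto; reflexivity.
    + rewrite wip_addr, wip_scalr, (H e), IH; simpl; auto; [ring|].
      intros; apply H; simpl; auto.
Qed.

Lemma wnsq_pythagoras e f (c : R) : wip e e = 1%C -> wip e f = 0%C ->
  wnsq (wadd (wscal (RtoC c) e) f) = c ^ 2 + wnsq f.
Proof.
  intros He Hf.
  assert (H : RtoC (wnsq (wadd (wscal (RtoC c) e) f)) = RtoC (c ^ 2 + wnsq f)).
  { rewrite <- wip_self, wip_addl, !wip_addr, !wip_scall, !wip_scalr, He, Hf.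
    rewrite <- (wip_conj ms e f), Hf, Cconj_0, Cconj_R, wip_self, RtoC_plus.
    simpl; rewrite !RtoC_mult; ring. }
  now injection H.
Qed.

(* The quadratures along [es] are squeezed; the part of [f] outside the real span
   of [es] only sees the vacuum. *)
Lemma Nsq_field_squeezed s es f w :
  0 < nu -> sq <= s * nu -> orthonormal es -> (forall e, In e es -> snd (wip e f) = 0) ->
  rspan es w ->
  Nsq (field f (squeezed es)) <=
  Nsq (squeezed es) * (s * wnsq f + wnsq (wadd f (wscal (RtoC (-1)) w))).
Proof.
  intros Hnu Hs; revert f w; induction es as [|e l IH]; intros f w HO Hf Hw.
  - cbn [squeezed]; unfold field; rewrite aF_vac, vadd_zero_l, Nsq_cF_vac, Nsq_vac.
    assert (0 <= s) by (assert (0 <= sq) by (apply rsum_nonneg; intros; apply pow2_ge_0); nra).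
    pose proof (wnsq_nonneg ms f).
    replace (wnsq (wadd f (wscal (RtoC (-1)) w))) with (wnsq f); [nra|].
    apply rsum_ext; intros m Hm; unfold wadd, wscal; rewrite Hw by auto.
    f_equal; f_equal; ring.
  - destruct HO as [He [Hel HO]], Hw as [r [w' [Hw' E]]].
    set (c := fst (wip e f)).
    assert (Hc : wip e f = RtoC c) by (apply C_eq; [reflexivity | apply Hf; simpl; auto]).
    set (f' := wadd f (wscal (RtoC (- c)) e)).
    assert (Ef : f = wadd (wscal (RtoC c) e) f').
    { apply functional_extensionality; intro m; unfold f', wadd, wscal; rewrite RtoC_opp; ring. }
    assert (Hef' : wip e f' = 0%C).
    { unfold f'; rewrite wip_addr, wip_scalr, He, Hc, RtoC_opp; ring. }
    assert (Hk : aF e (squeezed l) = vzero) by now apply aF_squeezed.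
    rewrite Ef; cbn [squeezed]; rewrite Nsq_field_superpose, wnsq_pythagoras, Nsq_superpose;
      auto using finsupp_squeezed.
    change (rsum (seq 0 L) (fun n => g n ^ 2)) with nu.
    (* Pythagoras: the distance from [f] to [w] splits into (c - r)^2 along [e] and the distance
       from [f'] to [w']. The former only helps and is discarded in the end. *)
    replace (wnsq (wadd (wadd (wscal (RtoC c) e) f') (wscal (RtoC (-1)) w))) with
      (wnsq (wadd (wscal (RtoC (c - r)) e) (wadd f' (wscal (RtoC (-1)) w')))).
    2: { apply rsum_ext; intros m Hm; unfold wadd, wscal; rewrite E by auto.
         f_equal; f_equal; rewrite RtoC_minus; ring. }
    rewrite wnsq_pythagoras; auto.
    2: { rewrite wip_addr, wip_scalr, Hef', (wip_rspan_0 e l); auto; ring. }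
    specialize (IH f' w' HO).
    pose proof (Nsq_nonneg _ (finsupp_squeezed l)).
    assert (Nsq (field f' (squeezed l)) <=
      Nsq (squeezed l) * (s * wnsq f' + wnsq (wadd f' (wscal (RtoC (-1)) w')))).
    { apply IH; auto; intros e' He'; unfold f'; rewrite wip_addr, wip_scalr.
      rewrite <- (wip_conj ms e e'), Hel, Cconj_0, Cmult_0_r by auto; simpl.
      rewrite (Hf e') by (simpl; auto); ring. }
    pose proof (pow2_ge_0 (c - r)).
    assert (c ^ 2 * (sq * Nsq (squeezed l)) <= nu * Nsq (squeezed l) * (s * c ^ 2)).
    { replace (nu * Nsq (squeezed l) * (s * c ^ 2)) with (c ^ 2 * (s * nu * Nsq (squeezed l))) by ring.
      apply Rmult_le_compat_l; [apply pow2_ge_0|]; now apply Rmult_le_compat_r. }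
    assert (0 <= nu * Nsq (squeezed l) * (c - r) ^ 2)
      by (apply Rmult_le_pos; [apply Rmult_le_pos; lra | auto]).
    pose proof (Rmult_le_compat_l nu _ _ (Rlt_le _ _ Hnu) H0).
    lra.
Qed.

Definition single (m : mode) : wave := fun m' => if mode_eqb m m' then 1%C else 0%C.

Lemma aF_single m u : In m ms -> aF (single m) u = an m u.
Proof.
  intros Hm; apply functional_extensionality; intro c; unfold aF, single.
  rewrite (csum_single ms _ m); auto.
  - rewrite mode_eqb_refl; apply C_eq; simpl; ring.
  - intros m' H; destruct (mode_eqb_spec m m'); [congruence|].
    rewrite Cconj_0; ring.
Qed.
Lemma wip_single m f : In m ms -> wip (single m) f = f m.
Proof.
  intros Hm; unfold wip, single.
  rewrite (csum_single ms _ m); auto.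
  - rewrite mode_eqb_refl; apply C_eq; simpl; ring.
  - intros m' H; destruct (mode_eqb_spec m m'); [congruence|].
    rewrite Cconj_0; ring.
Qed.

(** Each squeezed direction adds the mean photon number mu / nu of its one-mode state: spread over
    the modes it contributes |e m|^2, and these weights sum to one. *)
Lemma number_squeezed es : 0 < nu -> orthonormal es ->
  rsum ms (fun m => Nsq (an m (squeezed es))) =
  INR (length es) * (mu / nu) * Nsq (squeezed es).
Proof.
  intros Hnu; induction es as [|e l IH]; intros HO.
  - rewrite rsum_zero; [simpl; ring|]; intros m Hm.
    rewrite <- aF_single by auto; cbn [squeezed]; rewrite aF_vac.
    unfold Nsq; now rewrite ip_zerol.
  - destruct HO as [He [Hel HO]].
    assert (Hk : aF e (squeezed l) = vzero) by now apply aF_squeezed.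
    transitivity (rsum ms (fun m => nu * Nsq (an m (squeezed l)) +
      mu * Nsq (squeezed l) * Cmod (e m) ^ 2)).
    + apply rsum_ext; intros m Hm.
      rewrite <- !aF_single by auto; cbn [squeezed]; rewrite aF_superpose_full.
      assert (Hk' : aF e (aF (single m) (squeezed l)) = vzero) by now rewrite aF_comm, Hk, aF_zero.
      rewrite Nsq_add, Nsq_scal, !Nsq_superpose, ip_scalr, ip_superpose, lower_orth, wip_single;
        auto using finsupp_vscal, finsupp_superpose, finsupp_aF, finsupp_squeezed.
      unfold mu, nu; rewrite Cmult_0_l, Cmult_0_r; simpl; ring.
    + rewrite rsum_plus, !rsum_scal, IH by auto.
      change (rsum ms (fun m => Cmod (e m) ^ 2)) with (wnsq e).
      assert (H : RtoC (wnsq e) = RtoC 1) by (rewrite <- wip_self; exact He).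
      apply RtoC_inj in H; rewrite H.
      cbn [squeezed]; rewrite Nsq_superpose; auto using finsupp_squeezed.
      change (rsum (seq 0 L) (fun n => g n ^ 2)) with nu.
      replace (INR (length (e :: l))) with (INR (length l) + 1) by (rewrite <- S_INR; reflexivity).
      field; lra.
Qed.
End Squeeze.

(** * A finite amplitude profile that squeezes one mode *)

(** The values 1, 0, -1, 0, ..., that is cos (n pi / 2). *)
Fixpoint altsign (n : nat) : R :=
  match n with O => 1 | S O => 0 | S (S n) => - altsign n end.
(** Slope one up to height 2 k at n = 2 k, back to zero at n = 4 k, and zero from there on because
    subtraction is truncated. Bounded slope over a range of length k is what makes the quadrature of
    order 1 / k. *)
Definition tent (k n : nat) : R := INR (Nat.min n (4 * k - n)).
(* The amplitudes nearly solve [sqrt (n+1) g (n+1) + sqrt n g (n-1) = 0]. *)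
Definition profile (k n : nat) : R := altsign n * tent k n.

Lemma altsign_SS n : altsign (S (S n)) = - altsign n.
Proof. reflexivity. Qed.
Lemma altsign_sparse n : altsign n * altsign (S n) = 0.
Proof.
  induction n; [simpl; ring|].
  rewrite altsign_SS; lra.
Qed.
Lemma altsign_sqr_le n : altsign n ^ 2 <= 1.
Proof.
  enough (altsign n ^ 2 <= 1 /\ altsign (S n) ^ 2 <= 1) by tauto.
  induction n; [simpl; lra|]; rewrite altsign_SS; split; [tauto|]; nra.
Qed.
Lemma altsign_even n : altsign (2 * n) ^ 2 = 1.
Proof.
  induction n; [simpl; ring|].
  replace (2 * S n)%nat with (S (S (2 * n))) by lia; rewrite altsign_SS; nra.
Qed.

Lemma tent_diff k n : - 2 <= tent k n - tent k (S (S n)) <= 2.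
Proof.
  unfold tent.
  assert (Nat.min n (4 * k - n) <= 2 + Nat.min (S (S n)) (4 * k - S (S n)) /\
    Nat.min (S (S n)) (4 * k - S (S n)) <= 2 + Nat.min n (4 * k - n))%nat as [H1 H2] by lia.
  apply le_INR in H1, H2; rewrite plus_INR in H1, H2; simpl (INR 2) in *; lra.
Qed.
Lemma tent_le k n : tent k n <= INR n.
Proof. apply le_INR; lia. Qed.

Lemma profile_vanish k n : (4 * k <= n)%nat -> profile k n = 0.
Proof.
  intros H; unfold profile, tent; replace (Nat.min n (4 * k - n)) with 0%nat by lia; simpl; ring.
Qed.
Lemma profile_sparse k n : profile k n * profile k (S n) = 0.
Proof.
  unfold profile; transitivity (altsign n * altsign (S n) * (tent k n * tent k (S n))); [ring|].
  rewrite altsign_sparse; ring.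
Qed.

Lemma rsum_seq_le f m n : (forall i, 0 <= f i) -> (m <= n)%nat ->
  rsum (seq 0 m) f <= rsum (seq 0 n) f.
Proof.
  intros Hf; induction 1; [lra|]; rewrite rsum_seq_S; pose proof (Hf m0); lra.
Qed.

(** Only the even numbers on the rising side are kept, where the squared amplitude is n^2: the sum
    of (2 j)^2 over j <= k is at least 4 k^3 / 3. *)
Lemma profile_norm k : 4 / 3 * INR k ^ 3 <= rsum (seq 0 (S (4 * k))) (fun n => profile k n ^ 2).
Proof.
  apply Rle_trans with (rsum (seq 0 (S (2 * k))) (fun n => profile k n ^ 2));
    [|apply rsum_seq_le; [intros; apply pow2_ge_0 | lia]].
  enough (H : forall j, (j <= k)%nat ->
    4 / 3 * INR j ^ 3 <= rsum (seq 0 (S (2 * j))) (fun n => profile k n ^ 2)) by auto.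
  induction j; intros Hj; [unfold rsum; simpl; nra|].
  replace (S (2 * S j)) with (S (S (S (2 * j)))) by lia.
  rewrite rsum_seq_S, (rsum_seq_S (S (2 * j))).
  specialize (IHj ltac:(lia)).
  pose proof (pow2_ge_0 (profile k (S (2 * j)))).
  replace (profile k (S (S (2 * j))) ^ 2) with (4 * (INR j + 1) ^ 2).
  - rewrite S_INR; pose proof (pos_INR j); nra.
  - unfold profile, tent; rewrite altsign_SS, Nat.min_l by lia.
    rewrite !S_INR, mult_INR; simpl (INR 2).
    pose proof (altsign_even j).
    transitivity (altsign (2 * j) ^ 2 * (2 * INR j + 1 + 1) ^ 2); [rewrite H0|]; ring.
Qed.

(** With n = m + 1 the alternating sign leaves sqrt (m+1) t(m) - sqrt (m+2) t(m+2). The change of t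
    costs at most 2 sqrt (m+1), and the change of the root, of order 1 / sqrt m, times t(m+2) <= m +
    2 at most another sqrt (m+2). *)
Lemma quadrature_bound k n :
  (lower (profile k) n + raise (profile k) n) ^ 2 <= 9 * (INR n + 1).
Proof.
  unfold lower, raise; destruct n as [|m].
  - unfold profile; simpl altsign; rewrite Rmult_0_l, Rmult_0_r; simpl; nra.
  - unfold profile; rewrite altsign_SS.
    set (a := sqrt (INR (S m))); set (b := sqrt (INR (S (S m)))).
    assert (Ha : a * a = INR m + 1) by apply sqrt_S_sqr.
    assert (Hb : b * b = INR m + 2) by (unfold b; rewrite sqrt_S_sqr, S_INR; ring).
    assert (0 < a) by apply sqrt_S_pos; assert (0 < b) by apply sqrt_S_pos.
    assert (Hab : a <= b) by (apply sqrt_le_1_alt, le_INR; lia).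
    pose proof (tent_diff k m); pose proof (tent_le k (S (S m))).
    assert (0 <= tent k (S (S m))) by apply pos_INR.
    rewrite !S_INR in H2.
    assert ((b - a) * b <= 1) by nra.
    assert ((b - a) * tent k (S (S m)) <= b).
    { apply Rle_trans with ((b - a) * (b * b)); [apply Rmult_le_compat_l; lra | nra]. }
    assert (0 <= (b - a) * tent k (S (S m))) by (apply Rmult_le_pos; lra).
    set (D := a * tent k m - b * tent k (S (S m))).
    assert (- (3 * b) <= D <= 3 * b).
    { unfold D; split; nra. }
    replace ((b * (- altsign m * tent k (S (S m))) + a * (altsign m * tent k m)) ^ 2) with
      (altsign m ^ 2 * D ^ 2) by (unfold D; ring).
    pose proof (altsign_sqr_le m).
    rewrite S_INR; apply Rle_trans with (1 * D ^ 2);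
      [apply Rmult_le_compat_r; [apply pow2_ge_0 | auto] | nra].
Qed.

Lemma squeeze_profile k : (1 <= k)%nat -> exists (g : nat -> R) (M : nat),
  (forall n, (M <= n)%nat -> g n = 0) /\ (forall n, g n * g (S n) = 0) /\
  let nu := rsum (seq 0 (S M)) (fun n => g n ^ 2) in
  0 < nu /\
  rsum (seq 0 (S M)) (fun n => (lower g n + raise g n) ^ 2) <= 170 / INR k * nu /\
  rsum (seq 0 (S M)) (fun n => lower g n ^ 2) <= 4 * INR k * nu.
Proof.
  intros Hk; exists (profile k), (4 * k)%nat.
  split; [exact (profile_vanish k)|]; split; [exact (profile_sparse k)|]; intros nu.
  assert (Hk1 : 1 <= INR k) by (apply le_INR in Hk; exact Hk).
  pose proof (profile_norm k) as Hnu; fold nu in Hnu.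
  assert (0 < INR k ^ 3) by (apply pow_lt; lra).
  split; [lra|]; split.
  (* There are 4 k + 1 <= 5 k terms, each at most 9 (4 k + 1) <= 45 k. Against the norm 4 k^3 / 3
     this gives 225 * 3 / 4 < 170. *)
  - apply Rle_trans with (225 * INR k ^ 2).
    + apply Rle_trans with (rsum (seq 0 (S (4 * k))) (fun _ => 45 * INR k)).
      * apply rsum_le; intros n Hn; apply in_seq in Hn.
        pose proof (quadrature_bound k n).
        assert (INR n <= 4 * INR k)
          by (replace 4 with (INR 4) by (simpl; ring); rewrite <- mult_INR; apply le_INR; lia).
        lra.
      * rewrite rsum_const, length_seq, S_INR, mult_INR; simpl (INR 4); nra.
    + apply Rle_trans with (170 / INR k * (4 / 3 * INR k ^ 3)).
      * replace (170 / INR k * (4 / 3 * INR k ^ 3)) with (680 / 3 * INR k ^ 2) by (field; lra).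
        pose proof (pow2_ge_0 (INR k)); lra.
      * apply Rmult_le_compat_l; [apply Rlt_le, Rdiv_lt_0_compat; lra | lra].
  (* Shifting the index compares with [nu]; each weight n + 1 under the support is at most 4 k. *)
  - assert (E : rsum (seq 0 (S (4 * k))) (fun n => profile k (S n) ^ 2) <= nu).
    { enough (H0 : forall L, rsum (seq 0 L) (fun n => profile k (S n) ^ 2) <=
        rsum (seq 0 (S L)) (fun n => profile k n ^ 2)).
      - eapply Rle_trans; [apply H0|]; rewrite rsum_seq_S, (profile_vanish k (S (4 * k))) by lia.
        fold nu; lra.
      - induction L; [unfold rsum; simpl; nra|].
        rewrite rsum_seq_S, (rsum_seq_S (S L)); lra. }
    apply Rle_trans with (4 * INR k * rsum (seq 0 (S (4 * k))) (fun n => profile k (S n) ^ 2));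
      [|apply Rmult_le_compat_l; lra].
    rewrite <- rsum_scal; apply rsum_le; intros n _; unfold lower.
    rewrite Rpow_mult_distr, pow2_sqrt by apply pos_INR.
    destruct (Nat.le_gt_cases (S n) (4 * k)) as [Hn | Hn].
    + apply Rmult_le_compat_r; [apply pow2_ge_0|].
      replace 4 with (INR 4) by (simpl; ring); rewrite <- mult_INR; apply le_INR; lia.
    + rewrite profile_vanish by lia; simpl; lra.
Qed.

(** * Gram-Schmidt with real coefficients *)

Section RealSpan.
Variable ms : list mode.
Notation wip := (wip ms).
Notation wnsq := (wnsq ms).
Notation rspan := (rspan ms).
Notation orthonormal := (orthonormal ms).

Lemma rspan_ext es v w : (forall m, In m ms -> v m = w m) -> rspan es v -> rspan es w.
Proof.
  intros H; destruct es as [|e l]; cbn [rspan].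
  - intros Hv m Hm; rewrite <- H; auto.
  - intros [r [w' [Hw' E]]]; exists r, w'; split; auto; intros; rewrite <- H; auto.
Qed.
Lemma rspan_zero es (w : wave) : (forall m, In m ms -> w m = 0%C) -> rspan es w.
Proof.
  revert w; induction es; intros w H; [exact H|].
  exists 0, w; split; auto; intros; ring.
Qed.
Lemma rspan_lin es a v w : rspan es v -> rspan es w ->
  rspan es (wadd (wscal (RtoC a) v) w).
Proof.
  revert v w; induction es as [|e l IH]; intros v w Hv Hw.
  - intros m Hm; unfold wadd, wscal; rewrite Hv, Hw by auto; ring.
  - destruct Hv as [r [v' [Hv' Ev]]], Hw as [s [w' [Hw' Ew]]].
    exists (a * r + s), (wadd (wscal (RtoC a) v') w'); split; auto.
    intros m Hm; unfold wadd, wscal; rewrite Ev, Ew, RtoC_plus, RtoC_mult by auto; ring.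
Qed.
Lemma rspan_cons e es w : rspan es w -> rspan (e :: es) w.
Proof. intros H; exists 0, w; split; auto; intros; ring. Qed.
Lemma rspan_csum {T : Type} es (l : list T) (a : T -> R) (V : T -> wave) :
  (forall t, In t l -> rspan es (V t)) ->
  rspan es (fun m => csum l (fun t => (RtoC (a t) * V t m)%C)).
Proof.
  induction l as [|t l IH]; intros H.
  - apply rspan_zero; reflexivity.
  - apply (rspan_lin es (a t) (V t)); [apply H; simpl; auto|].
    apply IH; intros; apply H; simpl; auto.
Qed.

Lemma wnsq_zero (w : wave) : wnsq w = 0 -> forall m, In m ms -> w m = 0%C.
Proof.
  unfold wnsq; induction ms as [|m l IH]; intros H m' Hm'; [easy|].
  rewrite rsum_cons in H.
  assert (0 <= rsum l (fun m => Cmod (w m) ^ 2)) by (apply rsum_nonneg; intros; apply pow2_ge_0).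
  pose proof (pow2_ge_0 (Cmod (w m))).
  destruct Hm' as [<- | Hm']; [|apply IH; auto; lra].
  apply Cmod_eq_0; pose proof (Cmod_ge_0 (w m)); nra.
Qed.

(** The component of [v] orthogonal to [es]. Since the projection coefficients are real, [w]
    inherits from [v] and [es] the reality of inner products with any third wave; this is the last
    clause. *)
Lemma orthogonal_residue es v : orthonormal es -> (forall e, In e es -> snd (wip e v) = 0) ->
  exists w, (forall e, In e es -> wip e w = 0%C) /\
    rspan es (wadd v (wscal (RtoC (-1)) w)) /\
    forall f, snd (wip v f) = 0 -> (forall e, In e es -> snd (wip e f) = 0) -> snd (wip w f) = 0.
Proof.
  induction es as [|e l IH]; intros HO Hv.
  - exists v; split; [easy|]; split; [|easy].
    intros m _; unfold wadd, wscal; ring.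
  - destruct HO as [He [Hel HO]].
    destruct IH as [w [Hw1 [Hw2 Hw3]]]; auto; [intros; apply Hv; simpl; auto|].
    assert (Hew : wip e w = wip e v).
    { pose proof (wip_rspan_0 ms e l _ Hel Hw2) as H.
      rewrite wip_addr, wip_scalr in H.
      replace (wip e w) with (wip e v - (wip e v + RtoC (-1) * wip e w))%C by ring.
      rewrite H; ring. }
    set (r := fst (wip e v)).
    assert (Hr : wip e v = RtoC r) by (apply C_eq; [reflexivity | apply Hv; simpl; auto]).
    exists (wadd (wscal (RtoC (- r)) e) w); split; [|split].
    + intros e' [<- | He']; rewrite wip_addr, wip_scalr.
      * rewrite He, Hew, Hr, RtoC_opp; ring.
      * rewrite Hw1, <- (wip_conj ms e e'), Hel, Cconj_0 by auto; ring.
    + exists r, (wadd v (wscal (RtoC (-1)) w)); split; auto.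
      intros m Hm; unfold wadd, wscal; rewrite RtoC_opp; ring.
    + intros f Hf Hes; rewrite wip_addl, wip_scall, Cconj_R; simpl.
      rewrite Hw3, (Hes e); [ring | simpl; auto | auto | intros; apply Hes; simpl; auto].
Qed.

(** Real inner products among the [vs] keep every coefficient of the procedure real, so the real
    span is preserved. The last clause carries reality of inner products over to waves f outside the
    list, namely to A(x) itself. *)
Lemma real_gram_schmidt vs : (forall v v', In v vs -> In v' vs -> snd (wip v v') = 0) ->
  exists es, orthonormal es /\ (length es <= length vs)%nat /\
    (forall v, In v vs -> rspan es v) /\
    forall f, (forall v, In v vs -> snd (wip v f) = 0) -> forall e, In e es -> snd (wip e f) = 0.
Proof.
  induction vs as [|v vs IH]; intros Hr.
  - exists []; repeat split; easy.
  - destruct IH as [es [HO [Hlen [Hsp Hre]]]]; [intros; apply Hr; simpl; auto|].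
    destruct (orthogonal_residue es v HO) as [w [Hw1 [Hw2 Hw3]]].
    { apply Hre; intros; apply Hr; simpl; auto. }
    (* A dependent vector leaves no residue and is dropped, so [es] may be shorter than [vs]. *)
    destruct (Req_dec (wnsq w) 0) as [H0 | H0].
    + exists es; split; [auto|]; split; [simpl; lia|]; split.
      * intros v' [<- | Hv']; auto.
        apply (rspan_ext es _ _) with (2 := Hw2); intros m Hm; unfold wadd, wscal.
        rewrite (wnsq_zero w H0 m Hm); ring.
      * intros f Hf; apply Hre; intros; apply Hf; simpl; auto.
    + assert (Hpos : 0 < wnsq w) by (pose proof (wnsq_nonneg ms w); lra).
      assert (Hs : 0 < sqrt (wnsq w)) by now apply sqrt_lt_R0.
      set (e := wscal (RtoC (/ sqrt (wnsq w))) w).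
      exists (e :: es); split; [|split; [simpl; lia|]; split].
      * split; [|split; auto].
        -- unfold e; rewrite wip_scall, wip_scalr, wip_self, Cconj_R, <- !RtoC_mult.
           f_equal; rewrite <- (sqrt_sqrt (wnsq w)) at 3 by lra; field; lra.
        -- intros e' He'; rewrite <- wip_conj; unfold e.
           rewrite wip_scalr, Hw1, Cmult_0_r by auto; apply Cconj_0.
      * intros v' [<- | Hv']; [|apply rspan_cons; auto].
        exists (sqrt (wnsq w)), (wadd v (wscal (RtoC (-1)) w)); split; auto.
        intros m Hm; unfold e, wadd, wscal.
        rewrite Cmult_assoc, <- RtoC_mult, Rinv_r by lra; ring.
      * intros f Hf; assert (Hes : forall e, In e es -> snd (wip e f) = 0)
          by (apply Hre; intros; apply Hf; simpl; auto).
        intros e' [<- | He']; auto; unfold e; rewrite wip_scall, Cconj_R; simpl.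
        rewrite Hw3; auto; [ring | apply Hf; simpl; auto].
Qed.
End RealSpan.

(** * Integration over R^3 *)

Lemma continuous_pair {U V W : UniformSpace} (f : U -> V) (g : U -> W) x :
  continuous f x -> continuous g x -> continuous (fun u => (f u, g u)) x.
Proof.
  intros Hf Hg; apply filterlim_locally; intros eps.
  pose proof (proj1 (filterlim_locally _ _) Hf eps) as H1.
  pose proof (proj1 (filterlim_locally _ _) Hg eps) as H2.
  apply (filter_imp _ _ (fun u H => H)); apply filter_and; assumption.
Qed.

(** Tube lemma: compactness of the interval gives one neighbourhood of p that works for all
    integration points. The parameter space is arbitrary because the lemma serves the innermost
    integral, with two parameters, as well as the middle one. *)
Lemma continuous_RInt_param {U : UniformSpace} (g : U -> R -> R) (A B : R) :
  A < B -> (forall p c, continuous (fun q : U * R => g (fst q) (snd q)) (p, c)) ->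
  forall p, continuous (fun p => RInt (g p) A B) p.
Proof.
  intros HAB Hg p.
  assert (Hint : forall q, ex_RInt (g q) A B).
  { intros q; apply (ex_RInt_continuous (g q)); intros z _.
    apply (continuous_comp (fun c => (q, c)) (fun q : U * R => g (fst q) (snd q))); auto.
    apply continuous_pair; [apply continuous_const | apply continuous_id]. }
  apply filterlim_locally; intros eps.
  assert (He : 0 < eps / (2 * (B - A)) / 2).
  { repeat apply Rdiv_lt_0_compat; try lra; apply cond_pos. }
  set (eta := mkposreal _ He).
  assert (Hd : forall c, exists d : posreal, forall q y,
    ball p d q -> ball c d y -> Rabs (g q y - g p c) < eta).
  { intros c; destruct (proj1 (filterlim_locally _ _) (Hg p c) eta) as [d Hd].
    exists d; intros q y Hq Hy; apply (Hd (q, y)); split; assumption. }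
  set (delta c := proj1_sig (constructive_indefinite_description _ (Hd c))).
  assert (Hdelta : forall c q y, ball p (delta c) q -> ball c (delta c) y ->
    Rabs (g q y - g p c) < eta).
  { intros c; exact (proj2_sig (constructive_indefinite_description _ (Hd c))). }
  destruct (compactness_value_1d A B delta) as [d Hcomp].
  exists d; intros q Hq; change (Rabs (RInt (g q) A B - RInt (g p) A B) < eps).
  assert (E : RInt (g q) A B - RInt (g p) A B = RInt (fun c => minus (g q c) (g p c)) A B)
    by (symmetry; apply (RInt_minus (g q) (g p)); auto).
  rewrite E; apply Rle_lt_trans with ((B - A) * (eps / (2 * (B - A)))).
  - apply abs_RInt_le_const; [lra | apply (ex_RInt_minus (g q) (g p)); auto|].
    (* [compactness_value_1d] provides its point under a double negation only, hence the proof by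
       contradiction. *)
    intros c Hc; apply Rnot_lt_le; intros Hlt; apply (Hcomp c Hc); intros [t [_ [Ht Hdt]]].
    assert (Hct : ball t (delta t) c) by exact Ht.
    pose proof (Hdelta t q c (ball_le _ _ _ Hdt _ Hq) Hct) as H1.
    pose proof (Hdelta t p c (ball_center _ _) Hct) as H2.
    assert (eta + eta = eps / (2 * (B - A))) by (unfold eta; simpl; lra).
    unfold minus, plus, opp in Hlt; simpl in Hlt.
    apply Rabs_def2 in H1, H2.
    destruct (Rcase_abs (g q c + - g p c)) as [Hn | Hn];
      [rewrite Rabs_left in Hlt | rewrite Rabs_right in Hlt]; lra.
  - replace ((B - A) * (eps / (2 * (B - A)))) with (eps / 2) by (field; lra).
    pose proof (cond_pos eps); lra.
Qed.

Lemma is_derive_RInt_continuous (f f' : R -> R -> R) (A B : R) :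
  A < B -> (forall u t, is_derive (fun u => f u t) u (f' u t)) ->
  (forall u t, continuous (f u) t) ->
  (forall u t, continuous (fun q : R * R => f' (fst q) (snd q)) (u, t)) ->
  forall u, is_derive (fun u => RInt (f u) A B) u (RInt (f' u) A B).
Proof.
  intros HAB Hd Hc Hc' u.
  assert (E : forall u t, Derive (fun z => f z t) u = f' u t)
    by (intros; apply is_derive_unique, Hd).
  replace (RInt (f' u) A B) with (RInt (fun t => Derive (fun z => f z t) u) A B)
    by (apply RInt_ext; intros; apply E).
  apply is_derive_RInt_param.
  - apply filter_forall; intros v t _; eexists; apply Hd.
  - intros t _; apply continuity_2d_pt_filterlim.
    rewrite E; apply filterlim_ext with (fun z : R * R => f' (fst z) (snd z)); auto.
    apply Hc'.
  - apply filter_forall; intros v; apply (ex_RInt_continuous (f v)); auto.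
Qed.

Lemma RInt_gen_compact (f : R -> R) (M : R) : 0 < M -> (forall x, continuous f x) ->
  (forall x, M < Rabs x -> f x = 0) ->
  RInt_gen f (Rbar_locally m_infty) (Rbar_locally p_infty) = RInt f (- M) M.
Proof.
  intros HM Hc Hs; apply is_RInt_gen_unique.
  assert (Hex : forall a b, ex_RInt f a b) by (intros; apply (ex_RInt_continuous f); auto).
  intros P HP; apply Filter_prod with (fun x => x < - M) (fun x => M < x);
    [exists (- M); auto | exists M; auto|].
  intros a b Ha Hb; exists (RInt f (- M) M); split; [|now apply locally_singleton].
  assert (H0 : forall x y, ((forall z, x < z < y -> f z = 0) -> x <= y -> is_RInt f x y 0)).
  { intros x y Hz Hxy; apply is_RInt_ext with (fun _ => 0).
    - intros z; rewrite Rmin_left, Rmax_right by lra; symmetry; auto.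
    - pose proof (@is_RInt_const R_NormedModule x y 0) as Hc0.
      unfold scal in Hc0; simpl in Hc0; unfold mult in Hc0; simpl in Hc0.
      now rewrite Rmult_0_r in Hc0. }
  replace (RInt f (- M) M) with (plus (plus 0 (RInt f (- M) M)) 0)
    by (unfold plus; simpl; ring).
  apply (@is_RInt_Chasles R_NormedModule f a M b);
    [apply (@is_RInt_Chasles R_NormedModule f a (- M) M)|].
  - apply H0; [|lra]; intros z Hz; apply Hs; simpl in *; rewrite Rabs_left; lra.
  - apply (RInt_correct f); auto.
  - apply H0; [|lra]; intros z Hz; apply Hs; simpl in *; rewrite Rabs_right; lra.
Qed.

Definition in_box (M : R) (g : R3 -> R) : Prop := forall x : R3,
  (M < Rabs (vcomp x 0) \/ M < Rabs (vcomp x 1) \/ M < Rabs (vcomp x 2)) -> g x = 0.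
Definition cont3 (g : R3 -> R) : Prop := forall x : R3, continuous g x.
Definition cc (g : R3 -> R) : Prop := cont3 g /\ exists M, in_box M g.

Definition RIntM (M : R) (f : R -> R) : R := RInt f (- M) M.

Section Box.
Variable M : R.
Hypothesis HM : 0 < M.
Let slice1 (g : R3 -> R) (p : R * R) : R := RIntM M (fun c => g (p, c)).
Let slice2 (g : R3 -> R) (a : R) : R := RIntM M (fun b => slice1 g (a, b)).

Lemma continuous_slice1 g : cont3 g -> forall p, continuous (slice1 g) p.
Proof.
  intros Hg; apply (continuous_RInt_param (fun p c => g (p, c))); [lra|].
  intros p c; apply continuous_ext with g; [now intros [q y] | apply Hg].
Qed.
Lemma continuous_slice2 g : cont3 g -> forall a, continuous (slice2 g) a.
Proof.
  intros Hg; apply (continuous_RInt_param (fun a b => slice1 g (a, b))); [lra|].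
  intros a b; apply continuous_ext with (slice1 g); [now intros [q y] | ].
  now apply continuous_slice1.
Qed.
Lemma continuous_line1 g a b : cont3 g -> forall c, continuous (fun c => g (a, b, c)) c.
Proof.
  intros Hg c; apply (continuous_comp (fun c => (a, b, c)) g); [|apply Hg].
  apply continuous_pair; [apply continuous_const | apply continuous_id].
Qed.
Lemma continuous_line2 g a : cont3 g -> forall b, continuous (fun b => slice1 g (a, b)) b.
Proof.
  intros Hg b; apply (continuous_comp (fun b => (a, b)) (slice1 g)); [|now apply continuous_slice1].
  apply continuous_pair; [apply continuous_const | apply continuous_id].
Qed.

Lemma RIntM_zero f : (forall x, f x = 0) -> RIntM M f = 0.
Proof.
  intros H; unfold RIntM; rewrite (RInt_ext _ (fun _ => 0)) by auto.
  rewrite RInt_const; unfold scal; simpl; unfold mult; simpl; ring.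
Qed.

Lemma integral3_box g : cont3 g -> in_box M g -> integral3 g = RIntM M (slice2 g).
Proof.
  intros Hg Hb; unfold integral3.
  assert (E1 : forall a b, RInt_gen (fun c => g (a, b, c)) (Rbar_locally m_infty)
    (Rbar_locally p_infty) = slice1 g (a, b)).
  { intros a b; apply RInt_gen_compact; auto using continuous_line1. }
  assert (E2 : forall a, RInt_gen (fun b => RInt_gen (fun c => g (a, b, c)) (Rbar_locally m_infty)
    (Rbar_locally p_infty)) (Rbar_locally m_infty) (Rbar_locally p_infty) = slice2 g a).
  { intros a; rewrite (functional_extensionality _ _ (E1 a)).
    apply RInt_gen_compact; auto using continuous_line2.
    intros b Hc; apply RIntM_zero; intros c; apply Hb; simpl; auto. }
  rewrite (functional_extensionality _ _ E2).
  apply RInt_gen_compact; auto using continuous_slice2.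
  intros a Ha; apply RIntM_zero; intros b; apply RIntM_zero; intros c; apply Hb; simpl; auto.
Qed.

Lemma RIntM_plus (f g : R -> R) : (forall x, continuous f x) -> (forall x, continuous g x) ->
  RIntM M (fun x => f x + g x) = RIntM M f + RIntM M g.
Proof.
  intros Hf Hg; apply (RInt_plus f g); [apply (ex_RInt_continuous f) | apply (ex_RInt_continuous g)];
    auto.
Qed.
Lemma RIntM_scal a (f : R -> R) : (forall x, continuous f x) -> RIntM M (fun x => a * f x) = a * RIntM M f.
Proof. intros Hf; apply (RInt_scal f); apply (ex_RInt_continuous f); auto. Qed.
Lemma RIntM_le (f g : R -> R) : (forall x, continuous f x) -> (forall x, continuous g x) ->
  (forall x, f x <= g x) -> RIntM M f <= RIntM M g.
Proof.
  intros Hf Hg H; apply RInt_le; [lra | apply (ex_RInt_continuous f) | apply (ex_RInt_continuous g) | ];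
    auto.
Qed.

Lemma slice2_plus f g : cont3 f -> cont3 g -> forall a,
  slice2 (fun x => f x + g x) a = slice2 f a + slice2 g a.
Proof.
  intros Hf Hg a; unfold slice2; rewrite <- RIntM_plus by auto using continuous_line2.
  apply RInt_ext; intros b _; apply RIntM_plus; auto using continuous_line1.
Qed.
Lemma box_plus f g : cont3 f -> cont3 g ->
  RIntM M (slice2 (fun x => f x + g x)) = RIntM M (slice2 f) + RIntM M (slice2 g).
Proof.
  intros Hf Hg; rewrite <- RIntM_plus by auto using continuous_slice2.
  apply RInt_ext; intros; now apply slice2_plus.
Qed.
Lemma box_scal a f : cont3 f ->
  RIntM M (slice2 (fun x => a * f x)) = a * RIntM M (slice2 f).
Proof.
  intros Hf; rewrite <- RIntM_scal by auto using continuous_slice2.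
  apply RInt_ext; intros x _; unfold slice2; rewrite <- RIntM_scal by auto using continuous_line2.
  apply RInt_ext; intros y _; apply RIntM_scal; auto using continuous_line1.
Qed.
Lemma box_le f g : cont3 f -> cont3 g -> (forall x, f x <= g x) ->
  RIntM M (slice2 f) <= RIntM M (slice2 g).
Proof.
  intros Hf Hg H; apply RIntM_le; auto using continuous_slice2; intros a.
  apply RIntM_le; auto using continuous_line2; intros b.
  apply RIntM_le; auto using continuous_line1.
Qed.

Lemma is_derive_shift (f : R -> R) x l :
  is_derive (fun t => f (x + t)) 0 l -> is_derive f x l.
Proof.
  intros H; apply is_derive_ext with (fun y => f (x + (y - x))); [intros; f_equal; ring|].
  replace l with (scal 1 l) by (unfold scal; simpl; unfold mult; simpl; ring).
  apply (is_derive_comp (fun t => f (x + t)) (fun y => y - x)).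
  - now replace (x - x) with 0 by ring.
  - auto_derive; auto.
Qed.

Lemma RIntM_derive f f' : (forall x, is_derive f x (f' x)) -> (forall x, continuous f' x) ->
  f M = 0 -> f (- M) = 0 -> RIntM M f' = 0.
Proof.
  intros Hd Hc H1 H2.
  transitivity (minus (f M) (f (- M))).
  - apply is_RInt_unique, (is_RInt_derive f); auto.
  - rewrite H1, H2; unfold minus, plus, opp; simpl; ring.
Qed.

(** The fundamental theorem of calculus in the j-th variable; the derivative is first pulled out of
    the integrals that lie inside, two for j = 0, one for j = 1, none for j = 2. *)
Lemma box_derive j F F' : (j < 3)%nat -> cont3 F -> cont3 F' ->
  (forall x, is_derive (fun t => F (Defs.shift x j t)) 0 (F' x)) ->
  (forall x, Rabs (vcomp x j) = M -> F x = 0) -> RIntM M (slice2 F') = 0.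
Proof.
  intros Hj HF HF' Hd H0.
  assert (Hp : Rabs M = M) by (apply Rabs_right; lra).
  assert (Hm : Rabs (- M) = M) by (rewrite Rabs_Ropp; exact Hp).
  destruct j as [|[|[|j]]]; [| | |lia].
  - assert (Hd1 : forall a b c, is_derive (fun a => F (a, b, c)) a (F' (a, b, c)))
      by (intros; apply is_derive_shift, (Hd (a, b, c))).
    assert (Hd2 : forall b a, is_derive (fun a => slice1 F (a, b)) a (slice1 F' (a, b))).
    { intros b; apply (is_derive_RInt_continuous (fun a c => F (a, b, c)) (fun a c => F' (a, b, c)));
        [lra | intros; apply Hd1 | intros; now apply continuous_line1 |].
      intros a c; apply (continuous_comp (fun q : R * R => (fst q, b, snd q)) F'); [|apply HF'].
      apply continuous_pair; [apply continuous_pair|];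
        [apply continuous_fst | apply continuous_const | apply continuous_snd]. }
    apply RIntM_derive with (slice2 F); auto using continuous_slice2.
    + apply (is_derive_RInt_continuous (fun a b => slice1 F (a, b)) (fun a b => slice1 F' (a, b)));
        [lra | intros; apply Hd2 | intros; now apply continuous_line2 |].
      intros a b; apply continuous_ext with (slice1 F'); [now intros [x y]|].
      now apply continuous_slice1.
    + apply RIntM_zero; intros b; apply RIntM_zero; intros c; apply H0; auto.
    + apply RIntM_zero; intros b; apply RIntM_zero; intros c; apply H0; auto.
  - apply RIntM_zero; intros a.
    assert (Hd1 : forall a b c, is_derive (fun b => F (a, b, c)) b (F' (a, b, c)))
      by (intros; apply is_derive_shift, (Hd (a0, b, c))).
    apply RIntM_derive with (fun b => slice1 F (a, b)); auto using continuous_line2.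
    + apply (is_derive_RInt_continuous (fun b c => F (a, b, c)) (fun b c => F' (a, b, c)));
        [lra | intros; apply Hd1 | intros; now apply continuous_line1 |].
      intros b c; apply (continuous_comp (fun q : R * R => (a, fst q, snd q)) F'); [|apply HF'].
      apply continuous_pair; [apply continuous_pair|];
        [apply continuous_const | apply continuous_fst | apply continuous_snd].
    + apply RIntM_zero; intros c; apply H0; auto.
    + apply RIntM_zero; intros c; apply H0; auto.
  - apply RIntM_zero; intros a; apply RIntM_zero; intros b.
    apply RIntM_derive with (fun c => F (a, b, c)); auto using continuous_line1.
    intros c; apply is_derive_shift, (Hd (a, b, c)).
Qed.

Lemma integral3_product_box (u v w : R -> R) :
  (forall x, continuous u x) -> (forall x, continuous v x) -> (forall x, continuous w x) ->
  RIntM M (slice2 (fun x => u (vcomp x 0) * v (vcomp x 1) * w (vcomp x 2))) =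
  RIntM M u * RIntM M v * RIntM M w.
Proof.
  intros Hu Hv Hw.
  transitivity (RIntM M (fun a => RIntM M v * RIntM M w * u a)).
  2: rewrite RIntM_scal by auto; ring.
  apply RInt_ext; intros a _; match goal with |- ?x = ?y => change (@eq R x y) end.
  transitivity (RIntM M (fun b => u a * RIntM M w * v b)).
  2: rewrite RIntM_scal by auto; ring.
  apply RInt_ext; intros b _; match goal with |- ?x = ?y => change (@eq R x y) end.
  unfold slice1; simpl.
  rewrite RIntM_scal by auto; ring.
Qed.
End Box.

Lemma in_box_mono M M' g : M <= M' -> in_box M g -> in_box M' g.
Proof. intros HM H x Hx; apply H; destruct Hx as [|[|]]; [left | right; left | right; right]; lra. Qed.

(** The margin of 1 makes [g] vanish on the faces of the cube of half-side M as well, not only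
    outside it; integration by parts needs this. *)
Lemma cc_box g M0 : cc g -> exists M, M0 < M /\ 0 < M /\ in_box (M - 1) g.
Proof.
  intros [_ [M HM]]; exists (Rmax (Rmax M M0) 0 + 1).
  pose proof (Rmax_l (Rmax M M0) 0); pose proof (Rmax_r (Rmax M M0) 0).
  pose proof (Rmax_l M M0); pose proof (Rmax_r M M0).
  repeat split; try lra; apply in_box_mono with (2 := HM); lra.
Qed.

Lemma cont3_plus f g : cont3 f -> cont3 g -> cont3 (fun x => f x + g x).
Proof. intros Hf Hg x; apply (continuous_plus f g); auto. Qed.
Lemma cont3_mult f g : cont3 f -> cont3 g -> cont3 (fun x => f x * g x).
Proof. intros Hf Hg x; apply (continuous_mult f g); auto. Qed.
Lemma cont3_const a : cont3 (fun _ => a).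
Proof. intros x; apply continuous_const. Qed.
Lemma cont3_scal a g : cont3 g -> cont3 (fun x => a * g x).
Proof. intros; apply cont3_mult; auto using cont3_const. Qed.

Lemma cc_plus f g : cc f -> cc g -> cc (fun x => f x + g x).
Proof.
  intros Hf Hg; split; [apply cont3_plus; [apply Hf | apply Hg]|].
  destruct Hf as [_ [M Hf]], Hg as [_ [M' Hg]]; exists (Rmax M M'); intros x Hx.
  rewrite (in_box_mono M _ f (Rmax_l _ _) Hf x Hx), (in_box_mono M' _ g (Rmax_r _ _) Hg x Hx); ring.
Qed.
Lemma cc_mult_l f g : cont3 f -> cc g -> cc (fun x => f x * g x).
Proof.
  intros Hf [Hg [M Hb]]; split; [now apply cont3_mult|].
  exists M; intros x Hx; rewrite Hb by auto; ring.
Qed.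
Lemma cc_scal a g : cc g -> cc (fun x => a * g x).
Proof. apply cc_mult_l, cont3_const. Qed.
Lemma cc_ext f g : (forall x, f x = g x) -> cc f -> cc g.
Proof. intros H; now rewrite (functional_extensionality _ _ H). Qed.
Lemma cc_zero : cc (fun _ => 0).
Proof. split; [apply cont3_const | now exists 0]. Qed.
Lemma cc_rsum {T : Type} (l : list T) (F : T -> R3 -> R) :
  (forall t, In t l -> cc (F t)) -> cc (fun x => rsum l (fun t => F t x)).
Proof.
  induction l; intros H; [apply cc_zero|]; apply cc_plus; [apply H; simpl; auto|].
  apply IHl; intros; apply H; simpl; auto.
Qed.

Lemma integral3_plus f g : cc f -> cc g ->
  integral3 (fun x => f x + g x) = integral3 f + integral3 g.
Proof.
  intros Hf Hg; destruct (cc_box f 0 Hf) as [M1 [H1 [H1' Hb1]]].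
  destruct (cc_box g M1 Hg) as [M [H2 [HM Hb2]]].
  assert (B1 : in_box M f) by (apply in_box_mono with (2 := Hb1); lra).
  assert (B2 : in_box M g) by (apply in_box_mono with (2 := Hb2); lra).
  destruct Hf as [Hf _], Hg as [Hg _].
  rewrite !(integral3_box M); auto using cont3_plus; [now apply box_plus|].
  intros x Hx; rewrite B1, B2 by auto; ring.
Qed.
Lemma integral3_scal a f : cc f -> integral3 (fun x => a * f x) = a * integral3 f.
Proof.
  intros Hf; destruct (cc_box f 0 Hf) as [M [H1 [HM Hb]]].
  assert (B : in_box M f) by (apply in_box_mono with (2 := Hb); lra).
  destruct Hf as [Hf _].
  rewrite !(integral3_box M); auto using cont3_scal; [now apply box_scal|].
  intros x Hx; rewrite B by auto; ring.
Qed.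
Lemma integral3_ext f g : (forall x, f x = g x) -> integral3 f = integral3 g.
Proof. intros H; now rewrite (functional_extensionality _ _ H). Qed.
Lemma integral3_le f g : cc f -> cc g -> (forall x, f x <= g x) -> integral3 f <= integral3 g.
Proof.
  intros Hf Hg; destruct (cc_box f 0 Hf) as [M1 [H1 [H1' Hb1]]].
  destruct (cc_box g M1 Hg) as [M [H2 [HM Hb2]]].
  assert (B1 : in_box M f) by (apply in_box_mono with (2 := Hb1); lra).
  assert (B2 : in_box M g) by (apply in_box_mono with (2 := Hb2); lra).
  destruct Hf as [Hf _], Hg as [Hg _].
  rewrite !(integral3_box M) by auto; now apply box_le.
Qed.
Lemma integral3_zero : integral3 (fun _ => 0) = 0.
Proof.
  rewrite (integral3_ext _ (fun x => 0 * 0)) by (intros; ring).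
  rewrite (integral3_scal 0 (fun _ => 0)) by apply cc_zero; ring.
Qed.
Lemma integral3_nonneg f : cc f -> (forall x, 0 <= f x) -> 0 <= integral3 f.
Proof. intros Hf H; rewrite <- integral3_zero; apply integral3_le; auto using cc_zero. Qed.
Lemma integral3_rsum {T : Type} (l : list T) (F : T -> R3 -> R) :
  (forall t, In t l -> cc (F t)) ->
  integral3 (fun x => rsum l (fun t => F t x)) = rsum l (fun t => integral3 (F t)).
Proof.
  induction l; intros H; [apply integral3_zero|].
  assert (H' : forall t, In t l -> cc (F t)) by (intros; apply H; simpl; auto).
  rewrite rsum_cons, <- IHl by auto.
  apply (integral3_plus (F a) (fun x => rsum l (fun t => F t x))); [apply H; simpl; auto|].
  now apply cc_rsum.
Qed.

Lemma integral3_derive j F F' : (j < 3)%nat -> cc F -> cc F' ->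
  (forall x, is_derive (fun t => F (Defs.shift x j t)) 0 (F' x)) -> integral3 F' = 0.
Proof.
  intros Hj Hf Hg Hd; destruct (cc_box F 0 Hf) as [M1 [H1 [H1' Hb1]]].
  destruct (cc_box F' M1 Hg) as [M [H2 [HM Hb2]]].
  assert (B1 : in_box (M - 1) F) by (apply in_box_mono with (2 := Hb1); lra).
  assert (B2 : in_box M F') by (apply in_box_mono with (2 := Hb2); lra).
  destruct Hf as [Hf _], Hg as [Hg _].
  rewrite (integral3_box M) by auto.
  apply (box_derive M HM j F F'); auto; intros x Hx; apply B1.
  destruct j as [|[|[|j]]]; [left | right; left | right; right | lia]; lra.
Qed.

Lemma integral3_product (u v w : R -> R) M : 0 < M ->
  (forall x, continuous u x) -> (forall x, continuous v x) -> (forall x, continuous w x) ->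
  (forall x, M < Rabs x -> u x = 0 /\ v x = 0 /\ w x = 0) ->
  cc (fun x => u (vcomp x 0) * v (vcomp x 1) * w (vcomp x 2)) /\
  integral3 (fun x => u (vcomp x 0) * v (vcomp x 1) * w (vcomp x 2)) =
  RIntM M u * RIntM M v * RIntM M w.
Proof.
  intros HM Hu Hv Hw Hs.
  assert (Hc : cont3 (fun x => u (vcomp x 0) * v (vcomp x 1) * w (vcomp x 2))).
  { apply cont3_mult; [apply cont3_mult|]; intros [[a b] c].
    - apply continuous_ext with (fun y : R3 => u (fst (fst y))); [now intros [[? ?] ?]|].
      apply (continuous_comp (fun y : R3 => fst (fst y)) u); [|apply Hu].
      apply (continuous_comp (fun y : R3 => fst y) fst); apply continuous_fst.
    - apply continuous_ext with (fun y : R3 => v (snd (fst y))); [now intros [[? ?] ?]|].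
      apply (continuous_comp (fun y : R3 => snd (fst y)) v); [|apply Hv].
      apply (continuous_comp (fun y : R3 => fst y) snd); [apply continuous_fst | apply continuous_snd].
    - apply continuous_ext with (fun y : R3 => w (snd y)); [now intros [[? ?] ?]|].
      apply (continuous_comp (fun y : R3 => snd y) w); [apply continuous_snd | apply Hw]. }
  assert (Hb : in_box M (fun x => u (vcomp x 0) * v (vcomp x 1) * w (vcomp x 2))).
  { intros x [H | [H | H]]; destruct (Hs _ H) as [E1 [E2 E3]]; rewrite ?E1, ?E2, ?E3; ring. }
  split; [split; eauto|].
  rewrite (integral3_box M) by auto; now apply integral3_product_box.
Qed.

(** * Calculus of complex functions on R^3 *)

Definition contC (f : R3 -> C) : Prop :=
  cont3 (fun x => fst (f x)) /\ cont3 (fun x => snd (f x)).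
Definition suppC (M : R) (f : R3 -> C) : Prop := forall x : R3,
  (M < Rabs (vcomp x 0) \/ M < Rabs (vcomp x 1) \/ M < Rabs (vcomp x 2)) -> f x = 0%C.
Definition ccC (f : R3 -> C) : Prop := contC f /\ exists M, suppC M f.
(** A relation instead of an equation for [pd]: [Derive] has a default value where no derivative
    exists, whereas here existence travels through sums and products together with the value. *)
Definition derC (j : nat) (f f' : R3 -> C) : Prop := forall x,
  is_derive (fun t => fst (f (Defs.shift x j t))) 0 (fst (f' x)) /\
  is_derive (fun t => snd (f (Defs.shift x j t))) 0 (snd (f' x)).

Lemma shift_0 x j : Defs.shift x j 0 = x.
Proof.
  destruct x as [[a b] c]; unfold Defs.shift; destruct j as [|[|]]; rewrite Rplus_0_r; reflexivity.
Qed.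

Lemma contC_const z : contC (fun _ => z).
Proof. split; apply cont3_const. Qed.
Lemma contC_plus f g : contC f -> contC g -> contC (fun x => (f x + g x)%C).
Proof. intros [H1 H2] [H3 H4]; split; simpl; now apply cont3_plus. Qed.
Lemma cont3_opp f : cont3 f -> cont3 (fun x => - f x).
Proof. intros Hf x; apply (continuous_opp f); auto. Qed.
Lemma contC_mult f g : contC f -> contC g -> contC (fun x => (f x * g x)%C).
Proof.
  intros [H1 H2] [H3 H4]; split; simpl; repeat apply cont3_plus; auto using cont3_mult.
  apply cont3_opp; auto using cont3_mult.
Qed.
Lemma contC_conj f : contC f -> contC (fun x => Cconj (f x)).
Proof. intros [H1 H2]; split; simpl; auto using cont3_opp. Qed.

Lemma ccC_plus f g : ccC f -> ccC g -> ccC (fun x => (f x + g x)%C).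
Proof.
  intros [Hf [M HM]] [Hg [M' HM']]; split; [now apply contC_plus|].
  exists (Rmax M M'); intros x Hx; pose proof (Rmax_l M M'); pose proof (Rmax_r M M').
  rewrite HM, HM'; [ring | |]; destruct Hx as [|[|]];
    try (left; lra); try (right; left; lra); right; right; lra.
Qed.
Lemma ccC_mult f g : contC f -> ccC g -> ccC (fun x => (f x * g x)%C).
Proof.
  intros Hf [Hg [M HM]]; split; [now apply contC_mult|].
  exists M; intros x Hx; rewrite HM by auto; ring.
Qed.
Lemma ccC_zero : ccC (fun _ => 0%C).
Proof. split; [apply contC_const | now exists 0]. Qed.
Lemma ccC_csum {T : Type} (l : list T) (F : T -> R3 -> C) :
  (forall t, ccC (F t)) -> ccC (fun x => csum l (fun t => F t x)).
Proof.
  intros H; induction l; [apply ccC_zero|].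
  apply (ccC_plus (F a) (fun x => csum l (fun t => F t x))); auto.
Qed.
Lemma cc_fst f : ccC f -> cc (fun x => fst (f x)).
Proof.
  intros [[H _] [M HM]]; split; auto; exists M; intros x Hx; now rewrite HM.
Qed.
Lemma cc_Cmod2 f : ccC f -> cc (fun x => Cmod (f x) ^ 2).
Proof.
  intros Hf; apply cc_ext with (fun x => fst (Cconj (f x) * f x)%C).
  - intros x; rewrite Cconj_mult_self; reflexivity.
  - apply cc_fst, ccC_mult; [apply contC_conj, Hf | exact Hf].
Qed.

Lemma derC_ext j f f' g g' : (forall x, f x = g x) -> (forall x, f' x = g' x) ->
  derC j f f' -> derC j g g'.
Proof. intros H H'; now rewrite (functional_extensionality _ _ H), (functional_extensionality _ _ H'). Qed.
Lemma derC_const j z : derC j (fun _ => z) (fun _ => 0%C).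
Proof. intros x; split; apply (@is_derive_const R_AbsRing R_NormedModule). Qed.
Lemma derC_plus j f f' g g' : derC j f f' -> derC j g g' ->
  derC j (fun x => (f x + g x)%C) (fun x => (f' x + g' x)%C).
Proof.
  intros Hf Hg x; destruct (Hf x) as [H1 H2], (Hg x) as [H3 H4]; split; simpl.
  - apply (is_derive_plus (fun t => fst (f (Defs.shift x j t)))); auto.
  - apply (is_derive_plus (fun t => snd (f (Defs.shift x j t)))); auto.
Qed.
Lemma is_derive_mult_0 (u v : R -> R) u' v' :
  is_derive u 0 u' -> is_derive v 0 v' ->
  is_derive (fun t => u t * v t) 0 (u' * v 0 + u 0 * v').
Proof. intros; apply (is_derive_mult u v); auto; intros; apply Rmult_comm. Qed.
Lemma derC_mult j f f' g g' : derC j f f' -> derC j g g' ->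
  derC j (fun x => (f x * g x)%C) (fun x => (f' x * g x + f x * g' x)%C).
Proof.
  intros Hf Hg x; destruct (Hf x) as [H1 H2], (Hg x) as [H3 H4].
  pose proof (is_derive_mult_0 _ _ _ _ H1 H3) as H13.
  pose proof (is_derive_mult_0 _ _ _ _ H1 H4) as H14.
  pose proof (is_derive_mult_0 _ _ _ _ H2 H3) as H23.
  pose proof (is_derive_mult_0 _ _ _ _ H2 H4) as H24.
  cbv beta in *; rewrite shift_0 in *; split; simpl.
  - replace (fst (f' x) * fst (g x) - snd (f' x) * snd (g x) +
      (fst (f x) * fst (g' x) - snd (f x) * snd (g' x))) with
      (minus (fst (f' x) * fst (g x) + fst (f x) * fst (g' x))
        (snd (f' x) * snd (g x) + snd (f x) * snd (g' x)))
      by (unfold minus, plus, opp; simpl; ring).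
    exact (is_derive_minus _ _ _ _ _ H13 H24).
  - replace (fst (f' x) * snd (g x) + snd (f' x) * fst (g x) +
      (fst (f x) * snd (g' x) + snd (f x) * fst (g' x))) with
      (plus (fst (f' x) * snd (g x) + fst (f x) * snd (g' x))
        (snd (f' x) * fst (g x) + snd (f x) * fst (g' x)))
      by (unfold minus, plus, opp; simpl; ring).
    exact (is_derive_plus _ _ _ _ _ H14 H23).
Qed.
Lemma derC_scal j z f f' : derC j f f' -> derC j (fun x => (z * f x)%C) (fun x => (z * f' x)%C).
Proof.
  intros Hf; eapply derC_ext; [| |apply (derC_mult j (fun _ => z) (fun _ => 0%C) f f')];
    auto using derC_const; intros; simpl; ring.
Qed.
Lemma derC_conj j f f' : derC j f f' -> derC j (fun x => Cconj (f x)) (fun x => Cconj (f' x)).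
Proof.
  intros Hf x; destruct (Hf x) as [H1 H2]; split; simpl; auto.
  exact (is_derive_opp _ _ _ H2).
Qed.
Lemma derC_csum {T : Type} j (l : list T) (F F' : T -> R3 -> C) :
  (forall t, derC j (F t) (F' t)) ->
  derC j (fun x => csum l (fun t => F t x)) (fun x => csum l (fun t => F' t x)).
Proof.
  intros H; induction l; [apply (derC_const j 0%C)|].
  apply (derC_plus j (F a) (F' a) (fun x => csum l (fun t => F t x))
    (fun x => csum l (fun t => F' t x))); auto.
Qed.

Lemma cont3_vcomp j : (j < 3)%nat -> cont3 (fun x => vcomp x j).
Proof.
  intros Hj x; destruct j as [|[|[|]]]; [| | |lia].
  - apply continuous_ext with (fun y : R3 => fst (fst y)); [now intros [[? ?] ?]|].
    apply (continuous_comp (fun y : R3 => fst y) fst); apply continuous_fst.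
  - apply continuous_ext with (fun y : R3 => snd (fst y)); [now intros [[? ?] ?]|].
    apply (continuous_comp (fun y : R3 => fst y) snd); [apply continuous_fst | apply continuous_snd].
  - apply continuous_ext with (fun y : R3 => snd y); [now intros [[? ?] ?]|].
    apply continuous_snd.
Qed.
Lemma cont3_dot3 k : cont3 (fun x => dot3 k x).
Proof.
  unfold dot3; repeat apply cont3_plus; apply cont3_scal; apply cont3_vcomp; lia.
Qed.
Lemma contC_expi k : contC (fun x => expi (- dot3 k x)).
Proof.
  split; intros x; simpl.
  - apply (continuous_comp (fun x => - dot3 k x) cos);
      [apply cont3_opp, cont3_dot3 | apply continuous_cos].
  - apply (continuous_comp (fun x => - dot3 k x) sin);
      [apply cont3_opp, cont3_dot3 | apply continuous_sin].
Qed.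
Lemma dot3_shift k x j t : (j < 3)%nat -> dot3 k (Defs.shift x j t) = dot3 k x + vcomp k j * t.
Proof.
  intros Hj; destruct x as [[a b] c]; unfold dot3.
  destruct j as [|[|[|]]]; [| | |lia]; simpl; ring.
Qed.
Lemma derC_expi j k : (j < 3)%nat ->
  derC j (fun x => expi (- dot3 k x)) (fun x => (- Ci * RtoC (vcomp k j) * expi (- dot3 k x))%C).
Proof.
  intros Hj x; split; simpl.
  - apply is_derive_ext with (fun t => cos (- (dot3 k x + vcomp k j * t)));
      [intros t; now rewrite dot3_shift|].
    auto_derive; [auto|]; rewrite Rmult_0_r, Rplus_0_r; ring.
  - apply is_derive_ext with (fun t => sin (- (dot3 k x + vcomp k j * t)));
      [intros t; now rewrite dot3_shift|].
    auto_derive; [auto|]; rewrite Rmult_0_r, Rplus_0_r; ring.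
Qed.
Lemma Cconj_expi t : Cconj (expi t) = expi (- t).
Proof. unfold expi; apply C_eq; simpl; [now rewrite cos_neg | now rewrite sin_neg]. Qed.
Lemma Cmod_expi t : Cmod (expi t) = 1.
Proof.
  unfold Cmod, expi; simpl; replace (_ + _) with 1; [apply sqrt_1|].
  pose proof (sin2_cos2 t); unfold Rsqr in *; lra.
Qed.

Lemma smooth_derC f j : smooth f -> compact_support f -> (j < 3)%nat ->
  ccC f /\ ccC (pd j f) /\ derC j f (pd j f).
Proof.
  intros Hs [M HM] Hj.
  assert (Hcont : forall h : R3 -> C, (forall x, continuous h x) -> contC h).
  { intros h Hh; split; intros x.
    - apply (continuous_comp h fst); [apply Hh | apply continuous_fst].
    - apply (continuous_comp h snd); [apply Hh | apply continuous_snd]. }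
  destruct (Hs 1%nat) as [Hc [Hd Hc']].
  split; [|split].
  - split; [now apply Hcont | now exists M].
  - split; [apply Hcont, (Hc' j Hj)|]; exists M; intros x Hx.
    (* Lying outside the box is an open condition, so f vanishes along a whole piece of the line
       through x and its derivative is zero there. *)
    assert (H0 : locally 0 (fun t => f (Defs.shift x j t) = 0%C)).
    { assert (Hopen : forall i, M < Rabs (vcomp x i) ->
        locally 0 (fun t => M < Rabs (vcomp (Defs.shift x j t) i))).
      { intros i Hi; assert (Hp : 0 < Rabs (vcomp x i) - M) by lra.
        exists (mkposreal _ Hp); intros t Ht.
        change (Rabs (t - 0) < Rabs (vcomp x i) - M) in Ht; rewrite Rminus_0_r in Ht.
        assert (E : vcomp (Defs.shift x j t) i = vcomp x i + t \/
          vcomp (Defs.shift x j t) i = vcomp x i).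
        { destruct x as [[a b] c]; destruct j as [|[|[|]]]; try lia;
            destruct i as [|[|]]; simpl; auto. }
        destruct E as [-> | ->]; [|lra].
        pose proof (Rabs_triang (vcomp x i + t) (- t)) as Ht'.
        rewrite Rabs_Ropp in Ht'; replace (vcomp x i + t + - t) with (vcomp x i) in Ht' by ring.
        lra. }
      destruct Hx as [Hx | [Hx | Hx]]; apply Hopen in Hx; revert Hx; apply filter_imp;
        intros t Ht; apply HM; auto. }
    unfold pd; apply C_eq; simpl.
    + rewrite (Derive_ext_loc _ (fun _ => 0)); [apply Derive_const|].
      revert H0; apply filter_imp; intros t ->; reflexivity.
    + rewrite (Derive_ext_loc _ (fun _ => 0)); [apply Derive_const|].
      revert H0; apply filter_imp; intros t ->; reflexivity.
  - intros x; destruct (Hd j x Hj); split; now apply Derive_correct.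
Qed.

(** * Norms of states *)

Lemma sum_configs_list (w : config -> R) l : NoDup l -> (forall c, 0 <= w c) ->
  (forall c, w c <> 0 -> In c l) -> sum_configs w = Finite (rsum l w).
Proof.
  intros Hl Hw Hs; apply is_lub_Rbar_unique; split.
  - intros r [l' [Hl' ->]]; simpl; change (rsum l' w <= rsum l w).
    set (p c := if Req_EM_T (w c) 0 then false else true).
    assert (E : rsum l' w = rsum (filter p l') w).
    { rewrite rsum_filter; apply rsum_ext; intros c _; unfold p.
      now destruct Req_EM_T. }
    rewrite E.
    assert (Hinc : incl (filter p l') l).
    { intros c Hc; apply filter_In in Hc as [_ Hc]; apply Hs; unfold p in Hc.
      now destruct Req_EM_T. }
    apply rsum_incl_le; auto; now apply NoDup_filter.
  - intros b Hb; apply Hb; exists l; split; auto.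
Qed.

(** Exchanges the sum over configurations with the integral, so that norms become integrals of Fock
    norms at fixed x. *)
Lemma normsq_list l (Phi : state) : NoDup l -> (forall c, ccC (Phi c)) ->
  (forall x, supp_in l (fun c => Phi c x)) ->
  normsq Phi = Finite (integral3 (fun x => Nsq (fun c => Phi c x))) /\
  cc (fun x => Nsq (fun c => Phi c x)).
Proof.
  intros Hl Hc Hs.
  assert (E : (fun x => Nsq (fun c => Phi c x)) = (fun x => rsum l (fun c => Cmod (Phi c x) ^ 2)))
    by (apply functional_extensionality; intros x; now apply Nsq_list).
  rewrite E; split; [|apply cc_rsum; intros; now apply cc_Cmod2].
  rewrite integral3_rsum by (intros; now apply cc_Cmod2).
  apply sum_configs_list; auto.
  - intros c; apply integral3_nonneg; [now apply cc_Cmod2 | intros; apply pow2_ge_0].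
  - intros c Hn; destruct (excluded_middle_informative (In c l)) as [|Hnin]; auto.
    destruct Hn; rewrite (integral3_ext _ (fun _ => 0)); [apply integral3_zero|].
    intros x; destruct (excluded_middle_informative (Phi c x = 0%C)) as [-> | H];
      [rewrite Cmod_0; ring | destruct Hnin; now apply (Hs x)].
Qed.

Lemma supp_vadd l u v : supp_in l u -> supp_in l v -> supp_in l (vadd u v).
Proof.
  intros Hu Hv c Hc; destruct (excluded_middle_informative (u c = 0%C)) as [H | H]; auto.
  apply Hv; intros H'; apply Hc; unfold vadd; rewrite H, H'; ring.
Qed.
Lemma supp_vscal l a u : supp_in l u -> supp_in l (vscal a u).
Proof. intros Hu c Hc; apply Hu; intros H; apply Hc; unfold vscal; rewrite H; ring. Qed.

(** The left side is the expectation of the number operator of m, which is diagonal in the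
    occupation numbers. *)
Lemma Nsq_an_list l m u : NoDup l -> supp_in l u ->
  Nsq (an m u) = rsum l (fun c => INR (c m) * Cmod (u c) ^ 2).
Proof.
  intros Hl Hs; unfold Nsq; rewrite ip_an by (apply finsupp_an; now exists l).
  rewrite (ip_list l), csum_fst by auto; apply rsum_ext; intros c _.
  replace (Cconj (u c) * cr m (an m u) c)%C with (RtoC (INR (c m) * Cmod (u c) ^ 2)); [reflexivity|].
  rewrite RtoC_mult, <- Cconj_mult_self; unfold cr, an.
  destruct (Nat.eq_dec (c m) 0) as [H0 | H0].
  - rewrite H0, sqrt_INR_0; simpl; ring.
  - rewrite cdecr_same, cincr_cdecr, Nat.succ_pred by easy.
    rewrite <- sqrt_INR_sqr; ring.
Qed.

Lemma Cmod_csum_le {T : Type} (l : list T) (f : T -> C) :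
  Cmod (csum l f) <= rsum l (fun t => Cmod (f t)).
Proof.
  induction l; [unfold csum, rsum; simpl; rewrite Cmod_0; lra|].
  rewrite csum_cons, rsum_cons; eapply Rle_trans; [apply Cmod_triangle | lra].
Qed.

(** * The conjugate momentum and the completed square *)

Section Commutator.
Variable ms : list mode.
Hypothesis Hms : NoDup ms.
Notation aF := (aF ms).
Notation cF := (cF ms).
Notation wip := (wip ms).
Notation wnsq := (wnsq ms).
Notation field := (field ms).

Definition momentum (h : wave) (u : vec) : vec := vadd (aF h u) (vscal (RtoC (-1)) (cF h u)).

Lemma finsupp_momentum h u : finsupp u -> finsupp (momentum h u).
Proof. intros; apply finsupp_vadd; auto using finsupp_vscal, finsupp_aF, finsupp_cF. Qed.
Lemma momentum_wadd h h' u : momentum (wadd h h') u = vadd (momentum h u) (momentum h' u).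
Proof. unfold momentum; rewrite aF_wadd, cF_wadd; vring. Qed.
Lemma momentum_antisym h u v : finsupp u -> finsupp v ->
  ip u (momentum h v) = (- ip (momentum h u) v)%C.
Proof.
  intros Hu Hv; unfold momentum.
  rewrite ip_addr, ip_addl, ip_scalr, ip_scall, ip_aF, ip_cF, Cconj_R;
    auto using finsupp_vscal, finsupp_aF, finsupp_cF.
  replace (RtoC (-1)) with (- (1))%C by (apply C_eq; simpl; ring); ring.
Qed.

Lemma Nsq_cF h u : finsupp u -> Nsq (cF h u) = Nsq (aF h u) + wnsq h * Nsq u.
Proof.
  intros Hu; unfold Nsq; rewrite ip_cF, aF_cF, ip_addr, ip_scalr, wip_self, ip_aF;
    auto using finsupp_cF, finsupp_aF.
  rewrite (ip_self u Hu); simpl; ring.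
Qed.
(** By the commutation relation |a*(h) u|^2 = |a(h) u|^2 + |h|^2 |u|^2, and splitting the norm of
    the difference doubles both parts. *)
Lemma Nsq_momentum_le h u : finsupp u ->
  Nsq (momentum h u) <= 4 * Nsq (aF h u) + 2 * wnsq h * Nsq u.
Proof.
  intros Hu; unfold momentum.
  eapply Rle_trans; [apply Nsq_add_le; auto using finsupp_vscal, finsupp_aF, finsupp_cF|].
  rewrite Nsq_scal, Nsq_cF, Cmod_R by auto using finsupp_cF.
  rewrite Rabs_left by lra; lra.
Qed.

(** The field is symmetric and T antisymmetric, so the real part is half the expectation of their
    commutator, which is the number -2 Re <f, h>. *)
Lemma field_momentum_commutator f h u : finsupp u ->
  fst (ip (field f u) (momentum h u)) = - fst (wip f h) * Nsq u.
Proof.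
  intros Hu; unfold field, momentum.
  rewrite ip_addr, !ip_scalr, !ip_addl;
    auto using finsupp_vadd, finsupp_vscal, finsupp_aF, finsupp_cF.
  assert (E1 : ip (cF f u) (cF h u) = (ip (aF h u) (aF f u) + wip f h * ip u u)%C).
  { rewrite ip_cF, aF_cF, ip_addr, ip_scalr, ip_aF; auto using finsupp_cF, finsupp_aF. }
  assert (E2 : ip (aF f u) (cF h u) = ip (aF h (aF f u)) u)
    by (rewrite <- ip_aF; auto using finsupp_aF).
  assert (E3 : ip (cF f u) (aF h u) = Cconj (ip (aF h (aF f u)) u)).
  { rewrite ip_conj, ip_cF, aF_comm; auto using finsupp_aF. }
  assert (E4 : ip (aF h u) (aF f u) = Cconj (ip (aF f u) (aF h u)))
    by (now rewrite ip_conj by auto using finsupp_aF).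
  rewrite E1, E2, E3, E4, ip_self by auto; simpl; ring.
Qed.

(* Expands [0 <= |P u + s T u|^2] with [P = p + a A] and [T] the momentum conjugate to [A]. *)
Lemma completed_square p f h u (a s : R) : finsupp p -> finsupp u ->
  0 <= Nsq (vadd p (vscal (RtoC a) (field f u))) + 2 * s * fst (ip p (momentum h u))
    - 2 * s * a * fst (wip f h) * Nsq u
    + s ^ 2 * (4 * Nsq (aF h u) + 2 * wnsq h * Nsq u).
Proof.
  intros Hp Hu.
  assert (HP : finsupp (vadd p (vscal (RtoC a) (field f u))))
    by auto using finsupp_vadd, finsupp_vscal, finsupp_field.
  pose proof (finsupp_momentum h u Hu) as HT.
  pose proof (Nsq_nonneg _ (finsupp_vadd _ _ HP (finsupp_vscal (RtoC s) _ HT))) as H0.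
  rewrite Nsq_add, Nsq_scal, ip_scalr, Cmod_R, pow2_abs, ip_addl, ip_scall, Cconj_R in H0;
    auto using finsupp_vscal, finsupp_field.
  pose proof (field_momentum_commutator f h u Hu) as HC.
  pose proof (Nsq_momentum_le h u Hu) as HN.
  pose proof (Rmult_le_compat_l (s ^ 2) _ _ (pow2_ge_0 s) HN).
  cbn [fst snd Cmult Cplus RtoC] in H0; rewrite HC in H0; lra.
Qed.

(** Cauchy-Schwarz over the modes with the weight sqrt (k m) kept on [an m u], so that the last
    factor is the field energy when [k] is the photon energy. *)
Lemma Nsq_aF_le l h u (e k : mode -> R) : (forall m, 0 <= k m) -> NoDup l ->
  (forall m, In m ms -> supp_in l (an m u)) ->
  (forall m, Cmod (h m) ^ 2 = e m ^ 2 * k m) ->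
  Nsq (aF h u) <= rsum ms (fun m => e m ^ 2) * rsum ms (fun m => k m * Nsq (an m u)).
Proof.
  intros Hk Hl Hs Hh.
  assert (HsA : supp_in l (aF h u)).
  { intros c Hc; destruct (excluded_middle_informative (In c l)) as [|Hn]; auto.
    destruct Hc; unfold aF; apply csum_zero; intros m Hm.
    destruct (excluded_middle_informative (an m u c = 0%C)) as [-> | H]; [ring|].
    destruct Hn; now apply (Hs m Hm). }
  rewrite (Nsq_list l) by auto.
  rewrite (rsum_ext ms (fun m => k m * Nsq (an m u))
    (fun m => rsum l (fun c => k m * Cmod (an m u c) ^ 2))).
  2: { intros m Hm; rewrite (Nsq_list l), rsum_scal; auto. }
  rewrite rsum_exchange, <- rsum_scal; apply rsum_le; intros c _.
  apply Rle_trans with ((rsum ms (fun m => Rabs (e m) * (sqrt (k m) * Cmod (an m u c)))) ^ 2).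
  - apply pow_incr; split; [apply Cmod_ge_0|]; unfold aF.
    eapply Rle_trans; [apply Cmod_csum_le|]; right; apply rsum_ext; intros m _.
    rewrite Cmod_mult, Cmod_conj.
    rewrite <- (sqrt_pow2 (Cmod (h m))), Hh, sqrt_mult, <- Rsqr_pow2, sqrt_Rsqr_abs
      by auto using pow2_ge_0, Cmod_ge_0; ring.
  - eapply Rle_trans; [apply rsum_cauchy_schwarz|]; right; f_equal; apply rsum_ext; intros m _.
    + now rewrite pow2_abs.
    + rewrite Rpow_mult_distr, pow2_sqrt; auto.
Qed.

Lemma ccC_an m (Psi : state) c : (forall c, ccC (Psi c)) ->
  ccC (fun x => an m (fun c => Psi c x) c).
Proof. intros H; apply ccC_mult; [apply contC_const | apply H]. Qed.
Lemma ccC_cr m (Psi : state) c : (forall c, ccC (Psi c)) ->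
  ccC (fun x => cr m (fun c => Psi c x) c).
Proof. intros H; apply ccC_mult; [apply contC_const | apply H]. Qed.

Lemma ccC_aF (H : R3 -> wave) (Psi : state) c : (forall m, contC (fun x => H x m)) ->
  (forall c, ccC (Psi c)) -> ccC (fun x => aF (H x) (fun c => Psi c x) c).
Proof.
  intros HH HP; apply (ccC_csum ms (fun m x => (Cconj (H x m) * an m (fun c => Psi c x) c)%C)).
  intros m; apply ccC_mult; [apply contC_conj, HH | now apply ccC_an].
Qed.
Lemma ccC_cF (H : R3 -> wave) (Psi : state) c : (forall m, contC (fun x => H x m)) ->
  (forall c, ccC (Psi c)) -> ccC (fun x => cF (H x) (fun c => Psi c x) c).
Proof.
  intros HH HP; apply (ccC_csum ms (fun m x => (H x m * cr m (fun c => Psi c x) c)%C)).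
  intros m; apply ccC_mult; [apply HH | now apply ccC_cr].
Qed.
Lemma ccC_momentum (H : R3 -> wave) (Psi : state) c : (forall m, contC (fun x => H x m)) ->
  (forall c, ccC (Psi c)) -> ccC (fun x => momentum (H x) (fun c => Psi c x) c).
Proof.
  intros HH HP; apply ccC_plus; [now apply ccC_aF|].
  apply ccC_mult; [apply contC_const | now apply ccC_cF].
Qed.

Lemma derC_momentum j (H H' : R3 -> wave) (Psi Psi' : state) c :
  (forall m, derC j (fun x => H x m) (fun x => H' x m)) ->
  (forall c, derC j (Psi c) (Psi' c)) ->
  derC j (fun x => momentum (H x) (fun c => Psi c x) c)
    (fun x => (momentum (H' x) (fun c => Psi c x) c + momentum (H x) (fun c => Psi' c x) c)%C).
Proof.
  intros HH HP; unfold momentum, vadd, vscal, aF, cF.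
  eapply derC_ext; [intros; reflexivity| |apply derC_plus; [|apply derC_scal]].
  2: { apply derC_csum; intros m; apply derC_mult;
       [apply derC_conj, HH | apply derC_scal, HP]. }
  2: { apply derC_csum; intros m; apply derC_mult; [apply HH | apply derC_scal, HP]. }
  intros x; cbv beta; rewrite !csum_plus; unfold an, cr; ring.
Qed.
End Commutator.

(** * Modes and the lower bound *)

Lemma NoDup_flat_map {S T : Type} (f : S -> list T) (g : T -> S) l : NoDup l ->
  (forall a, In a l -> NoDup (f a)) -> (forall a x, In a l -> In x (f a) -> g x = a) ->
  NoDup (flat_map f l).
Proof.
  intros Hl Hf Hg; induction Hl as [|a l Ha Hl IH]; simpl; [constructor|].
  apply NoDup_app; [apply Hf; simpl; auto | apply IH |].
  - intros; apply Hf; simpl; auto.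
  - intros; apply Hg; simpl; auto.
  - intros x Hx Hx'; apply in_flat_map in Hx' as [b [Hb Hx']]; apply Ha.
    rewrite <- (Hg a x), (Hg b x); simpl; auto.
Qed.

Lemma in_zrange K z : In z (zrange K) <-> (- Z.of_nat K <= z <= Z.of_nat K)%Z.
Proof.
  unfold zrange; rewrite in_map_iff; split.
  - intros [i [<- Hi]]; apply in_seq in Hi; lia.
  - intros H; exists (Z.to_nat (z + Z.of_nat K)); rewrite in_seq; lia.
Qed.
Lemma NoDup_zrange K : NoDup (zrange K).
Proof.
  apply NoDup_map_NoDup_ForallPairs; [|apply seq_NoDup].
  intros i j _ _ H; lia.
Qed.

Lemma in_box_modes K a b c l : In (a, b, c, l) (box_modes K) <->
  In a (zrange K) /\ In b (zrange K) /\ In c (zrange K).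
Proof.
  unfold box_modes; rewrite in_flat_map; split.
  - intros [a' [Ha H]]; apply in_flat_map in H as [b' [Hb H]].
    apply in_flat_map in H as [c' [Hc H]]; simpl in H.
    destruct H as [H | [H | []]]; injection H; intros; subst; auto.
  - intros [Ha [Hb Hc]]; exists a; split; auto; apply in_flat_map; exists b; split; auto.
    apply in_flat_map; exists c; split; auto; destruct l; simpl; auto.
Qed.
Lemma NoDup_box_modes K : NoDup (box_modes K).
Proof.
  apply (NoDup_flat_map _ (fun m : mode => fst (fst (fst m)))); [apply NoDup_zrange | |].
  - intros a _; apply (NoDup_flat_map _ (fun m : mode => snd (fst (fst m)))); [apply NoDup_zrange | |].
    + intros b _; apply (NoDup_flat_map _ (fun m : mode => snd (fst m))); [apply NoDup_zrange | |].
      * intros c _; repeat constructor; simpl; intuition discriminate.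
      * intros c m _ [<- | [<- | []]]; reflexivity.
    + intros b m _ H; apply in_flat_map in H as [c [_ [<- | [<- | []]]]]; reflexivity.
  - intros a m _ H; apply in_flat_map in H as [b [_ H]].
    apply in_flat_map in H as [c [_ [<- | [<- | []]]]]; reflexivity.
Qed.

Definition modes (L Lam : R) : list mode := filter (allowedb L Lam) (box_modes (cutoffK L Lam)).

Lemma NoDup_modes L Lam : NoDup (modes L Lam).
Proof. apply NoDup_filter, NoDup_box_modes. Qed.
Lemma sum_modes_csum L Lam f : sum_modes L Lam f = csum (modes L Lam) f.
Proof. unfold modes; rewrite csum_filter; reflexivity. Qed.

Lemma norm3_kvec_sqr L n : dot3 (kvec L n) (kvec L n) = norm3 (kvec L n) ^ 2.
Proof. unfold norm3; rewrite pow2_sqrt; [reflexivity|]; unfold dot3; nra. Qed.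

Lemma norm3_kvec_pos L n : 0 < L -> Z3_nonzero n = true -> 0 < norm3 (kvec L n).
Proof.
  intros HL Hn; apply sqrt_lt_R0; destruct n as [[a b] c]; unfold dot3; simpl.
  assert (Hpi : 0 < 2 * PI / L) by (pose proof PI_RGT_0; apply Rdiv_lt_0_compat; lra).
  assert (H : forall z : Z, 2 * PI * IZR z / L = 2 * PI / L * IZR z) by (intros; field; lra).
  rewrite !H; clear H.
  assert (H : (a <> 0 \/ b <> 0 \/ c <> 0)%Z).
  { unfold Z3_nonzero in Hn; destruct (Z.eqb_spec a 0), (Z.eqb_spec b 0), (Z.eqb_spec c 0);
      simpl in Hn; auto; discriminate. }
  assert (Hsq : forall z : Z, z <> 0%Z -> 0 < IZR z * IZR z)
    by (intros z Hz; apply not_0_IZR in Hz; nra).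
  assert (Hsq' : forall z : Z, 0 <= IZR z * IZR z) by (intros; nra).
  assert (0 < IZR a * IZR a + IZR b * IZR b + IZR c * IZR c).
  { pose proof (Hsq' a); pose proof (Hsq' b); pose proof (Hsq' c).
    destruct H as [H | [H | H]]; apply Hsq in H; lra. }
  replace (_ + _) with ((2 * PI / L) ^ 2 * (IZR a * IZR a + IZR b * IZR b + IZR c * IZR c)) by ring.
  apply Rmult_lt_0_compat; [now apply pow_lt | assumption].
Qed.

Definition knorm (L : R) (m : mode) : R := norm3 (kvec L (fst m)).

Lemma modes_allowed L Lam m : In m (modes L Lam) ->
  Z3_nonzero (fst m) = true /\ knorm L m < Lam.
Proof.
  intros H; apply filter_In in H as [_ H]; unfold allowedb in H.
  apply andb_prop in H as [H1 H2]; split; auto; unfold knorm; now destruct Rlt_dec.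
Qed.

Definition acoef (L : R) (eps : mode -> R3) (j : nat) (m : mode) : R :=
  vcomp (eps m) j / sqrt (2 * (L ^ 3) * knorm L m).
(** The phase is the one that accompanies a* in A_j(x); the conjugation inside [aF] restores e^{ikx}
    on the annihilators. *)
Definition awave (L : R) (eps : mode -> R3) (j : nat) (x : R3) : wave :=
  fun m => (RtoC (acoef L eps j m) * expi (- dot3 (kvec L (fst m)) x))%C.
Definition hcoef (L : R) (eps : mode -> R3) (j : nat) (m : mode) : R :=
  vcomp (eps m) j * sqrt (knorm L m).
Definition hwave (L : R) (eps : mode -> R3) (j : nat) (x : R3) : wave :=
  fun m => (RtoC (hcoef L eps j m) * expi (- dot3 (kvec L (fst m)) x))%C.

Lemma Aop_field L Lam eps j Psi c x :
  Aop L Lam eps j Psi c x = field (modes L Lam) (awave L eps j x) (fun c => Psi c x) c.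
Proof.
  unfold Aop, field, vadd, aF, cF; rewrite sum_modes_csum, <- csum_plus.
  apply csum_ext; intros m _; unfold awave, an, cr.
  rewrite Cconj_mult, Cconj_R, Cconj_expi, Ropp_involutive; unfold acoef, knorm; ring.
Qed.

Lemma Piop_vec alpha L Lam eps j Psi x :
  (fun c => Piop alpha L Lam eps j Psi c x) =
  vadd (vscal (- Ci)%C (fun c => pd j (Psi c) x))
    (vscal (RtoC (sqrt alpha)) (field (modes L Lam) (awave L eps j x) (fun c => Psi c x))).
Proof.
  apply functional_extensionality; intros c; unfold Piop, pop, vadd, vscal.
  now rewrite Aop_field.
Qed.

Lemma contC_wave L (a : mode -> R) m :
  contC (fun x => (RtoC (a m) * expi (- dot3 (kvec L (fst m)) x))%C).
Proof. apply contC_mult; [apply contC_const | apply contC_expi]. Qed.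

Lemma rsum_seq3 f : rsum (seq 0 3) f = f 0%nat + f 1%nat + f 2%nat.
Proof. unfold rsum; simpl; ring. Qed.

Section Polarized.
Variables (L Lam : R) (eps : mode -> R3).
Hypothesis HL : 0 < L.
Hypothesis Heps : polarization L eps.
Notation ms := (modes L Lam).
Notation N := (INR (length (modes L Lam))).

Lemma knorm_pos m : In m ms -> 0 < knorm L m.
Proof. intros H; apply norm3_kvec_pos; auto; now apply modes_allowed in H. Qed.

Lemma eps_unit m : In m ms -> rsum (seq 0 3) (fun j => vcomp (eps m) j ^ 2) = 1.
Proof.
  intros H; apply modes_allowed in H as [H _]; destruct m as [n l].
  destruct (Heps n H) as [H1 _]; specialize (H1 l l); rewrite eqb_reflx in H1.
  rewrite rsum_seq3, <- H1; unfold dot3; ring.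
Qed.
Lemma eps_transverse m : In m ms ->
  rsum (seq 0 3) (fun j => vcomp (eps m) j * vcomp (kvec L (fst m)) j) = 0.
Proof.
  intros H; apply modes_allowed in H as [H _]; destruct m as [n l].
  destruct (Heps n H) as [_ H1]; rewrite rsum_seq3; exact (H1 l).
Qed.

(** This is why h_j carries sqrt |k|: it cancels the 1 / sqrt |k| of A_j. Summing over j then
    replaces eps_j^2 by 1, so the commutator simply counts modes. *)
Lemma wip_awave_hwave j x : fst (wip ms (awave L eps j x) (hwave L eps j x)) =
  / sqrt (2 * L ^ 3) * rsum ms (fun m => vcomp (eps m) j ^ 2).
Proof.
  unfold wip; rewrite csum_fst, <- rsum_scal; apply rsum_ext; intros m Hm.
  unfold awave, hwave; rewrite Cconj_mult, Cconj_R.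
  replace (_ * _)%C with (RtoC (acoef L eps j m * hcoef L eps j m) *
    (Cconj (expi (- dot3 (kvec L (fst m)) x)) * expi (- dot3 (kvec L (fst m)) x)))%C
    by (rewrite RtoC_mult; ring).
  rewrite Cconj_mult_self, Cmod_expi; cbn [fst snd Cmult RtoC]; unfold acoef, hcoef.
  assert (0 < L ^ 3) by now apply pow_lt.
  pose proof (knorm_pos m Hm).
  rewrite sqrt_mult by nra; field; split; apply Rgt_not_eq, sqrt_lt_R0; lra.
Qed.
Lemma sum_wip_awave_hwave x :
  rsum (seq 0 3) (fun j => fst (wip ms (awave L eps j x) (hwave L eps j x))) = N / sqrt (2 * L ^ 3).
Proof.
  rewrite (rsum_ext _ _ (fun j => / sqrt (2 * L ^ 3) * rsum ms (fun m => vcomp (eps m) j ^ 2)))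
    by (intros; apply wip_awave_hwave).
  rewrite rsum_scal, rsum_exchange, (rsum_ext ms _ (fun _ => 1)) by apply eps_unit.
  rewrite rsum_const; unfold Rdiv; ring.
Qed.
Lemma hwave_Cmod j x m : 0 <= knorm L m ->
  Cmod (hwave L eps j x m) ^ 2 = vcomp (eps m) j ^ 2 * knorm L m.
Proof.
  intros Hk; unfold hwave; rewrite Cmod_mult, Cmod_expi, Cmod_R, Rmult_1_r, pow2_abs.
  unfold hcoef; rewrite Rpow_mult_distr, pow2_sqrt; auto.
Qed.
Lemma knorm_nonneg m : 0 <= knorm L m.
Proof. apply sqrt_pos. Qed.

Lemma wnsq_hwave j x : wnsq ms (hwave L eps j x) =
  rsum ms (fun m => vcomp (eps m) j ^ 2 * knorm L m).
Proof. apply rsum_ext; intros; apply hwave_Cmod, knorm_nonneg. Qed.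
Lemma sum_wnsq_hwave x :
  rsum (seq 0 3) (fun j => wnsq ms (hwave L eps j x)) <= Lam * N.
Proof.
  rewrite (rsum_ext _ _ (fun j => rsum ms (fun m => vcomp (eps m) j ^ 2 * knorm L m)))
    by (intros; apply wnsq_hwave).
  rewrite rsum_exchange, (Rmult_comm Lam), <- rsum_const; apply rsum_le; intros m Hm.
  rewrite (rsum_ext _ _ (fun j => knorm L m * vcomp (eps m) j ^ 2)), rsum_scal, eps_unit
    by (auto; intros; ring).
  apply modes_allowed in Hm; lra.
Qed.

(** * The completed square, integrated over a trial state *)

Section Trial.
Variables (alpha : R) (Psi : state) (S : list config).
Hypothesis HS : forall c, (exists x, Psi c x <> 0%C) -> In c S.
Hypothesis Hreg : forall c, smooth (Psi c) /\ compact_support (Psi c).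

Let l := nodup eq_dec_classic S.
Notation psi x := (fun c : config => Psi c x).
Notation dpsi j x := (fun c : config => pd j (Psi c) x).
Notation T j x := (momentum ms (hwave L eps j x)).

Lemma NoDup_supp : NoDup l.
Proof. apply NoDup_nodup. Qed.
Lemma supp_psi x : supp_in l (psi x).
Proof. intros c Hc; apply nodup_In, HS; eauto. Qed.
Lemma supp_dpsi j x : (j < 3)%nat -> supp_in l (dpsi j x).
Proof.
  intros Hj c Hc; apply nodup_In, HS.
  destruct (excluded_middle_informative (exists x, Psi c x <> 0%C)) as [|Hn]; auto.
  destruct Hc; assert (H0 : forall y, Psi c y = 0%C).
  { intros y; destruct (excluded_middle_informative (Psi c y = 0%C)); auto.
    destruct Hn; eauto. }
  unfold pd; apply C_eq; simpl.
  - rewrite (Derive_ext _ (fun _ => 0)); [apply Derive_const | intros; now rewrite H0].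
  - rewrite (Derive_ext _ (fun _ => 0)); [apply Derive_const | intros; now rewrite H0].
Qed.
Lemma finsupp_psi x : finsupp (psi x).
Proof. exists l; apply supp_psi. Qed.
Lemma finsupp_dpsi j x : (j < 3)%nat -> finsupp (dpsi j x).
Proof. exists l; now apply supp_dpsi. Qed.
Lemma ccC_psi c : ccC (Psi c).
Proof. destruct (Hreg c) as [H1 H2]; apply (smooth_derC (Psi c) 0); auto. Qed.
Lemma ccC_dpsi j c : (j < 3)%nat -> ccC (pd j (Psi c)).
Proof. intros Hj; destruct (Hreg c) as [H1 H2]; now apply (smooth_derC (Psi c) j). Qed.
Lemma derC_psi j c : (j < 3)%nat -> derC j (Psi c) (pd j (Psi c)).
Proof. intros Hj; destruct (Hreg c) as [H1 H2]; now apply (smooth_derC (Psi c) j). Qed.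

(** The support of Psi together with everything one field operator can reach, hence a support for
    [Piop] applied to Psi. *)
Let l' := nodup eq_dec_classic (l ++ spread ms l).

Lemma NoDup_supp' : NoDup l'.
Proof. apply NoDup_nodup. Qed.
Lemma supp_incl u : supp_in l u -> supp_in l' u.
Proof. apply supp_in_mono; intros c Hc; apply nodup_In, in_or_app; auto. Qed.
Lemma supp_spread_incl u : supp_in (spread ms l) u -> supp_in l' u.
Proof. apply supp_in_mono; intros c Hc; apply nodup_In, in_or_app; auto. Qed.

Lemma normsq_Piop j : (j < 3)%nat ->
  normsq (Piop alpha L Lam eps j Psi) =
    Finite (integral3 (fun x => Nsq (fun c => Piop alpha L Lam eps j Psi c x))) /\
  cc (fun x => Nsq (fun c => Piop alpha L Lam eps j Psi c x)).
Proof.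
  intros Hj; apply normsq_list with l'; [apply NoDup_supp' | |].
  - intros c; apply ccC_plus.
    + apply ccC_mult; [apply contC_const | now apply ccC_dpsi].
    + apply ccC_mult; [apply contC_const|].
      assert (E : Aop L Lam eps j Psi c =
        fun x => field ms (awave L eps j x) (fun c => Psi c x) c)
        by (apply functional_extensionality; intros; apply Aop_field).
      rewrite E; apply ccC_plus;
        [apply ccC_aF | apply ccC_cF]; auto using ccC_psi; intros; apply contC_wave.
  - intros x; rewrite Piop_vec; apply supp_vadd; apply supp_vscal.
    + apply supp_incl; now apply supp_dpsi.
    + apply supp_vadd; apply supp_spread_incl; [apply supp_aF | apply supp_cF]; apply supp_psi.
Qed.

Lemma normsq_psi : normsq Psi = Finite (integral3 (fun x => Nsq (psi x))) /\
  cc (fun x => Nsq (psi x)).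
Proof.
  apply normsq_list with l; [apply NoDup_supp | apply ccC_psi | apply supp_psi].
Qed.

Lemma cc_Nsq_an m : cc (fun x => Nsq (an m (psi x))).
Proof.
  apply cc_ext with (fun x => rsum l (fun c => INR (c m) * Cmod (Psi c x) ^ 2)).
  - intros x; symmetry; apply Nsq_an_list; [apply NoDup_supp | apply supp_psi].
  - apply cc_rsum; intros; apply cc_scal, cc_Cmod2, ccC_psi.
Qed.

Lemma field_energy_psi : field_energy L Lam Psi =
  Finite (integral3 (fun x => rsum ms (fun m => knorm L m * Nsq (an m (psi x))))).
Proof.
  assert (Hcc : forall c, cc (fun x => Cmod (Psi c x) ^ 2)) by (intros; apply cc_Cmod2, ccC_psi).
  assert (E : forall c, fst (sum_modes L Lam (fun m => RtoC (norm3 (kvec L (fst m)) * INR (c m)))) =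
    rsum ms (fun m => knorm L m * INR (c m))).
  { intros c; rewrite sum_modes_csum, csum_RtoC; reflexivity. }
  unfold field_energy; rewrite (sum_configs_list _ l); [| apply NoDup_supp | |].
  - f_equal; transitivity (rsum l (fun c => integral3 (fun x =>
      rsum ms (fun m => knorm L m * (INR (c m) * Cmod (Psi c x) ^ 2))))).
    + apply rsum_ext; intros c _; rewrite E, <- integral3_scal by auto.
      apply integral3_ext; intros x; rewrite Rmult_comm, <- rsum_scal.
      apply rsum_ext; intros; ring.
    + rewrite <- (integral3_rsum l (fun c x =>
        rsum ms (fun m => knorm L m * (INR (c m) * Cmod (Psi c x) ^ 2)))).
      * apply integral3_ext; intros x; rewrite rsum_exchange; apply rsum_ext; intros m _.
        rewrite (Nsq_an_list l), rsum_scal; auto using NoDup_supp, supp_psi.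
      * intros c _; apply cc_rsum; intros; now apply cc_scal, cc_scal.
  - intros c; rewrite E; apply Rmult_le_pos; [|apply integral3_nonneg; auto; intros; apply pow2_ge_0].
    apply rsum_nonneg; intros; apply Rmult_le_pos; [apply knorm_nonneg | apply pos_INR].
  - intros c Hc; apply nodup_In, HS.
    destruct (excluded_middle_informative (exists x, Psi c x <> 0%C)) as [|Hn]; auto.
    destruct Hc; rewrite (integral3_ext _ (fun _ => 0)), integral3_zero; [ring|].
    intros x; destruct (excluded_middle_informative (Psi c x = 0%C)) as [-> | H];
      [rewrite Cmod_0; ring | destruct Hn; eauto].
Qed.

(* [ik . eps = 0]: the conjugate momentum is divergence free, so the cross term with
   the electron momentum is a total divergence. *)
Let flux j x : R := fst (Ci * ip (psi x) (T j x (psi x)))%C.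
Let dhwave j x : wave :=
  fun m => (RtoC (hcoef L eps j m) *
    (- Ci * RtoC (vcomp (kvec L (fst m)) j) * expi (- dot3 (kvec L (fst m)) x)))%C.
Let cross j x : R := fst (ip (vscal (- Ci)%C (dpsi j x)) (T j x (psi x))).
Let dflux j x : R := 2 * cross j x + fst (Ci * ip (psi x) (momentum ms (dhwave j x) (psi x)))%C.

Lemma ccC_ip (F G : state) : (forall c, ccC (F c)) -> (forall c, ccC (G c)) ->
  (forall x, supp_in l (fun c => F c x)) ->
  ccC (fun x => ip (fun c => F c x) (fun c => G c x)).
Proof.
  intros HF HG Hs.
  assert (E : (fun x => ip (fun c => F c x) (fun c => G c x)) =
    (fun x => csum l (fun c => (Cconj (F c x) * G c x)%C))).
  { apply functional_extensionality; intros x; apply ip_list; [apply NoDup_supp | apply Hs]. }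
  rewrite E; apply (ccC_csum l (fun c x => (Cconj (F c x) * G c x)%C)).
  intros c; apply ccC_mult; [apply contC_conj, HF | apply HG].
Qed.

Lemma ccC_T_psi j c : ccC (fun x => T j x (psi x) c).
Proof. apply ccC_momentum; auto using ccC_psi; intros; apply contC_wave. Qed.

Lemma cc_cross j : (j < 3)%nat -> cc (cross j).
Proof.
  intros Hj; apply cc_fst, (ccC_ip (fun c x => (- Ci * pd j (Psi c) x)%C) (fun c x => T j x (psi x) c)).
  - intros c; apply ccC_mult; [apply contC_const | now apply ccC_dpsi].
  - intros c; apply ccC_T_psi.
  - intros x; apply (supp_vscal l (- Ci)%C (dpsi j x)); now apply supp_dpsi.
Qed.

Lemma cc_flux j : (j < 3)%nat -> cc (flux j) /\ cc (dflux j).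
Proof.
  intros Hj; split.
  - apply cc_fst, ccC_mult; [apply contC_const|].
    apply (ccC_ip Psi (fun c x => T j x (psi x) c)); auto using ccC_psi, ccC_T_psi, supp_psi.
  - apply cc_plus; [now apply cc_scal, cc_cross|].
    apply cc_fst, ccC_mult; [apply contC_const|].
    apply (ccC_ip Psi (fun c x => momentum ms (dhwave j x) (psi x) c)); auto using ccC_psi, supp_psi.
    intros c; apply ccC_momentum; auto using ccC_psi; intros m; unfold dhwave.
    apply contC_mult; [apply contC_const|]; apply contC_mult; [apply contC_const | apply contC_expi].
Qed.

(** Product rule. With z = <d Psi, T Psi>, antisymmetry of T turns <Psi, T d Psi> into minus the
    conjugate of z, and Re (i z) - Re (i conj z) = 2 Re (i z), which is twice [cross]. *)
Lemma is_derive_flux j x : (j < 3)%nat ->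
  is_derive (fun t => flux j (Defs.shift x j t)) 0 (dflux j x).
Proof.
  intros Hj.
  assert (HT : forall c, derC j (fun x => T j x (psi x) c)
    (fun x => (momentum ms (dhwave j x) (psi x) c + T j x (dpsi j x) c)%C)).
  { intros c; apply derC_momentum; [|intros; now apply derC_psi].
    intros m; apply derC_scal, derC_expi; auto. }
  assert (H : derC j (fun x => Ci * csum l (fun c => Cconj (Psi c x) * T j x (psi x) c))%C
    (fun x => Ci * csum l (fun c => Cconj (pd j (Psi c) x) * T j x (psi x) c +
      Cconj (Psi c x) * (momentum ms (dhwave j x) (psi x) c + T j x (dpsi j x) c)))%C).
  { apply derC_scal.
    apply (derC_csum j l (fun c x => (Cconj (Psi c x) * T j x (psi x) c)%C)); intros c.
    apply derC_mult; auto; apply derC_conj; now apply derC_psi. }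
  destruct (H x) as [H1 _]; cbv beta in H1.
  match type of H1 with is_derive _ _ ?d => replace (dflux j x) with d end.
  - apply is_derive_ext with (2 := H1).
    intros t; unfold flux; rewrite (ip_list l); auto using NoDup_supp, supp_psi.
  - pose proof (finsupp_psi x) as Hp; pose proof (finsupp_dpsi j x Hj) as Hd.
    rewrite csum_plus.
    rewrite <- (ip_list l (dpsi j x) (T j x (psi x))) by auto using NoDup_supp, supp_dpsi.
    assert (E : ip (psi x) (vadd (momentum ms (dhwave j x) (psi x)) (T j x (dpsi j x))) =
      csum l (fun c => Cconj (Psi c x) *
        (momentum ms (dhwave j x) (psi x) c + T j x (dpsi j x) c))%C)
      by (apply (ip_list l); auto using NoDup_supp, supp_psi).
    rewrite <- E, ip_addr by auto.
    rewrite (momentum_antisym ms _ (psi x) (dpsi j x)) by auto.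
    rewrite <- (ip_conj (dpsi j x) (T j x (psi x))) by auto.
    unfold dflux, cross; rewrite ip_scall by auto; simpl; ring.
Qed.

Lemma integral_cross : rsum (seq 0 3) (fun j => integral3 (cross j)) = 0.
Proof.
  assert (H : forall j, In j (seq 0 3) -> integral3 (dflux j) = 0).
  { intros j Hj; apply in_seq in Hj; destruct (cc_flux j) as [H1 H2]; [lia|].
    apply (integral3_derive j (flux j)); auto; [lia|]; intros; apply is_derive_flux; lia. }
  assert (H0 : rsum (seq 0 3) (fun j => integral3 (dflux j)) = 0) by (apply rsum_zero; exact H).
  assert (Hj : forall j, In j (seq 0 3) -> (j < 3)%nat) by (intros j Hj; apply in_seq in Hj; lia).
  rewrite <- integral3_rsum in H0 by (intros; apply cc_flux; auto).
  rewrite (integral3_ext _ (fun x => 2 * rsum (seq 0 3) (fun j => cross j x))) in H0.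
  - rewrite integral3_scal, integral3_rsum in H0; [lra | intros; apply cc_cross; auto |].
    apply cc_rsum; intros; apply cc_cross; auto.
  - intros x; unfold dflux; rewrite rsum_plus, rsum_scal.
    match goal with |- _ + ?r = _ => replace r with 0; [ring|] end.
    (* The derivatives of the three waves are added before any estimate: each carries a factor -i
       k_j, and the sum over j contains k . eps = 0, so the total wave vanishes mode by mode. *)
    transitivity (fst (Ci * ip (psi x) (momentum ms
      (wadd (wadd (dhwave 0 x) (dhwave 1 x)) (dhwave 2 x)) (psi x)))%C).
    + replace (momentum ms _ (psi x)) with vzero; [rewrite ip_zeror; simpl; ring|].
      symmetry; apply functional_extensionality; intros c; unfold momentum, vadd, vscal, aF, cF, vzero.
      assert (Hz : forall m, In m ms -> wadd (wadd (dhwave 0 x) (dhwave 1 x)) (dhwave 2 x) m = 0%C).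
      { intros m Hm; unfold wadd, dhwave, hcoef.
        transitivity (RtoC (sqrt (knorm L m) * rsum (seq 0 3) (fun j => vcomp (eps m) j *
          vcomp (kvec L (fst m)) j)%R) * (- Ci * expi (- dot3 (kvec L (fst m)) x)))%C.
        - rewrite rsum_seq3, !RtoC_mult, !RtoC_plus, !RtoC_mult; ring.
        - rewrite eps_transverse by auto; rewrite Rmult_0_r; ring. }
      rewrite !csum_zero; [ring | |]; intros m Hm; rewrite Hz by auto; rewrite ?Cconj_0; ring.
    + pose proof (finsupp_psi x) as Hp.
      rewrite !momentum_wadd, !ip_addr by auto; rewrite rsum_seq3; simpl; ring.
Qed.
(** Each j contributes the sum of eps_j^2 over the modes times the field energy; over the three
    components these sums add up to N. *)
Lemma sum_Nsq_aF_hwave x :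
  rsum (seq 0 3) (fun j => Nsq (aF ms (hwave L eps j x) (psi x))) <=
  N * rsum ms (fun m => knorm L m * Nsq (an m (psi x))).
Proof.
  set (E := rsum ms (fun m => knorm L m * Nsq (an m (psi x)))).
  apply Rle_trans with (rsum (seq 0 3) (fun j => E * rsum ms (fun m => vcomp (eps m) j ^ 2))).
  - apply rsum_le; intros j _; rewrite Rmult_comm.
    apply (Nsq_aF_le ms l'); [apply knorm_nonneg | apply NoDup_supp' | |].
    + intros m Hm; apply supp_spread_incl, supp_an; auto using supp_psi.
    + intros m; apply hwave_Cmod, knorm_nonneg.
  - rewrite rsum_scal, rsum_exchange, (rsum_ext ms _ (fun _ => 1)) by apply eps_unit.
    rewrite rsum_const; lra.
Qed.

Lemma pointwise_bound s x :
  0 <= rsum (seq 0 3) (fun j => Nsq (fun c => Piop alpha L Lam eps j Psi c x))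
    + 2 * s * rsum (seq 0 3) (fun j => cross j x)
    + (2 * s ^ 2 * Lam * N - 2 * s * sqrt alpha * (N / sqrt (2 * L ^ 3))) * Nsq (psi x)
    + 4 * s ^ 2 * N * rsum ms (fun m => knorm L m * Nsq (an m (psi x))).
Proof.
  set (E := rsum ms (fun m => knorm L m * Nsq (an m (psi x)))).
  pose proof (sum_Nsq_aF_hwave x) as HA; fold E in HA.
  pose proof (sum_wip_awave_hwave x) as HG; pose proof (sum_wnsq_hwave x) as HW.
  pose proof (finsupp_psi x) as Hp.
  assert (HQ : forall j, (j < 3)%nat ->
    0 <= Nsq (fun c => Piop alpha L Lam eps j Psi c x) + 2 * s * cross j x
      - 2 * s * sqrt alpha * fst (wip ms (awave L eps j x) (hwave L eps j x)) * Nsq (psi x)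
      + s ^ 2 * (4 * Nsq (aF ms (hwave L eps j x) (psi x)) +
          2 * wnsq ms (hwave L eps j x) * Nsq (psi x))).
  { intros j Hj; rewrite Piop_vec; apply completed_square; auto using NoDup_modes.
    apply finsupp_vscal; now apply finsupp_dpsi. }
  rewrite rsum_seq3 in *.
  pose proof (HQ 0%nat ltac:(lia)); pose proof (HQ 1%nat ltac:(lia)); pose proof (HQ 2%nat ltac:(lia)).
  rewrite <- HG; clear HG HQ.
  pose proof (Nsq_nonneg _ Hp).
  pose proof (Rmult_le_compat_l (4 * s ^ 2) _ _ ltac:(pose proof (pow2_ge_0 s); lra) HA).
  pose proof (Rmult_le_compat_l (2 * s ^ 2 * Nsq (psi x)) _ _
    ltac:(pose proof (pow2_ge_0 s); apply Rmult_le_pos; lra) HW).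
  rewrite rsum_seq3; lra.
Qed.

Lemma energy_lower s n q0 q1 q2 h :
  normsq Psi = Finite n ->
  normsq (Piop alpha L Lam eps 0 Psi) = Finite q0 ->
  normsq (Piop alpha L Lam eps 1 Psi) = Finite q1 ->
  normsq (Piop alpha L Lam eps 2 Psi) = Finite q2 ->
  field_energy L Lam Psi = Finite h ->
  0 <= q0 + q1 + q2
    + (2 * s ^ 2 * Lam * N - 2 * s * sqrt alpha * (N / sqrt (2 * L ^ 3))) * n
    + 4 * s ^ 2 * N * h.
Proof.
  intros Hn H0 H1 H2 Hh.
  destruct normsq_psi as [En Cn]; rewrite En in Hn; injection Hn as <-.
  rewrite field_energy_psi in Hh; injection Hh as <-.
  destruct (normsq_Piop 0 ltac:(lia)) as [E0 C0]; rewrite E0 in H0; injection H0 as <-.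
  destruct (normsq_Piop 1 ltac:(lia)) as [E1 C1]; rewrite E1 in H1; injection H1 as <-.
  destruct (normsq_Piop 2 ltac:(lia)) as [E2 C2]; rewrite E2 in H2; injection H2 as <-.
  pose proof integral_cross as HX.
  assert (Hj : forall j, In j (seq 0 3) -> (j < 3)%nat) by (intros j Hj; apply in_seq in Hj; lia).
  rewrite <- integral3_rsum in HX by (intros; apply cc_cross; auto).
  assert (CX : cc (fun x => rsum (seq 0 3) (fun j => cross j x)))
    by (apply cc_rsum; intros; apply cc_cross; auto).
  assert (CH : cc (fun x => rsum ms (fun m => knorm L m * Nsq (an m (psi x)))))
    by (apply cc_rsum; intros; apply cc_scal, cc_Nsq_an).
  match goal with |- 0 <= ?Q + ?R1 + ?R2 =>
    enough (H : 0 <= Q + 2 * s * integral3 (fun x => rsum (seq 0 3) (fun j => cross j x)) + R1 + R2)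
      by (rewrite HX in H; lra) end.
  rewrite <- !integral3_scal, <- !integral3_plus; auto 10 using cc_plus, cc_scal.
  apply integral3_nonneg; [auto 10 using cc_plus, cc_scal|].
  intros x; pose proof (pointwise_bound s x) as H; rewrite rsum_seq3 in H.
  exact H.
Qed.
End Trial.
End Polarized.

(** * Counting modes and the resulting lower bound *)

(** The cutoff in units of the lattice spacing 2 pi / L: the allowed modes are the nonzero n in Z^3
    with |n| < [radius]. *)
Definition radius (L Lam : R) : R := Lam * L / (2 * PI).

Lemma knorm_lt_radius L Lam a b c : 0 < L -> 0 < Lam ->
  IZR a ^ 2 + IZR b ^ 2 + IZR c ^ 2 < radius L Lam ^ 2 -> norm3 (kvec L (a, b, c)) < Lam.
Proof.
  intros HL HLam H; pose proof PI_RGT_0.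
  unfold norm3; rewrite <- (sqrt_pow2 Lam) by lra; apply sqrt_lt_1_alt; split.
  - unfold dot3; nra.
  - replace (dot3 _ _) with ((2 * PI / L) ^ 2 * (IZR a ^ 2 + IZR b ^ 2 + IZR c ^ 2))
      by (unfold dot3, kvec; simpl; field; lra).
    replace (Lam ^ 2) with ((2 * PI / L) ^ 2 * radius L Lam ^ 2) by (unfold radius; field; lra).
    apply Rmult_lt_compat_l; [|auto]; apply pow_lt, Rdiv_lt_0_compat; lra.
Qed.

Lemma NoDup_prod {S T : Type} (l : list S) (l' : list T) :
  NoDup l -> NoDup l' -> NoDup (list_prod l l').
Proof.
  intros Hl Hl'; induction Hl as [|a l Ha Hl IH]; simpl; [constructor|].
  apply NoDup_app; auto.
  - apply NoDup_map_NoDup_ForallPairs; auto; intros x y _ _ H; congruence.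
  - intros [x y] Hx Hx'; apply in_map_iff in Hx as [z [Hz _]]; apply in_prod_iff in Hx'.
    apply Ha; injection Hz as <- _; tauto.
Qed.

Lemma length_list_prod3 q :
  length (list_prod (list_prod (seq 1 q) (seq 1 q)) (seq 1 q)) = (q * q * q)%nat.
Proof. now rewrite !length_prod, !length_seq. Qed.

(** The cube of points with coordinates from 1 to q = floor (radius / 2) lies in the ball, since 3 /
    4 < 1, and avoids the origin; one polarization is enough. For radius >= 4 one has q >= radius /
    4. *)
Lemma modes_count L Lam : 0 < L -> 4 <= radius L Lam ->
  (radius L Lam / 4) ^ 3 <= INR (length (modes L Lam)).
Proof.
  intros HL HR; pose proof PI_RGT_0.
  assert (HLam : 0 < Lam).
  { assert (E : Lam * L = radius L Lam * (2 * PI)) by (unfold radius; field; lra).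
    apply Rmult_lt_reg_r with L; auto; rewrite E, Rmult_0_l; apply Rmult_lt_0_compat; lra. }
  set (rad := radius L Lam) in *.
  destruct (nfloor_ex (rad / 2)) as [q [Hq1 Hq2]]; [lra|].
  set (f := fun t : nat * nat * nat =>
    (Z.of_nat (fst (fst t)), Z.of_nat (snd (fst t)), Z.of_nat (snd t), false) : mode).
  set (l := list_prod (list_prod (seq 1 q) (seq 1 q)) (seq 1 q)).
  apply Rle_trans with (INR (length (map f l))).
  - rewrite length_map; unfold l; rewrite length_list_prod3, !mult_INR.
    replace (INR q * INR q * INR q) with (INR q ^ 3) by ring.
    apply pow_incr; lra.
  - apply le_INR, NoDup_incl_length.
    + apply NoDup_map_NoDup_ForallPairs.
      * intros [[a b] c] [[a' b'] c'] _ _ H0; unfold f in H0; simpl in H0.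
        injection H0; intros H1 H2 H3; apply Nat2Z.inj in H1, H2, H3; congruence.
      * unfold l; repeat apply NoDup_prod; apply seq_NoDup.
    + intros m Hm; apply in_map_iff in Hm as [[[a b] c] [<- Ht]].
      apply in_prod_iff in Ht as [Ht Hc]; apply in_prod_iff in Ht as [Ha Hb].
      apply in_seq in Ha, Hb, Hc; unfold f; simpl.
      assert (HK : (Z.of_nat q <= Z.of_nat (cutoffK L Lam))%Z).
      { unfold cutoffK; fold rad; rewrite Z2Nat.id; destruct (archimed rad) as [H1 _].
        - apply le_IZR; rewrite <- INR_IZR_INZ; change (INR q <= IZR (up rad)); lra.
        - apply le_IZR; change (0 <= IZR (up rad)); lra. }
      apply filter_In; split.
      * apply in_box_modes; rewrite !in_zrange; lia.
      * unfold allowedb; apply andb_true_intro; split.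
        -- unfold Z3_nonzero; simpl; destruct (Z.eqb_spec (Z.of_nat a) 0); [lia | reflexivity].
        -- destruct Rlt_dec as [|Hn]; [reflexivity|]; destruct Hn.
           apply knorm_lt_radius; auto; fold rad; rewrite <- !INR_IZR_INZ.
           assert (Hle : forall i, (1 <= i < 1 + q)%nat -> INR i ^ 2 <= (rad / 2) ^ 2).
           { intros i Hi; apply pow_incr; split; [apply pos_INR|].
             apply Rle_trans with (INR q); [apply le_INR; lia | lra]. }
           apply Hle in Ha, Hb, Hc; nra.
Qed.

Lemma Rpower_half x : 0 < x -> Rpower x (1 / 2) = sqrt x.
Proof. intros; replace (1 / 2) with (/ 2) by lra; now apply Rpower_sqrt. Qed.
Lemma Rpower_three_halves x : 0 < x -> Rpower x (3 / 2) = x * sqrt x.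
Proof.
  intros; replace (3 / 2) with (1 + / 2) by lra.
  rewrite Rpower_plus, Rpower_1, Rpower_sqrt; auto.
Qed.

Lemma E0_lower_bound : exists C1, 0 < C1 /\
  forall alpha, 0 < alpha -> forall L, 0 < L -> forall eps, polarization L eps ->
  exists Lam0, forall Lam, Lam0 < Lam ->
    Rbar_lt (Finite (C1 * Rpower alpha (1 / 2) * Rpower Lam (3 / 2))) (E0 alpha L Lam eps).
Proof.
  pose proof PI_RGT_0 as Hpi.
  (* 512 pi^3 = (8 pi)^3, because [modes_count] yields N >= (Lam L / (8 pi))^3. *)
  set (c := / sqrt (512 * PI ^ 3)).
  assert (HP3 : 0 < 512 * PI ^ 3) by (apply Rmult_lt_0_compat; [lra | now apply pow_lt]).
  assert (Hc : 0 < c) by (apply Rinv_0_lt_compat, sqrt_lt_R0; auto).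
  exists (c / 8); split; [lra|]; intros alpha Ha L HL eps Heps.
  assert (Hsa : 0 < sqrt alpha) by now apply sqrt_lt_R0.
  (* The second threshold gives [radius] > 4; the third gives Lam <= (c / 4) sqrt alpha Lam^(3/2),
     which absorbs the loss Lam / 2. *)
  exists (Rmax (Rmax 1 (8 * PI / L)) ((4 / (c * sqrt alpha)) ^ 2)); intros Lam HLam.
  pose proof (Rmax_l (Rmax 1 (8 * PI / L)) ((4 / (c * sqrt alpha)) ^ 2)).
  pose proof (Rmax_r (Rmax 1 (8 * PI / L)) ((4 / (c * sqrt alpha)) ^ 2)).
  pose proof (Rmax_l 1 (8 * PI / L)); pose proof (Rmax_r 1 (8 * PI / L)).
  assert (Hl1 : 1 < Lam) by lra; assert (Hl2 : 8 * PI / L < Lam) by lra.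
  assert (Hl3 : (4 / (c * sqrt alpha)) ^ 2 < Lam) by lra; clear HLam.
  rewrite Rpower_half, Rpower_three_halves by lra.
  set (X := Lam * sqrt Lam).
  assert (Hsl : 4 / (c * sqrt alpha) < sqrt Lam).
  { rewrite <- (sqrt_pow2 (4 / (c * sqrt alpha))); [apply sqrt_lt_1_alt; split; [apply pow2_ge_0 | auto]|].
    apply Rlt_le, Rdiv_lt_0_compat; [lra | now apply Rmult_lt_0_compat]. }
  assert (HX : Lam <= c / 4 * sqrt alpha * X).
  { unfold X; replace (c / 4 * sqrt alpha * (Lam * sqrt Lam)) with
      (Lam * ((c * sqrt alpha) * sqrt Lam / 4)) by field.
    rewrite <- (Rmult_1_r Lam) at 1; apply Rmult_le_compat_l; [lra|].
    apply Rmult_lt_compat_l with (r := c * sqrt alpha) in Hsl; [|now apply Rmult_lt_0_compat].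
    replace (c * sqrt alpha * (4 / (c * sqrt alpha))) with 4 in Hsl by (field; split; lra); lra. }
  assert (HXpos : 0 < X) by (apply Rmult_lt_0_compat; [lra | apply sqrt_lt_R0; lra]).
  (* A bound valid for every quotient bounds the infimum only weakly; halving the constant makes the
     inequality strict. *)
  apply Rbar_lt_le_trans with (Finite (c / 4 * sqrt alpha * X)).
  { simpl; assert (0 < c * sqrt alpha * X) by (apply Rmult_lt_0_compat; [now apply Rmult_lt_0_compat | auto]); lra. }
  apply Glb_Rbar_correct; intros r [Psi [[[S HS] [_ Hreg]] [n [q0 [q1 [q2 [h
    [En [Hn [Eq0 [Eq1 [Eq2 [Eh ->]]]]]]]]]]]]]; simpl.
  set (N := INR (length (modes L Lam))).
  assert (HN : Lam ^ 3 * L ^ 3 / (512 * PI ^ 3) <= N).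
  { replace (Lam ^ 3 * L ^ 3 / (512 * PI ^ 3)) with ((radius L Lam / 4) ^ 3)
      by (unfold radius; field; lra).
    apply modes_count; auto; unfold radius.
    apply Rmult_lt_compat_r with (r := L / (2 * PI)) in Hl2; [|apply Rdiv_lt_0_compat; lra].
    replace (8 * PI / L * (L / (2 * PI))) with 4 in Hl2 by (field; lra).
    replace (Lam * L / (2 * PI)) with (Lam * (L / (2 * PI))) by (field; lra); lra. }
  assert (HL3 : 0 < L ^ 3) by now apply pow_lt.
  assert (HN0 : 0 < N).
  { apply Rlt_le_trans with (2 := HN); apply Rdiv_lt_0_compat; auto.
    apply Rmult_lt_0_compat; auto; apply pow_lt; lra. }
  (* This s makes 4 s^2 N = 2, so half of the inequality contains the field energy with coefficient
     exactly one, and the commutator contributes sqrt (alpha N / V) / 2. *)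
  pose proof (energy_lower L Lam eps HL Heps alpha Psi S HS Hreg (/ sqrt (2 * N)) n q0 q1 q2 h
    En Eq0 Eq1 Eq2 Eh) as HE; fold N in HE.
  assert (Hs2 : (/ sqrt (2 * N)) ^ 2 = / (2 * N))
    by (rewrite pow_inv, pow2_sqrt; lra).
  rewrite Hs2 in HE.
  assert (Hg : / sqrt (2 * N) * (N / sqrt (2 * L ^ 3)) = sqrt N / (2 * sqrt (L ^ 3))).
  { rewrite !sqrt_mult by lra.
    rewrite <- (sqrt_sqrt N) at 2 by lra.
    pose proof (sqrt_lt_R0 _ HN0); pose proof (sqrt_lt_R0 _ HL3).
    pose proof (sqrt_lt_R0 2 ltac:(lra)).
    transitivity (sqrt N / (sqrt 2 * sqrt 2 * sqrt (L ^ 3))); [field; lra|].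
    now rewrite (sqrt_sqrt 2) by lra. }
  assert (HG : c * X <= sqrt N / sqrt (L ^ 3)).
  { rewrite <- sqrt_div_alt by auto; unfold c, X.
    replace (Lam * sqrt Lam) with (sqrt (Lam ^ 3)).
    2: { replace (Lam ^ 3) with (Lam * Lam * Lam) by ring.
         rewrite sqrt_mult, sqrt_square by nra; reflexivity. }
    rewrite Rmult_comm; change (sqrt (Lam ^ 3) / sqrt (512 * PI ^ 3) <= sqrt (N / L ^ 3)).
    rewrite <- sqrt_div_alt by auto; apply sqrt_le_1_alt.
    apply Rmult_le_reg_r with (L ^ 3); auto.
    replace (N / L ^ 3 * L ^ 3) with N by (field; lra).
    replace (Lam ^ 3 / (512 * PI ^ 3) * L ^ 3) with (Lam ^ 3 * L ^ 3 / (512 * PI ^ 3));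
      [auto | field; lra]. }
  apply Rmult_le_reg_r with n; auto.
  replace (((q0 + q1 + q2) / 2 + h) / n * n) with ((q0 + q1 + q2) / 2 + h) by (field; lra).
  replace (2 * / sqrt (2 * N) * sqrt alpha * (N / sqrt (2 * L ^ 3))) with
    (2 * sqrt alpha * (/ sqrt (2 * N) * (N / sqrt (2 * L ^ 3)))) in HE by ring.
  rewrite Hg in HE.
  replace (4 * / (2 * N) * N * h) with (2 * h) in HE by (field; lra).
  replace (2 * / (2 * N) * Lam * N) with Lam in HE by (field; lra).
  replace (2 * sqrt alpha * (sqrt N / (2 * sqrt (L ^ 3)))) with
    (sqrt alpha * (sqrt N / sqrt (L ^ 3))) in HE
    by (field; apply Rgt_not_eq, sqrt_lt_R0; auto).
  apply Rle_trans with ((sqrt alpha * (sqrt N / sqrt (L ^ 3)) - Lam) / 2 * n); [|lra].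
  apply Rmult_le_compat_r; [lra|].
  apply Rmult_le_compat_l with (r := sqrt alpha) in HG; [lra | lra].
Qed.

(** * A smooth bump *)

Fixpoint diff_k (k : nat) (f : R -> R) : Prop :=
  match k with
  | O => forall x, continuous f x
  | S k => exists f', (forall x, is_derive f x (f' x)) /\ diff_k k f'
  end.
Definition smooth1 (f : R -> R) : Prop := forall k, diff_k k f.

Lemma diff_k_continuous k f : diff_k k f -> forall x, continuous f x.
Proof.
  destruct k; [auto|]; intros [f' [Hf _]] x; apply (ex_derive_continuous f); eexists; apply Hf.
Qed.
Lemma diff_k_pred k : forall f, diff_k (S k) f -> diff_k k f.
Proof.
  induction k; intros f Hf; [exact (diff_k_continuous 1 f Hf)|].
  destruct Hf as [f' [Hd Hf']]; exists f'; auto.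
Qed.
Lemma diff_k_plus k : forall f g, diff_k k f -> diff_k k g -> diff_k k (fun x => f x + g x).
Proof.
  induction k; intros f g Hf Hg.
  - intros x; apply (continuous_plus f g); auto.
  - destruct Hf as [f' [Hf Hf']], Hg as [g' [Hg Hg']].
    exists (fun x => f' x + g' x); split; auto.
    intros x; apply (is_derive_plus f g); auto.
Qed.
Lemma diff_k_mult k : forall f g, diff_k k f -> diff_k k g -> diff_k k (fun x => f x * g x).
Proof.
  induction k; intros f g Hf Hg.
  - intros x; apply (continuous_mult f g); auto.
  - pose proof (diff_k_pred _ _ Hf); pose proof (diff_k_pred _ _ Hg).
    destruct Hf as [f' [Hf Hf']], Hg as [g' [Hg Hg']].
    exists (fun x => f' x * g x + f x * g' x); split; [|auto using diff_k_plus].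
    intros x; apply (is_derive_mult f g); auto; intros; apply Rmult_comm.
Qed.
Lemma diff_k_const k a : diff_k k (fun _ => a).
Proof.
  revert a; induction k; intros a; [intros x; apply continuous_const|].
  exists (fun _ => 0); split; auto; intros x; apply (@is_derive_const R_AbsRing R_NormedModule).
Qed.
Lemma diff_k_affine k a b : forall f, diff_k k f -> diff_k k (fun x => f (a * x + b)).
Proof.
  assert (Hd : forall x, is_derive (fun x => a * x + b) x a)
    by (intros x; auto_derive; [auto | ring]).
  induction k; intros f Hf.
  - intros x; apply (continuous_comp (fun x => a * x + b) f); auto.
    apply (ex_derive_continuous (fun x => a * x + b)); eexists; apply Hd.
  - destruct Hf as [f' [Hf Hf']]; exists (fun x => a * f' (a * x + b)); split.
    + intros x; apply (is_derive_comp f (fun x => a * x + b)); auto.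
    + apply diff_k_mult; auto using diff_k_const.
Qed.

Lemma smooth1_Derive f : smooth1 f ->
  (forall x, is_derive f x (Derive f x)) /\ smooth1 (Derive f).
Proof.
  intros Hf; assert (H : forall k, (forall x, is_derive f x (Derive f x)) /\ diff_k k (Derive f)).
  { intros k; destruct (Hf (S k)) as [f' [Hd Hf']].
    assert (E : Derive f = f')
      by (apply functional_extensionality; intros; now apply is_derive_unique).
    rewrite E; auto. }
  split; [apply (H 0%nat) | intros k; apply H].
Qed.

(** The family over all n is closed under differentiation up to linear combinations, so smoothness
    follows by induction on the order with n general. *)
Definition flat (n : nat) (t : R) : R := if Rlt_dec 0 t then (/ t) ^ n * exp (- / t) else 0.

Lemma flat_nonpos n t : t <= 0 -> flat n t = 0.
Proof. intros; unfold flat; destruct Rlt_dec; lra. Qed.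
(** From exp u >= u^(n+2) / (n+2)! at u = 1 / t. Being quadratic, the bound makes the difference
    quotient at 0 tend to zero. *)
Lemma flat_bound n t : Rabs (flat n t) <= INR (Factorial.fact (n + 2)) * t ^ 2.
Proof.
  pose proof (INR_fact_lt_0 (n + 2)).
  unfold flat; destruct Rlt_dec as [Ht | Ht];
    [|rewrite Rabs_R0; apply Rmult_le_pos; [lra | apply pow2_ge_0]].
  assert (Hu : 0 < / t) by now apply Rinv_0_lt_compat.
  rewrite Rabs_right by (apply Rle_ge, Rmult_le_pos; [apply pow_le; lra | apply Rlt_le, exp_pos]).
  assert (Hexp : (/ t) ^ (n + 2) / INR (Factorial.fact (n + 2)) <= exp (/ t)).
  { eapply Rle_trans; [|apply (exp_ge_taylor (/ t) (n + 2)); lra].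
    replace (n + 2)%nat with (S (n + 1)) by lia; rewrite tech5.
    assert (0 <= sum_f_R0 (fun k => (/ t) ^ k / INR (Factorial.fact k)) (n + 1)); [|lra].
    apply cond_pos_sum; intros k; apply Rlt_le, Rdiv_lt_0_compat;
      [now apply pow_lt | apply INR_fact_lt_0]. }
  rewrite exp_Ropp; pose proof (exp_pos (/ t)).
  apply Rmult_le_reg_r with (exp (/ t)); [auto|].
  rewrite Rmult_assoc, Rinv_l, Rmult_1_r by lra.
  replace ((/ t) ^ n) with ((/ t) ^ (n + 2) / INR (Factorial.fact (n + 2)) *
    (INR (Factorial.fact (n + 2)) * t ^ 2)).
  - rewrite Rmult_comm; apply Rmult_le_compat_l; auto.
    apply Rmult_le_pos; [lra | apply pow2_ge_0].
  - rewrite pow_add; field; lra.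
Qed.

Lemma is_derive_flat n t : is_derive (flat n) t (- INR n * flat (S n) t + flat (S (S n)) t).
Proof.
  destruct (Rtotal_order t 0) as [Ht | [-> | Ht]].
  - rewrite !flat_nonpos by lra; rewrite Rmult_0_r, Rplus_0_r.
    apply is_derive_ext_loc with (fun _ => 0); [|apply (@is_derive_const R_AbsRing R_NormedModule)].
    assert (Hp : 0 < - t) by lra; exists (mkposreal _ Hp); intros y Hy.
    change (Rabs (y - t) < - t) in Hy; apply Rabs_def2 in Hy.
    symmetry; apply flat_nonpos; lra.
  - rewrite !flat_nonpos by lra; rewrite Rmult_0_r, Rplus_0_r.
    apply is_derive_Reals; intros eps Heps.
    set (C := INR (Factorial.fact (n + 2))).
    assert (HC : 0 < C) by apply INR_fact_lt_0.
    assert (Hd : 0 < eps / C) by now apply Rdiv_lt_0_compat.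
    exists (mkposreal _ Hd); intros h Hh Hlt; simpl in Hlt.
    rewrite Rplus_0_l, (flat_nonpos n 0), !Rminus_0_r by lra.
    unfold Rdiv; rewrite Rabs_mult, Rabs_inv.
    assert (0 < Rabs h) by now apply Rabs_pos_lt.
    apply Rmult_lt_reg_r with (Rabs h); auto.
    rewrite Rmult_assoc, Rinv_l, Rmult_1_r by lra.
    eapply Rle_lt_trans; [apply flat_bound|]; fold C; rewrite <- (pow2_abs h).
    apply Rmult_lt_compat_l with (r := C) in Hlt; auto.
    replace (C * (eps / C)) with eps in Hlt by (field; lra); nra.
  - apply is_derive_ext_loc with (fun t => (/ t) ^ n * exp (- / t)).
    + exists (mkposreal _ Ht); intros y Hy.
      change (Rabs (y - t) < t) in Hy; apply Rabs_def2 in Hy.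
      unfold flat; destruct Rlt_dec; [reflexivity | lra].
    + auto_derive; [lra|]; unfold flat; destruct Rlt_dec; [|lra].
      destruct n; simpl; field; lra.
Qed.

Lemma diff_k_flat k : forall n, diff_k k (flat n).
Proof.
  induction k; intros n.
  - intros x; apply (ex_derive_continuous (flat n)); eexists; apply is_derive_flat.
  - eexists; split; [apply is_derive_flat|].
    apply diff_k_plus; auto; apply diff_k_mult; auto using diff_k_const.
Qed.

Definition bump (t : R) : R := flat 0 (t + 1) * flat 0 (1 - t).

Lemma bump_outside t : 1 <= Rabs t -> bump t = 0.
Proof.
  intros H; unfold bump; destruct (Rcase_abs t) as [Ht | Ht].
  - rewrite Rabs_left in H by auto; rewrite (flat_nonpos 0 (t + 1)) by lra; ring.
  - rewrite Rabs_right in H by auto; rewrite (flat_nonpos 0 (1 - t)) by lra; ring.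
Qed.
Lemma bump_pos t : - 1 < t < 1 -> 0 < bump t.
Proof.
  intros H; unfold bump, flat; destruct Rlt_dec, Rlt_dec; try lra; simpl.
  rewrite !Rmult_1_l; apply Rmult_lt_0_compat; apply exp_pos.
Qed.
Lemma smooth1_bump : smooth1 bump.
Proof.
  intros k; apply diff_k_mult.
  - assert (H := diff_k_affine k 1 1 _ (diff_k_flat k 0)).
    assert (E : (fun t => flat 0 (t + 1)) = (fun t => flat 0 (1 * t + 1)))
      by (apply functional_extensionality; intros; f_equal; ring).
    now rewrite E.
  - assert (H := diff_k_affine k (-1) 1 _ (diff_k_flat k 0)).
    assert (E : (fun t => flat 0 (1 - t)) = (fun t => flat 0 (-1 * t + 1)))
      by (apply functional_extensionality; intros; f_equal; ring).
    now rewrite E.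
Qed.

Lemma RIntM_rescale l (f : R -> R) : 0 < l -> (forall x, continuous f x) ->
  RIntM l (fun t => f (/ l * t)) = l * RIntM 1 f.
Proof.
  intros Hl Hf; unfold RIntM.
  assert (E : RInt (fun t => scal (/ l) (f (/ l * t + 0))) (- l) l =
    RInt f (/ l * - l + 0) (/ l * l + 0)).
  { apply (RInt_comp_lin f (/ l) 0 (- l) l); apply (ex_RInt_continuous f); auto. }
  replace (/ l * - l + 0) with (- (1)) in E by (field; lra).
  replace (/ l * l + 0) with 1 in E by (field; lra).
  rewrite <- E, (RInt_scal (fun t => f (/ l * t + 0))).
  - unfold scal; simpl; unfold mult; simpl.
    rewrite <- Rmult_assoc, Rinv_r, Rmult_1_l by lra.
    apply RInt_ext; intros x _; f_equal; ring.
  - apply (ex_RInt_continuous (fun t => f (/ l * t + 0))); intros z _.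
    apply (continuous_comp (fun t => / l * t + 0) f); auto.
    apply (ex_derive_continuous (fun t => / l * t + 0)); auto_derive; auto.
Qed.

Lemma scaled_bump : exists kappa, 0 < kappa /\ forall l, 0 < l -> exists f : R -> R,
  smooth1 f /\ (forall x, l < Rabs x -> f x = 0 /\ Derive f x = 0) /\
  0 < RIntM l (fun x => f x ^ 2) /\
  RIntM l (fun x => Derive f x ^ 2) <= kappa / l ^ 2 * RIntM l (fun x => f x ^ 2).
Proof.
  destruct (smooth1_Derive _ smooth1_bump) as [Hd Hs].
  assert (Hc : forall x, continuous bump x) by apply (smooth1_bump 0%nat).
  assert (Hc' : forall x, continuous (Derive bump) x) by apply (Hs 0%nat).
  assert (Hsq : forall f : R -> R, (forall x, continuous f x) ->
    forall x, continuous (fun x => f x ^ 2) x).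
  { intros f Hf x; apply continuous_ext with (fun x => f x * f x); [intros; simpl; now rewrite Rmult_1_r|].
    now apply (continuous_mult f f). }
  set (A := RIntM 1 (fun x => bump x ^ 2)); set (B := RIntM 1 (fun x => Derive bump x ^ 2)).
  assert (HA : 0 < A).
  { apply RInt_gt_0; [lra | |intros; now apply Hsq].
    intros x Hx; apply pow_lt, bump_pos; lra. }
  assert (HB : 0 <= B).
  { apply RInt_ge_0; [lra | apply (ex_RInt_continuous (fun x => Derive bump x ^ 2)); auto |].
    intros; apply pow2_ge_0. }
  (* By scaling the kinetic quotient is exactly (B / A) / l^2; the 1 only makes the constant visibly
     positive. *)
  exists (B / A + 1); split.
  { assert (0 <= B / A) by (apply Rle_div_r; lra); lra. }
  intros l Hl; assert (Hl' : 0 < / l) by now apply Rinv_0_lt_compat.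
  set (f := fun t => bump (/ l * t)).
  assert (Hsf : smooth1 f).
  { intros k; assert (H := diff_k_affine k (/ l) 0 _ (smooth1_bump k)).
    assert (E : f = (fun t => bump (/ l * t + 0)))
      by (apply functional_extensionality; intros; unfold f; f_equal; ring).
    now rewrite E. }
  assert (Hf' : forall t, Derive f t = / l * Derive bump (/ l * t)).
  { intros t; apply is_derive_unique.
    apply (is_derive_comp bump (fun t => / l * t)); auto.
    auto_derive; [auto | ring]. }
  assert (E1 : RIntM l (fun x => f x ^ 2) = l * A)
    by (apply (RIntM_rescale l (fun x => bump x ^ 2)); auto).
  assert (E2 : RIntM l (fun x => Derive f x ^ 2) = / l * B).
  { transitivity (RIntM l (fun x => / l ^ 2 * Derive bump (/ l * x) ^ 2)).
    - apply RInt_ext; intros x _; rewrite Hf', Rpow_mult_distr, pow_inv; reflexivity.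
    - rewrite (RIntM_scal l (/ l ^ 2) (fun x => Derive bump (/ l * x) ^ 2)).
      + assert (E : RIntM l (fun x => Derive bump (/ l * x) ^ 2) = l * B)
          by (apply (RIntM_rescale l (fun x => Derive bump x ^ 2)); auto).
        rewrite E; field; lra.
      + intros x; apply (continuous_comp (fun x => / l * x) (fun x => Derive bump x ^ 2)); auto.
        apply (ex_derive_continuous (fun t => / l * t)); auto_derive; auto. }
  exists f; repeat split; auto.
  - unfold f; apply bump_outside; rewrite Rabs_mult, (Rabs_right (/ l)) by lra.
    apply Rmult_le_reg_l with l; auto; rewrite <- Rmult_assoc, Rinv_r; lra.
  - assert (Hp : 0 < Rabs x - l) by lra.
    rewrite (Derive_ext_loc _ (fun _ => 0)); [apply Derive_const|].
    exists (mkposreal _ Hp); intros y Hy; change (Rabs (y - x) < Rabs x - l) in Hy.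
    unfold f; apply bump_outside; rewrite Rabs_mult, (Rabs_right (/ l)) by lra.
    apply Rmult_le_reg_l with l; auto; rewrite <- Rmult_assoc, Rinv_r by lra.
    pose proof (Rabs_triang_inv x y); rewrite <- Rabs_Ropp, Ropp_minus_distr in Hy; lra.
  - rewrite E1; now apply Rmult_lt_0_compat.
  - rewrite E1, E2; replace ((B / A + 1) / l ^ 2 * (l * A)) with (/ l * B + / l * A) by (field; lra).
    assert (0 < / l * A) by now apply Rmult_lt_0_compat.
    lra.
Qed.

Definition product3 (u v w : R -> R) (x : R3) : C :=
  RtoC (u (vcomp x 0) * v (vcomp x 1) * w (vcomp x 2)).

Lemma product3_derive u v w x : smooth1 u -> smooth1 v -> smooth1 w ->
  is_derive (fun t => fst (product3 u v w (Defs.shift x 0 t))) 0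
    (fst (product3 (Derive u) v w x)) /\
  is_derive (fun t => fst (product3 u v w (Defs.shift x 1 t))) 0
    (fst (product3 u (Derive v) w x)) /\
  is_derive (fun t => fst (product3 u v w (Defs.shift x 2 t))) 0
    (fst (product3 u v (Derive w) x)).
Proof.
  assert (H : forall f y a, smooth1 f -> is_derive (fun t => a * f (y + t)) 0 (a * Derive f y)).
  { intros f y a Hf; apply smooth1_Derive in Hf as [Hf _].
    assert (ex_derive f (y + 0)) by (eexists; apply Hf).
    auto_derive; [auto|]; rewrite Rplus_0_r, Rmult_1_l; reflexivity. }
  intros Hu Hv Hw; destruct x as [[a b] c]; unfold product3; simpl; (split; [|split]).
  - apply is_derive_ext with (fun t => v b * w c * u (a + t)); [intros; simpl; ring|].
    replace (Derive u a * v b * w c) with (v b * w c * Derive u a) by ring; auto.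
  - apply is_derive_ext with (fun t => u a * w c * v (b + t)); [intros; simpl; ring|].
    replace (u a * Derive v b * w c) with (u a * w c * Derive v b) by ring; auto.
  - apply is_derive_ext with (fun t => u a * v b * w (c + t)); [intros; simpl; ring|]; auto.
Qed.

Lemma pd_product3 u v w : smooth1 u -> smooth1 v -> smooth1 w ->
  pd 0 (product3 u v w) = product3 (Derive u) v w /\
  pd 1 (product3 u v w) = product3 u (Derive v) w /\
  pd 2 (product3 u v w) = product3 u v (Derive w).
Proof.
  intros Hu Hv Hw.
  assert (H := fun x => product3_derive u v w x Hu Hv Hw).
  repeat split; apply functional_extensionality; intros x; destruct (H x) as [H0 [H1 H2]];
    unfold pd; apply C_eq; cbn [fst snd];
    try (now apply is_derive_unique); exact (Derive_const 0 0).
Qed.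

Lemma continuous_RtoC3 (f : R3 -> R) x : continuous f x -> continuous (fun x => RtoC (f x)) x.
Proof. intros H; apply (continuous_pair f (fun _ => 0)); [auto | apply continuous_const]. Qed.

(** Products of one-variable functions are mapped to such products by partial derivatives, so the
    induction on the order runs over all triples. *)
Lemma smooth_product3 u v w : smooth1 u -> smooth1 v -> smooth1 w -> smooth (product3 u v w).
Proof.
  assert (Hc : forall u v w, smooth1 u -> smooth1 v -> smooth1 w ->
    forall x, continuous (product3 u v w) x).
  { clear; intros u v w Hu Hv Hw x; apply continuous_RtoC3; revert x.
    apply cont3_mult; [apply cont3_mult|]; intros x;
      [apply (continuous_comp (fun x => vcomp x 0) u) |
       apply (continuous_comp (fun x => vcomp x 1) v) |
       apply (continuous_comp (fun x => vcomp x 2) w)];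
      try (apply cont3_vcomp; lia); [apply (Hu 0%nat) | apply (Hv 0%nat) | apply (Hw 0%nat)]. }
  intros Hu Hv Hw k; revert u v w Hu Hv Hw; induction k; intros u v w Hu Hv Hw; simpl; [auto|].
  split; [auto|]; split.
  - intros j x Hj; destruct (product3_derive u v w x Hu Hv Hw) as [H0 [H1 H2]].
    split; [|apply ex_derive_const].
    destruct j as [|[|[|]]]; [| | |lia]; eexists; eassumption.
  - intros j Hj; destruct (pd_product3 u v w Hu Hv Hw) as [H0 [H1 H2]].
    apply smooth1_Derive in Hu as Hu', Hv as Hv', Hw as Hw'.
    destruct j as [|[|[|]]]; [rewrite H0 | rewrite H1 | rewrite H2 | lia]; apply IHk; tauto.
Qed.

(** * The upper bound *)

(** A separable majorant: 1 / |n| is at most 2 hsq(n_2) hsq(n_3), which reduces the lattice sum of 1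
    / |k| to sums over one integer. Two coordinates already give the right power, K sqrt K sqrt K =
    K^2. *)
Definition hsq (z : Z) : R := / sqrt (Rabs (IZR z) + 1).

Lemma hsq_nonneg z : 0 <= hsq z.
Proof.
  apply Rlt_le, Rinv_0_lt_compat, sqrt_lt_R0; pose proof (Rabs_pos (IZR z)); lra.
Qed.
(** Telescoping: 1 / sqrt (n+1) <= 2 (sqrt (n+1) - sqrt n). *)
Lemma sum_inv_sqrt n : rsum (seq 0 n) (fun i => / sqrt (INR i + 1)) <= 2 * sqrt (INR n).
Proof.
  induction n; [unfold rsum; simpl; rewrite sqrt_0; lra|].
  rewrite rsum_seq_S, S_INR.
  set (b := sqrt (INR n + 1)); set (a := sqrt (INR n)) in *.
  pose proof (pos_INR n).
  assert (Hb : 0 < b) by (apply sqrt_lt_R0; lra).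
  assert (Ha : 0 <= a) by apply sqrt_pos.
  assert (Ea : a * a = INR n) by (apply sqrt_sqrt; lra).
  assert (Eb : b * b = INR n + 1) by (apply sqrt_sqrt; lra).
  apply Rle_trans with (2 * a + / b); [lra|].
  apply Rmult_le_reg_r with b; auto; rewrite Rmult_plus_distr_r, Rinv_l by lra; nra.
Qed.
Lemma sum_hsq K : rsum (zrange K) hsq <= 4 * sqrt (INR K + 1).
Proof.
  set (l := seq 0 (S K)).
  apply Rle_trans with (rsum (map (fun i => Z.of_nat i) l ++ map (fun i => (- Z.of_nat i)%Z) l) hsq).
  - apply rsum_incl_le; [apply NoDup_zrange | | apply hsq_nonneg].
    intros z Hz; apply in_zrange in Hz; apply in_or_app.
    destruct (Z.le_gt_cases 0 z) as [H | H]; [left | right]; apply in_map_iff.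
    + exists (Z.to_nat z); split; [lia | apply in_seq; lia].
    + exists (Z.to_nat (- z)); split; [lia | apply in_seq; lia].
  - rewrite rsum_app, !rsum_map.
    assert (E : forall i, hsq (Z.of_nat i) = / sqrt (INR i + 1)).
    { intros i; unfold hsq; rewrite <- INR_IZR_INZ, Rabs_right by apply Rle_ge, pos_INR; easy. }
    assert (E' : forall i, hsq (- Z.of_nat i)%Z = / sqrt (INR i + 1)).
    { intros i; unfold hsq; rewrite opp_IZR, Rabs_Ropp; apply E. }
    rewrite (rsum_ext l (fun i => hsq (- Z.of_nat i)%Z) (fun i => / sqrt (INR i + 1))) by auto.
    rewrite (rsum_ext l (fun i => hsq (Z.of_nat i)) (fun i => / sqrt (INR i + 1))) by auto.
    pose proof (sum_inv_sqrt (S K)); rewrite S_INR in H; fold l in H; lra.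
Qed.

Lemma inv_knorm_le L n l : 0 < L -> Z3_nonzero n = true ->
  / knorm L (n, l) <= L / PI * (hsq (snd (fst n)) * hsq (snd n)).
Proof.
  intros HL Hn; pose proof PI_RGT_0; pose proof (norm3_kvec_pos L n HL Hn) as Hp.
  destruct n as [[a b] c]; simpl; unfold knorm; simpl fst.
  set (k := norm3 (kvec L (a, b, c))) in *.
  set (A := IZR a); set (B := Rabs (IZR b)); set (C := Rabs (IZR c)).
  assert (HB : 0 <= B) by apply Rabs_pos; assert (HC : 0 <= C) by apply Rabs_pos.
  assert (Hk : k ^ 2 = (2 * PI / L) ^ 2 * (A ^ 2 + B ^ 2 + C ^ 2)).
  { unfold k; rewrite <- norm3_kvec_sqr; unfold dot3, kvec, A, B, C; simpl.
    rewrite !Rmult_1_r, <- !Rabs_mult, !(Rabs_right (_ * _)) by (apply Rle_ge; nra).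
    field; lra. }
  assert (H1 : 1 <= A ^ 2 + B ^ 2 + C ^ 2).
  { assert (Hz : forall z, z <> 0%Z -> 1 <= IZR z ^ 2).
    { intros z Hz; rewrite <- (pow2_abs (IZR z)), <- abs_IZR.
      assert (1 <= IZR (Z.abs z)) by (apply IZR_le; lia); nra. }
    assert (H0 : (a <> 0 \/ b <> 0 \/ c <> 0)%Z).
    { unfold Z3_nonzero in Hn; destruct (Z.eqb_spec a 0), (Z.eqb_spec b 0), (Z.eqb_spec c 0);
        simpl in Hn; auto; discriminate. }
    unfold B, C; rewrite !pow2_abs; fold A.
    pose proof (pow2_ge_0 A); pose proof (pow2_ge_0 (IZR b)); pose proof (pow2_ge_0 (IZR c)).
    destruct H0 as [H0 | [H0 | H0]]; apply Hz in H0; fold A in H0; lra. }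
  assert (Hs : 0 < sqrt ((B + 1) * (C + 1))) by (apply sqrt_lt_R0; nra).
  replace (hsq b * hsq c) with (/ sqrt ((B + 1) * (C + 1)))
    by (unfold hsq; rewrite <- Rinv_mult, <- sqrt_mult by (fold B C; lra); reflexivity).
  replace (L / PI * / sqrt ((B + 1) * (C + 1))) with (/ (PI / L * sqrt ((B + 1) * (C + 1))))
    by (field; lra).
  assert (HPL : 0 < PI / L) by (apply Rdiv_lt_0_compat; lra).
  apply Rinv_le_contravar; [now apply Rmult_lt_0_compat|].
  apply Rsqr_incr_0_var; [|lra].
  rewrite !Rsqr_pow2, Hk, Rpow_mult_distr, pow2_sqrt by nra.
  replace ((2 * PI / L) ^ 2 * (A ^ 2 + B ^ 2 + C ^ 2)) with
    ((PI / L) ^ 2 * (4 * (A ^ 2 + B ^ 2 + C ^ 2))) by (field; lra).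
  apply Rmult_le_compat_l; [apply pow2_ge_0|].
  pose proof (pow2_ge_0 (B - 1)); pose proof (pow2_ge_0 (C - 1)); pose proof (pow2_ge_0 (B - C)); nra.
Qed.

(** The left side is the vacuum expectation of A(x)^2. The first coordinate contributes the factor 2
    K + 1, each of the others at most 4 sqrt (K+1), the polarizations 2, and K + 1 <= 2 [radius]. *)
Lemma sum_inv_knorm L Lam : 0 < L -> 2 <= radius L Lam ->
  rsum (modes L Lam) (fun m => / (2 * L ^ 3 * knorm L m)) <= 32 / PI ^ 3 * Lam ^ 2.
Proof.
  intros HL HR; pose proof PI_RGT_0.
  set (K := cutoffK L Lam); set (rad := radius L Lam) in *.
  assert (HK : INR K + 1 <= 2 * rad).
  { unfold K, cutoffK; fold rad; destruct (archimed rad) as [H1 H2].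
    change (Lam * L / (2 * PI)) with rad.
    assert (H0 : (0 <= up rad)%Z) by (apply le_IZR; change (0 <= IZR (up rad)); lra).
    rewrite INR_IZR_INZ, Z2Nat.id by auto; lra. }
  assert (HK0 : 0 <= INR K) by apply pos_INR.
  set (F := fun m : mode => / (2 * L ^ 3) * (L / PI * (hsq (snd (fst (fst m))) * hsq (snd (fst m))))).
  assert (HL3 : 0 < L ^ 3) by now apply pow_lt.
  assert (HLP : 0 < L / PI) by (apply Rdiv_lt_0_compat; lra).
  assert (HF : forall m, 0 <= F m).
  { intros m; repeat apply Rmult_le_pos; try apply hsq_nonneg; try lra.
    apply Rlt_le, Rinv_0_lt_compat; lra. apply Rlt_le, Rinv_0_lt_compat; lra. }
  apply Rle_trans with (rsum (box_modes K) F).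
  - apply Rle_trans with (rsum (modes L Lam) F).
    + apply rsum_le; intros m Hm; destruct (modes_allowed L Lam m Hm) as [Hn _].
      pose proof (knorm_pos L Lam HL m Hm).
      rewrite Rinv_mult; apply Rmult_le_compat_l; [apply Rlt_le, Rinv_0_lt_compat; lra|].
      destruct m as [n l]; now apply inv_knorm_le.
    + apply rsum_incl_le; auto; [apply NoDup_modes|].
      intros m Hm; now apply filter_In in Hm.
  - set (S := rsum (zrange K) hsq).
    assert (HS : rsum (box_modes K) F = 2 * / (2 * L ^ 3) * (L / PI) * (INR (2 * K + 1) * S ^ 2)).
    { unfold box_modes; rewrite rsum_flat_map.
      rewrite (rsum_ext _ _ (fun _ => 2 * / (2 * L ^ 3) * (L / PI) * S ^ 2)).
      - rewrite rsum_const; unfold zrange; rewrite length_map, length_seq; ring.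
      - intros a _; rewrite rsum_flat_map.
        rewrite (rsum_ext _ _ (fun b => 2 * / (2 * L ^ 3) * (L / PI) * S * hsq b)).
        + rewrite rsum_scal; fold S; ring.
        + intros b _; rewrite rsum_flat_map.
          rewrite (rsum_ext _ _ (fun c => 2 * / (2 * L ^ 3) * (L / PI) * hsq b * hsq c)).
          * rewrite rsum_scal; fold S; ring.
          * intros c _; rewrite !rsum_cons; unfold rsum, F; simpl; ring. }
    rewrite HS.
    assert (HS2 : S ^ 2 <= 16 * (INR K + 1)).
    { replace (16 * (INR K + 1)) with ((4 * sqrt (INR K + 1)) ^ 2)
        by (rewrite Rpow_mult_distr, pow2_sqrt by lra; ring).
      apply pow_incr; split; [apply rsum_nonneg; intros; apply hsq_nonneg | apply sum_hsq]. }
    assert (HS3 : INR (2 * K + 1) * S ^ 2 <= 128 * rad ^ 2).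
    { rewrite plus_INR, mult_INR; simpl (INR 2); simpl (INR 1).
      pose proof (pow2_ge_0 S).
      apply Rle_trans with ((2 * (INR K + 1)) * (16 * (INR K + 1))); [|nra].
      apply Rmult_le_compat; nra. }
    replace (32 / PI ^ 3 * Lam ^ 2) with
      (2 * / (2 * L ^ 3) * (L / PI) * (128 * rad ^ 2)).
    + apply Rmult_le_compat_l; auto.
      apply Rmult_le_pos; [|lra]; apply Rmult_le_pos; [lra | apply Rlt_le, Rinv_0_lt_compat; lra].
    + unfold rad, radius; field; lra.
Qed.

(** * Polarization sums and reality of inner products *)

(** Orthonormal rows imply orthonormal columns. The squared determinant is the Gram determinant 1,
    so only 0 is orthogonal to u, v and w; this is applied to each basis vector minus its
    expansion. *)
Lemma orthonormal3_complete (u v w : R3) :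
  dot3 u u = 1 -> dot3 v v = 1 -> dot3 w w = 1 ->
  dot3 u v = 0 -> dot3 u w = 0 -> dot3 v w = 0 ->
  forall i j, (i < 3)%nat -> (j < 3)%nat ->
  vcomp u i * vcomp u j + vcomp v i * vcomp v j + vcomp w i * vcomp w j =
  if Nat.eqb i j then 1 else 0.
Proof.
  destruct u as [[u0 u1] u2], v as [[v0 v1] v2], w as [[w0 w1] w2]; unfold dot3; simpl vcomp.
  intros Huu Hvv Hww Huv Huw Hvw.
  set (D := u0 * (v1 * w2 - v2 * w1) - u1 * (v0 * w2 - v2 * w0) + u2 * (v0 * w1 - v1 * w0)).
  assert (HD : D * D = 1).
  { transitivity ((u0 * u0 + u1 * u1 + u2 * u2) *
      ((v0 * v0 + v1 * v1 + v2 * v2) * (w0 * w0 + w1 * w1 + w2 * w2) -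
       (v0 * w0 + v1 * w1 + v2 * w2) * (v0 * w0 + v1 * w1 + v2 * w2)) -
      (u0 * v0 + u1 * v1 + u2 * v2) *
      ((u0 * v0 + u1 * v1 + u2 * v2) * (w0 * w0 + w1 * w1 + w2 * w2) -
       (v0 * w0 + v1 * w1 + v2 * w2) * (u0 * w0 + u1 * w1 + u2 * w2)) +
      (u0 * w0 + u1 * w1 + u2 * w2) *
      ((u0 * v0 + u1 * v1 + u2 * v2) * (v0 * w0 + v1 * w1 + v2 * w2) -
       (v0 * v0 + v1 * v1 + v2 * v2) * (u0 * w0 + u1 * w1 + u2 * w2)));
    [unfold D; ring | rewrite Huu, Hvv, Hww, Huv, Huw, Hvw; ring]. }
  assert (HD0 : D <> 0) by (intros H; rewrite H in HD; lra).
  (* Cramer's rule, with the cofactors of the matrix written out. *)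
  assert (Hz : forall x y z, u0 * x + u1 * y + u2 * z = 0 -> v0 * x + v1 * y + v2 * z = 0 ->
    w0 * x + w1 * y + w2 * z = 0 -> x = 0 /\ y = 0 /\ z = 0).
  { intros x y z H1 H2 H3; repeat split; apply Rmult_eq_reg_l with D; auto; rewrite Rmult_0_r.
    - transitivity ((v1 * w2 - v2 * w1) * (u0 * x + u1 * y + u2 * z) -
        (u1 * w2 - u2 * w1) * (v0 * x + v1 * y + v2 * z) +
        (u1 * v2 - u2 * v1) * (w0 * x + w1 * y + w2 * z));
        [unfold D; ring | rewrite H1, H2, H3; ring].
    - transitivity (- (v0 * w2 - v2 * w0) * (u0 * x + u1 * y + u2 * z) +
        (u0 * w2 - u2 * w0) * (v0 * x + v1 * y + v2 * z) -
        (u0 * v2 - u2 * v0) * (w0 * x + w1 * y + w2 * z));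
        [unfold D; ring | rewrite H1, H2, H3; ring].
    - transitivity ((v0 * w1 - v1 * w0) * (u0 * x + u1 * y + u2 * z) -
        (u0 * w1 - u1 * w0) * (v0 * x + v1 * y + v2 * z) +
        (u0 * v1 - u1 * v0) * (w0 * x + w1 * y + w2 * z));
        [unfold D; ring | rewrite H1, H2, H3; ring]. }
  assert (Hres : forall p q r,
    let x := u0 * p + u1 * q + u2 * r in let y := v0 * p + v1 * q + v2 * r in
    let z := w0 * p + w1 * q + w2 * r in
    u0 * x + v0 * y + w0 * z - p = 0 /\ u1 * x + v1 * y + w1 * z - q = 0 /\
    u2 * x + v2 * y + w2 * z - r = 0).
  { intros p q r x y z; apply Hz.
    - transitivity ((u0 * u0 + u1 * u1 + u2 * u2) * x + (u0 * v0 + u1 * v1 + u2 * v2) * y +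
        (u0 * w0 + u1 * w1 + u2 * w2) * z - x);
        [unfold x, y, z; ring | rewrite Huu, Huv, Huw; ring].
    - transitivity ((u0 * v0 + u1 * v1 + u2 * v2) * x + (v0 * v0 + v1 * v1 + v2 * v2) * y +
        (v0 * w0 + v1 * w1 + v2 * w2) * z - y);
        [unfold x, y, z; ring | rewrite Hvv, Huv, Hvw; ring].
    - transitivity ((u0 * w0 + u1 * w1 + u2 * w2) * x + (v0 * w0 + v1 * w1 + v2 * w2) * y +
        (w0 * w0 + w1 * w1 + w2 * w2) * z - z);
        [unfold x, y, z; ring | rewrite Hww, Huw, Hvw; ring]. }
  destruct (Hres 1 0 0) as [A1 [A2 A3]]; destruct (Hres 0 1 0) as [B1 [B2 B3]];
    destruct (Hres 0 0 1) as [C1 [C2 C3]].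
  intros i j Hi Hj; destruct i as [|[|[|]]]; try lia; destruct j as [|[|[|]]]; try lia; simpl; lra.
Qed.

Definition negk (n : Z * Z * Z) : Z * Z * Z :=
  match n with (a, b, c) => (- a, - b, - c)%Z end.

Lemma kvec_negk L n j : vcomp (kvec L (negk n)) j = - vcomp (kvec L n) j.
Proof.
  destruct n as [[a b] c]; destruct j as [|[|j]]; simpl; rewrite opp_IZR; unfold Rdiv; ring.
Qed.
Lemma norm3_negk L n : norm3 (kvec L (negk n)) = norm3 (kvec L n).
Proof. unfold norm3; f_equal; unfold dot3; rewrite !kvec_negk; ring. Qed.
Lemma nonzero_negk n : Z3_nonzero (negk n) = Z3_nonzero n.
Proof.
  destruct n as [[a b] c]; unfold Z3_nonzero, negk.
  assert (H : forall z, (- z =? 0)%Z = (z =? 0)%Z)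
    by (intros z; destruct (Z.eqb_spec (- z) 0), (Z.eqb_spec z 0); lia).
  now rewrite !H.
Qed.

Lemma rsum_zrange_opp K f : rsum (zrange K) (fun z => f (- z)%Z) = rsum (zrange K) f.
Proof.
  rewrite <- (rsum_map Z.opp); apply rsum_perm, NoDup_Permutation.
  - apply NoDup_map_NoDup_ForallPairs; [|apply NoDup_zrange]; intros x y _ _ H; lia.
  - apply NoDup_zrange.
  - intros z; rewrite in_map_iff, in_zrange; split.
    + intros [y [<- Hy]]; apply in_zrange in Hy; lia.
    + intros H; exists (- z)%Z; rewrite in_zrange; lia.
Qed.
Lemma rsum_box_modes K F : rsum (box_modes K) F =
  rsum (zrange K) (fun a => rsum (zrange K) (fun b => rsum (zrange K) (fun c =>
    F (a, b, c, false) + F (a, b, c, true)))).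
Proof.
  unfold box_modes; rewrite rsum_flat_map; apply rsum_ext; intros a _.
  rewrite rsum_flat_map; apply rsum_ext; intros b _.
  rewrite rsum_flat_map; apply rsum_ext; intros c _.
  rewrite !rsum_cons; unfold rsum; simpl; ring.
Qed.
(** The polarization vectors at k and -k are unrelated, so oddness can be asked only of the sum over
    both polarizations. *)
Lemma rsum_box_odd K F :
  (forall n, F (negk n, false) + F (negk n, true) = - (F (n, false) + F (n, true))) ->
  rsum (box_modes K) F = 0.
Proof.
  intros H.
  enough (rsum (box_modes K) F = - rsum (box_modes K) F) by lra.
  rewrite rsum_box_modes at 1.
  rewrite <- rsum_zrange_opp; replace (- rsum (box_modes K) F) with (-1 * rsum (box_modes K) F) by ring.
  rewrite rsum_box_modes, <- rsum_scal; apply rsum_ext; intros a _.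
  rewrite <- rsum_zrange_opp, <- rsum_scal; apply rsum_ext; intros b _.
  rewrite <- rsum_zrange_opp, <- rsum_scal; apply rsum_ext; intros c _.
  pose proof (H (a, b, c)) as E; simpl negk in E; lra.
Qed.

(* Waves invariant under the complex conjugation [u(k) -> conj (u(-k))]; all their field
   operators commute. *)
Definition csym (u : Z * Z * Z -> C) : Prop := forall n, u (negk n) = Cconj (u n).
Definition swave (L : R) (eps : mode -> R3) (j : nat) (u : Z * Z * Z -> C) : wave :=
  fun m => (RtoC (acoef L eps j m) * u (fst m))%C.

(** After summation over the polarizations the weight is even in k, while the imaginary part of
    conj(u) v is odd by symmetry, so k and -k cancel. *)
Lemma wip_swave_real L Lam eps i j u v : 0 < L -> polarization L eps ->
  (i < 3)%nat -> (j < 3)%nat -> csym u -> csym v ->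
  snd (wip (modes L Lam) (swave L eps i u) (swave L eps j v)) = 0.
Proof.
  intros HL Heps Hi Hj Hu Hv.
  assert (HL3 : 0 < L ^ 3) by now apply pow_lt.
  unfold wip; rewrite csum_snd.
  transitivity (rsum (box_modes (cutoffK L Lam)) (fun m => if allowedb L Lam m then
    acoef L eps i m * acoef L eps j m * snd (Cconj (u (fst m)) * v (fst m))%C else 0)).
  { unfold modes; rewrite rsum_filter; apply rsum_ext; intros m _.
    destruct allowedb; [|reflexivity]; unfold swave; simpl; ring. }
  apply rsum_box_odd; intros n.
  assert (Hal : forall l, allowedb L Lam (n, l) = allowedb L Lam (n, false)) by reflexivity.
  assert (Hal' : forall l, allowedb L Lam (negk n, l) = allowedb L Lam (n, false)).
  { intros l; unfold allowedb; simpl fst; now rewrite norm3_negk, nonzero_negk. }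
  rewrite !Hal', (Hal true); destruct (allowedb L Lam (n, false)) eqn:E; [|ring].
  unfold allowedb in E; apply andb_prop in E as [E _]; simpl fst in *.
  (* Completeness of the two polarization vectors and k / |k| gives the transverse projection
     delta_ij - k_i k_j / |k|^2, which no longer depends on the choice of [eps]. *)
  assert (HP : forall n, Z3_nonzero n = true ->
    acoef L eps i (n, false) * acoef L eps j (n, false) +
    acoef L eps i (n, true) * acoef L eps j (n, true) =
    ((if Nat.eqb i j then 1 else 0) - vcomp (kvec L n) i * vcomp (kvec L n) j /
      norm3 (kvec L n) ^ 2) / (2 * L ^ 3 * norm3 (kvec L n))).
  { clear n E Hal Hal'; intros n Hn; pose proof (norm3_kvec_pos L n HL Hn) as Hk.
    set (k := norm3 (kvec L n)) in *.
    assert (Hkk : dot3 (kvec L n) (kvec L n) = k ^ 2) by apply norm3_kvec_sqr.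
    destruct (Heps n Hn) as [H1 H2].
    set (w := (vcomp (kvec L n) 0 / k, vcomp (kvec L n) 1 / k, vcomp (kvec L n) 2 / k) : R3).
    assert (Hd : forall e, dot3 e w = dot3 e (kvec L n) / k)
      by (intros; unfold dot3, w; simpl; field; lra).
    assert (Hw : forall j, (j < 3)%nat -> vcomp w j = vcomp (kvec L n) j / k)
      by (intros [|[|[|]]] ?; try lia; reflexivity).
    pose proof (orthonormal3_complete (eps (n, false)) (eps (n, true)) w
      (H1 false false) (H1 true true)) as HC.
    rewrite !Hd, !H2, (H1 false true) in HC.
    specialize (HC ltac:(unfold dot3 in Hkk |- *; unfold w; simpl in *;
      apply (Rmult_eq_reg_r (k * k)); [field_simplify; [lra | lra] | nra])).
    specialize (HC eq_refl ltac:(unfold Rdiv; ring) ltac:(unfold Rdiv; ring) i j Hi Hj).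
    rewrite !Hw in HC by auto; rewrite <- HC.
    unfold acoef, knorm; simpl fst; fold k.
    assert (Hsq : sqrt (2 * L ^ 3 * k) * sqrt (2 * L ^ 3 * k) = 2 * L ^ 3 * k)
      by (apply sqrt_sqrt; nra).
    assert (Hs : 0 < sqrt (2 * L ^ 3 * k)) by (apply sqrt_lt_R0; nra).
    set (s := sqrt (2 * L ^ 3 * k)) in *; rewrite <- Hsq; field; lra. }
  assert (Hpar : acoef L eps i (negk n, false) * acoef L eps j (negk n, false) +
    acoef L eps i (negk n, true) * acoef L eps j (negk n, true) =
    acoef L eps i (n, false) * acoef L eps j (n, false) +
    acoef L eps i (n, true) * acoef L eps j (n, true)).
  { rewrite !HP by (rewrite ?nonzero_negk; auto).
    rewrite norm3_negk, !kvec_negk; f_equal; f_equal; f_equal; ring. }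
  rewrite Hu, Hv, <- Cconj_mult; cbn [snd Cconj].
  rewrite <- !Rmult_plus_distr_r, Hpar.
  simpl; ring.
Qed.

(** * Taylor approximation of plane waves *)

Notation fact_R n := (INR (Factorial.fact n)).

(** The first d terms of the series of exp (-i t). *)
Definition taylor (d : nat) (t : R) : C :=
  csum (seq 0 d) (fun n => (RtoC (t ^ n / fact_R n) * (- Ci) ^ n)%C).

Lemma taylor_S d t : taylor (S d) t = (taylor d t + RtoC (t ^ d / fact_R d) * (- Ci) ^ d)%C.
Proof. unfold taylor; rewrite seq_S, csum_app; unfold csum at 2; simpl; ring. Qed.

Lemma pow_fact_derive d t :
  is_derive (fun t => t ^ S d / fact_R (S d)) t (t ^ d / fact_R d).
Proof.
  pose proof (INR_fact_lt_0 d).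
  assert (EF : fact_R (S d) = INR (S d) * fact_R d) by (rewrite fact_simpl, mult_INR; reflexivity).
  assert (0 < INR (S d)) by (apply lt_0_INR; lia).
  replace (t ^ d / fact_R d) with (/ fact_R (S d) * (INR (S d) * 1 * t ^ pred (S d)))
    by (rewrite EF; simpl pred; field; lra).
  apply is_derive_ext with (fun t => / fact_R (S d) * t ^ S d);
    [intros; unfold Rdiv; apply Rmult_comm|].
  apply (is_derive_scal (fun t => t ^ S d)), (is_derive_pow (fun t => t)), (@is_derive_id R_AbsRing).
Qed.

Lemma is_derive_Rmult_r (f : R -> R) t l a :
  is_derive f t l -> is_derive (fun t => f t * a) t (l * a).
Proof. exact (@is_derive_scal_l R_AbsRing R_NormedModule f t l a). Qed.

Lemma taylor_derive d t :
  is_derive (fun t => fst (taylor (S d) t)) t (fst (- Ci * taylor d t)%C) /\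
  is_derive (fun t => snd (taylor (S d) t)) t (snd (- Ci * taylor d t)%C).
Proof.
  induction d.
  - unfold taylor, csum; simpl; split; auto_derive; auto; ring.
  - destruct IHd as [H1 H2].
    pose proof (pow_fact_derive d t) as Hp.
    set (z := ((- Ci) ^ S d)%C).
    assert (E : (- Ci * taylor (S d) t = - Ci * taylor d t + RtoC (t ^ d / fact_R d) * z)%C)
      by (rewrite taylor_S; unfold z; simpl; ring).
    rewrite E; split.
    + apply is_derive_ext with (fun t => fst (taylor (S d) t) + t ^ S d / fact_R (S d) * fst z).
      * intros s; rewrite (taylor_S (S d)); fold z; simpl; ring.
      * replace (fst (- Ci * taylor d t + RtoC (t ^ d / fact_R d) * z)%C) with
          (fst (- Ci * taylor d t)%C + t ^ d / fact_R d * fst z) by (simpl; ring).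
        apply (is_derive_plus (fun t => fst (taylor (S d) t))); auto.
        apply (is_derive_Rmult_r (fun t => t ^ S d / fact_R (S d))); auto.
    + apply is_derive_ext with (fun t => snd (taylor (S d) t) + t ^ S d / fact_R (S d) * snd z).
      * intros s; rewrite (taylor_S (S d)); fold z; simpl; ring.
      * replace (snd (- Ci * taylor d t + RtoC (t ^ d / fact_R d) * z)%C) with
          (snd (- Ci * taylor d t)%C + t ^ d / fact_R d * snd z) by (simpl; ring).
        apply (is_derive_plus (fun t => snd (taylor (S d) t))); auto.
        apply (is_derive_Rmult_r (fun t => t ^ S d / fact_R (S d))); auto.
Qed.

(** Both t^(d+1) / (d+1)! + f and t^(d+1) / (d+1)! - f vanish at 0 and have nonnegative derivatives
    for t >= 0. *)
Lemma iterated_bound d (f f' : R -> R) : f 0 = 0 -> (forall t, is_derive f t (f' t)) ->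
  (forall t, 0 <= t -> Rabs (f' t) <= t ^ d / fact_R d) ->
  forall t, 0 <= t -> Rabs (f t) <= t ^ S d / fact_R (S d).
Proof.
  intros H0 Hd Hb t Ht.
  pose proof (pow_fact_derive d) as Hp.
  assert (H : forall g g' : R -> R, g 0 = 0 -> (forall t, is_derive g t (g' t)) ->
    (forall t, 0 <= t -> 0 <= g' t) -> 0 <= g t).
  { intros g g' Hg0 Hg Hg'.
    destruct (MVT_gen g 0 t g') as [c [Hc E]]; [auto | |].
    - intros x _; apply continuity_pt_filterlim, (ex_derive_continuous g); eexists; apply Hg.
    - rewrite Rmin_left, Rmax_right in Hc by auto.
      rewrite Hg0, !Rminus_0_r in E; rewrite E; apply Rmult_le_pos; auto; apply Hg'; lra. }
  assert (E0 : 0 ^ S d / fact_R (S d) = 0) by (simpl; unfold Rdiv; ring).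
  apply Rabs_le; split.
  - enough (0 <= t ^ S d / fact_R (S d) + f t) by lra.
    apply (H (fun t => t ^ S d / fact_R (S d) + f t) (fun t => t ^ d / fact_R d + f' t)).
    + rewrite E0, H0; ring.
    + intros s; apply (is_derive_plus (fun t => t ^ S d / fact_R (S d)) f); auto.
    + intros s Hs; pose proof (Hb s Hs) as Hbs; apply Rabs_le_between in Hbs; lra.
  - enough (0 <= t ^ S d / fact_R (S d) - f t) by lra.
    apply (H (fun t => t ^ S d / fact_R (S d) - f t) (fun t => t ^ d / fact_R d - f' t)).
    + rewrite E0, H0; ring.
    + intros s; apply (is_derive_minus (fun t => t ^ S d / fact_R (S d)) f); auto.
    + intros s Hs; pose proof (Hb s Hs) as Hbs; apply Rabs_le_between in Hbs; lra.
Qed.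

Definition remainder (d : nat) (t : R) : C := (expi (- t) - taylor d t)%C.

(** In complex form R_(d+1)' = -i R_d. Starting from |cos|, |sin| <= 1 at d = 0, the bound on the
    remainder is obtained by integrating d times. *)
Lemma remainder_derive d t :
  is_derive (fun t => fst (remainder (S d) t)) t (snd (remainder d t)) /\
  is_derive (fun t => snd (remainder (S d) t)) t (- fst (remainder d t)).
Proof.
  destruct (taylor_derive d t) as [H1 H2]; split.
  - apply is_derive_ext with (fun t => minus (cos (- t)) (fst (taylor (S d) t)));
      [intros; unfold minus, plus, opp; simpl; ring|].
    replace (snd (remainder d t)) with (minus (sin (- t)) (fst (- Ci * taylor d t)%C))
      by (unfold minus, plus, opp; simpl; ring).
    apply (is_derive_minus (fun t => cos (- t))); auto.
    auto_derive; auto; ring.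
  - apply is_derive_ext with (fun t => minus (sin (- t)) (snd (taylor (S d) t)));
      [intros; unfold minus, plus, opp; simpl; ring|].
    replace (- fst (remainder d t)) with (minus (- cos (- t)) (snd (- Ci * taylor d t)%C))
      by (unfold minus, plus, opp; simpl; ring).
    apply (is_derive_minus (fun t => sin (- t))); auto.
    auto_derive; auto; ring.
Qed.

Lemma taylor_0 d : taylor (S d) 0 = 1%C.
Proof.
  induction d; [unfold taylor, csum; simpl; apply C_eq; simpl; field|].
  rewrite taylor_S, IHd; replace (0 ^ S d / fact_R (S d)) with 0 by (simpl; unfold Rdiv; ring); ring.
Qed.

Lemma remainder_bound_pos d : forall t, 0 <= t ->
  Rabs (fst (remainder d t)) <= t ^ d / fact_R d /\ Rabs (snd (remainder d t)) <= t ^ d / fact_R d.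
Proof.
  induction d; intros t Ht.
  - unfold remainder, taylor, csum; simpl; pose proof (COS_bound (- t)); pose proof (SIN_bound (- t)).
    split; apply Rabs_le; lra.
  - assert (H0 : remainder (S d) 0 = 0%C).
    { unfold remainder; rewrite taylor_0, Ropp_0; unfold expi; rewrite cos_0, sin_0.
      apply C_eq; simpl; ring. }
    split.
    + apply (iterated_bound d (fun t => fst (remainder (S d) t)) (fun t => snd (remainder d t))); auto; [now rewrite H0 | |].
      * intros s; apply remainder_derive.
      * intros s Hs; now apply IHd.
    + apply (iterated_bound d (fun t => snd (remainder (S d) t)) (fun t => - fst (remainder d t))); auto; [now rewrite H0 | |].
      * intros s; apply remainder_derive.
      * intros s Hs; rewrite Rabs_Ropp; now apply IHd.
Qed.

Lemma Cconj_pow z n : Cconj (z ^ n) = (Cconj z ^ n)%C.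
Proof.
  induction n; [apply C_eq; simpl; ring|].
  simpl Cpow; now rewrite Cconj_mult, IHn.
Qed.
Lemma Cpow_opp_real (t : R) n : (RtoC ((- t) ^ n) * (- Ci) ^ n)%C = Cconj (RtoC (t ^ n) * (- Ci) ^ n)%C.
Proof.
  rewrite Cconj_mult, Cconj_R, Cconj_pow, !RtoC_pow, <- !Cpow_mult_l.
  f_equal; apply C_eq; simpl; ring.
Qed.
Lemma taylor_opp d t : taylor d (- t) = Cconj (taylor d t).
Proof.
  unfold taylor; rewrite <- csum_conj; apply csum_ext; intros n _.
  unfold Rdiv; rewrite !RtoC_mult.
  replace (RtoC ((- t) ^ n) * RtoC (/ fact_R n) * (- Ci) ^ n)%C with
    (RtoC (/ fact_R n) * (RtoC ((- t) ^ n) * (- Ci) ^ n))%C by ring.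
  replace (RtoC (t ^ n) * RtoC (/ fact_R n) * (- Ci) ^ n)%C with
    (RtoC (/ fact_R n) * (RtoC (t ^ n) * (- Ci) ^ n))%C by ring.
  rewrite (Cconj_mult (RtoC (/ fact_R n))), Cconj_R, Cpow_opp_real; reflexivity.
Qed.

Lemma remainder_bound d t : Cmod (remainder d t) <= 2 * (Rabs t ^ d / fact_R d).
Proof.
  assert (H : forall t, 0 <= t -> Cmod (remainder d t) <= 2 * (t ^ d / fact_R d)).
  { clear t; intros t Ht; destruct (remainder_bound_pos d t Ht) as [H1 H2].
    set (z := remainder d t) in *.
    assert (E : z = (RtoC (fst z) + Ci * RtoC (snd z))%C) by (apply C_eq; simpl; ring).
    rewrite E; eapply Rle_trans; [apply Cmod_triangle|].
    rewrite Cmod_mult, Cmod_Ci, !Cmod_R; lra. }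
  destruct (Rle_lt_dec 0 t) as [Ht | Ht]; [rewrite Rabs_right by lra; auto|].
  rewrite Rabs_left by lra; rewrite <- Cmod_conj.
  replace (Cconj (remainder d t)) with (remainder d (- t)); [apply H; lra|].
  unfold remainder; rewrite taylor_opp, <- Cconj_expi; apply C_eq; simpl; ring.
Qed.

(** From d^d / d! <= exp d <= 3^d, and r <= d / 6 leaves (3 / 6)^d. This is the origin of the factor
    6 between the degree and l Lam. *)
Lemma pow_fact_le d r : 0 <= r -> 6 * r <= INR d -> r ^ d / fact_R d <= (/ 2) ^ d.
Proof.
  intros Hr Hd; pose proof (INR_fact_lt_0 d).
  assert (He : INR d ^ d / fact_R d <= 3 ^ d).
  { apply Rle_trans with (exp (INR d)).
    - eapply Rle_trans; [|apply (exp_ge_taylor (INR d) d), pos_INR].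
      destruct d; [simpl; lra|]; rewrite tech5.
      assert (0 <= sum_f_R0 (fun k => INR (S d) ^ k / fact_R k) d); [|lra].
      apply cond_pos_sum; intros k; apply Rmult_le_pos;
        [apply pow_le, pos_INR | apply Rlt_le, Rinv_0_lt_compat, INR_fact_lt_0].
    - replace (exp (INR d)) with (exp 1 ^ d).
      + apply pow_incr; split; [apply Rlt_le, exp_pos | apply exp_le_3].
      + rewrite <- Rpower_pow by apply exp_pos; unfold Rpower; rewrite ln_exp; f_equal; ring. }
  apply Rle_trans with ((/ 6) ^ d * (INR d ^ d / fact_R d)).
  - unfold Rdiv; rewrite <- Rmult_assoc, <- Rpow_mult_distr.
    apply Rmult_le_compat_r; [apply Rlt_le, Rinv_0_lt_compat; auto|].
    apply pow_incr; lra.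
  - replace ((/ 2) ^ d) with ((/ 6) ^ d * 3 ^ d)
      by (rewrite <- Rpow_mult_distr; f_equal; field).
    apply Rmult_le_compat_l; [apply pow_le; lra | auto].
Qed.

Definition plane_taylor (d : nat) (k x : R3) : C :=
  (taylor d (vcomp k 0 * vcomp x 0) * taylor d (vcomp k 1 * vcomp x 1) *
   taylor d (vcomp k 2 * vcomp x 2))%C.

Lemma expi_plus s t : expi (s + t) = (expi s * expi t)%C.
Proof. unfold expi; apply C_eq; simpl; [apply cos_plus | rewrite sin_plus; ring]. Qed.

(** The three factors are replaced one at a time. Each remainder is at most del = 2 * 2^(-d) <= 1
    and each polynomial at most 1 + del <= 2, so the errors add up to del + 2 del + 4 del = 14 *
    2^(-d). *)
Lemma plane_taylor_error d r k x : 0 <= r -> 6 * r <= INR d -> (1 <= d)%nat ->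
  (forall i, (i < 3)%nat -> Rabs (vcomp k i * vcomp x i) <= r) ->
  Cmod (expi (- dot3 k x) - plane_taylor d k x) <= 14 * (/ 2) ^ d.
Proof.
  intros Hr Hd Hd1 Hi; set (del := 2 * (/ 2) ^ d).
  assert (Hdel1 : del <= 1).
  { unfold del; destruct d; [lia|]; simpl.
    assert ((/ 2) ^ d <= 1) by (rewrite <- (pow1 d); apply pow_incr; lra); lra. }
  assert (Hdel0 : 0 <= del) by (unfold del; assert (0 < (/ 2) ^ d) by (apply pow_lt; lra); lra).
  assert (Hrem : forall i, (i < 3)%nat -> Cmod (remainder d (vcomp k i * vcomp x i)) <= del).
  { intros i Hi3; eapply Rle_trans; [apply remainder_bound|]; unfold del.
    apply Rmult_le_compat_l; [lra|]; eapply Rle_trans; [|apply (pow_fact_le d r); auto].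
    apply Rmult_le_compat_r; [apply Rlt_le, Rinv_0_lt_compat, INR_fact_lt_0|].
    apply pow_incr; split; [apply Rabs_pos | auto]. }
  unfold plane_taylor, dot3.
  replace (- (vcomp k 0 * vcomp x 0 + vcomp k 1 * vcomp x 1 + vcomp k 2 * vcomp x 2)) with
    (- (vcomp k 0 * vcomp x 0) + - (vcomp k 1 * vcomp x 1) + - (vcomp k 2 * vcomp x 2)) by ring.
  rewrite !expi_plus.
  pose proof (Hrem 0%nat ltac:(lia)) as R0; pose proof (Hrem 1%nat ltac:(lia)) as R1;
    pose proof (Hrem 2%nat ltac:(lia)) as R2; clear Hrem Hi.
  set (t0 := vcomp k 0 * vcomp x 0) in *; set (t1 := vcomp k 1 * vcomp x 1) in *;
    set (t2 := vcomp k 2 * vcomp x 2) in *.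
  pose proof (Cmod_expi (- t0)) as E0; pose proof (Cmod_expi (- t1)) as E1.
  assert (HT : forall t, Cmod (remainder d t) <= del -> Cmod (taylor d t) <= 1 + del).
  { intros t Ht; replace (taylor d t) with (expi (- t) + - remainder d t)%C
      by (unfold remainder; ring).
    eapply Rle_trans; [apply Cmod_triangle|]; rewrite Cmod_opp, Cmod_expi; lra. }
  apply HT in R1 as T1; apply HT in R2 as T2.
  pose proof (Cmod_ge_0 (remainder d t0)); pose proof (Cmod_ge_0 (remainder d t1)).
  pose proof (Cmod_ge_0 (taylor d t1)); pose proof (Cmod_ge_0 (taylor d t2)).
  replace (_ - _)%C with (expi (- t0) * expi (- t1) * remainder d t2 +
    (expi (- t0) * remainder d t1 * taylor d t2 + remainder d t0 * taylor d t1 * taylor d t2))%C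
    by (unfold remainder; ring).
  eapply Rle_trans; [apply Cmod_triangle|].
  eapply Rle_trans; [apply Rplus_le_compat_l, Cmod_triangle|].
  rewrite !Cmod_mult, E0, E1, !Rmult_1_l.
  assert (Cmod (remainder d t1) * Cmod (taylor d t2) <= del * 2)
    by (apply Rmult_le_compat; lra).
  assert (Cmod (remainder d t0) * Cmod (taylor d t1) * Cmod (taylor d t2) <= del * 2 * 2).
  { apply Rmult_le_compat; try lra; [apply Rmult_le_pos; auto|].
    apply Rmult_le_compat; lra. }
  unfold del in *; lra.
Qed.

(** The part of a Taylor term that depends on k. Keeping the powers of -i here makes it symmetric in
    the sense of [csym] and leaves the real coefficient [taylor_coef] to x, as a real span
    demands. *)
Definition monomial (L : R) (b : nat * nat * nat) (n : Z * Z * Z) : C :=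
  match b with (b0, b1, b2) =>
    ((RtoC (vcomp (kvec L n) 0 ^ b0) * (- Ci) ^ b0) *
     (RtoC (vcomp (kvec L n) 1 ^ b1) * (- Ci) ^ b1) *
     (RtoC (vcomp (kvec L n) 2 ^ b2) * (- Ci) ^ b2))%C
  end.

Lemma csym_monomial L b : csym (monomial L b).
Proof.
  intros n; destruct b as [[b0 b1] b2]; unfold monomial.
  rewrite !kvec_negk, !Cpow_opp_real, !Cconj_mult; reflexivity.
Qed.
Lemma csym_plane L x : csym (fun n => expi (- dot3 (kvec L n) x)).
Proof.
  intros n; rewrite Cconj_expi; f_equal; unfold dot3; rewrite !kvec_negk; ring.
Qed.

Definition exponents (d : nat) : list (nat * nat * nat) :=
  list_prod (list_prod (seq 0 d) (seq 0 d)) (seq 0 d).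
Definition taylor_coef (x : R3) (b : nat * nat * nat) : R :=
  match b with (b0, b1, b2) =>
    vcomp x 0 ^ b0 / fact_R b0 * (vcomp x 1 ^ b1 / fact_R b1) * (vcomp x 2 ^ b2 / fact_R b2)
  end.

Lemma csum_prod {S T : Type} (l : list S) (l' : list T) f g :
  csum (list_prod l l') (fun p => (f (fst p) * g (snd p))%C) = (csum l f * csum l' g)%C.
Proof.
  induction l; [unfold csum; simpl; ring|].
  simpl list_prod; rewrite csum_app, IHl, csum_map, csum_cons; simpl.
  rewrite csum_scal; ring.
Qed.

Lemma plane_taylor_monomials L d n x : plane_taylor d (kvec L n) x =
  csum (exponents d) (fun b => (RtoC (taylor_coef x b) * monomial L b n)%C).
Proof.
  unfold plane_taylor, exponents, taylor; rewrite <- !csum_prod.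
  apply csum_ext; intros [[b0 b1] b2] _; simpl fst; simpl snd; unfold taylor_coef, monomial.
  unfold Rdiv; rewrite !Rpow_mult_distr, !RtoC_mult; ring.
Qed.

(* Near the origin [A(x)] is approximated by its Taylor polynomial, hence by field
   operators of only [3 d^3] waves. *)
Lemma local_waves L Lam eps l d : 0 < L -> 0 < Lam -> polarization L eps ->
  0 < l -> 6 * (l * Lam) <= INR d -> (1 <= d)%nat ->
  exists es, orthonormal (modes L Lam) es /\ INR (length es) <= 3 * INR d ^ 3 /\
    (forall j x, (j < 3)%nat -> forall e, In e es ->
      snd (wip (modes L Lam) e (awave L eps j x)) = 0) /\
    forall j x, (j < 3)%nat -> (forall i, (i < 3)%nat -> Rabs (vcomp x i) <= l) ->
      exists w, rspan (modes L Lam) es w /\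
        wnsq (modes L Lam) (wadd (awave L eps j x) (wscal (RtoC (-1)) w)) <=
        196 * (/ 4) ^ d * wnsq (modes L Lam) (awave L eps j x).
Proof.
  intros HL HLam Heps Hl Hd Hd1; set (ms := modes L Lam).
  set (vs := map (fun p => swave L eps (fst p) (monomial L (snd p))) (list_prod (seq 0 3) (exponents d))).
  assert (Hvs : forall v, In v vs -> exists j b, (j < 3)%nat /\ v = swave L eps j (monomial L b)).
  { intros v Hv; apply in_map_iff in Hv as [[j b] [<- Hp]]; apply in_prod_iff in Hp as [Hj _].
    apply in_seq in Hj; exists j, b; split; [lia | reflexivity]. }
  destruct (real_gram_schmidt ms vs) as [es [HO [Hlen [Hsp Hre]]]].
  { intros v v' Hv Hv'; destruct (Hvs v Hv) as [j [b [Hj ->]]], (Hvs v' Hv') as [j' [b' [Hj' ->]]].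
    apply wip_swave_real; auto using csym_monomial. }
  exists es; split; [auto|]; split; [|split].
  - apply le_INR in Hlen; eapply Rle_trans; [apply Hlen|].
    unfold vs, exponents; rewrite length_map, !length_prod, !length_seq, !mult_INR; simpl (INR 3).
    right; ring.
  - intros j x Hj; apply Hre; intros v Hv; destruct (Hvs v Hv) as [j' [b [Hj' ->]]].
    apply (wip_swave_real L Lam eps j' j (monomial L b) (fun n => expi (- dot3 (kvec L n) x)));
      auto using csym_monomial, csym_plane.
  - intros j x Hj Hx.
    exists (fun m => csum (exponents d)
      (fun b => (RtoC (taylor_coef x b) * swave L eps j (monomial L b) m)%C)); split.
    + apply rspan_csum; intros b Hb; apply Hsp, in_map_iff.
      exists (j, b); split; [reflexivity|]; apply in_prod; auto; apply in_seq; lia.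
    + unfold wnsq; rewrite <- rsum_scal; apply rsum_le; intros m Hm.
      replace (wadd _ _ m) with (RtoC (acoef L eps j m) *
        (expi (- dot3 (kvec L (fst m)) x) - plane_taylor d (kvec L (fst m)) x))%C.
      2: { unfold wadd, wscal, awave; rewrite plane_taylor_monomials.
           rewrite (csum_ext _ (fun b => (RtoC (taylor_coef x b) * swave L eps j (monomial L b) m)%C)
             (fun b => (RtoC (acoef L eps j m) *
             (RtoC (taylor_coef x b) * monomial L b (fst m)))%C))
             by (intros; unfold swave; ring).
           rewrite csum_scal; apply C_eq; simpl; ring. }
      unfold awave; rewrite !Cmod_mult, Cmod_expi, Rmult_1_r, Rpow_mult_distr, Rmult_comm.
      apply Rmult_le_compat_r; [apply pow2_ge_0|].
      replace (196 * (/ 4) ^ d) with ((14 * (/ 2) ^ d) ^ 2).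
      2: { rewrite Rpow_mult_distr, <- pow_mult, Nat.mul_comm, pow_mult.
           replace ((/ 2) ^ 2) with (/ 4) by field; ring. }
      apply pow_incr; split; [apply Cmod_ge_0|].
      apply (plane_taylor_error d (l * Lam)); auto; [nra|].
      intros i Hi; rewrite Rabs_mult, Rmult_comm.
      apply Rmult_le_compat; auto using Rabs_pos.
      apply modes_allowed in Hm as [_ Hk]; unfold knorm in Hk.
      apply Rle_trans with (norm3 (kvec L (fst m))); [|lra].
      rewrite <- sqrt_Rsqr_abs; apply sqrt_le_1_alt; unfold Rsqr, dot3.
      destruct i as [|[|[|]]]; [| | |lia]; nra.
Qed.

(** * The trial state and its energy *)

(** The condition in [trial] that photons occupy modes below the cutoff only, stated for a Fock
    vector. *)
Definition lives_on (ms : list mode) (u : vec) : Prop :=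
  forall c, u c <> 0%C -> forall m, c m <> 0%nat -> In m ms.

Lemma lives_on_vadd ms u v : lives_on ms u -> lives_on ms v -> lives_on ms (vadd u v).
Proof.
  intros Hu Hv c Hc; destruct (excluded_middle_informative (u c = 0%C)) as [H | H];
    [apply Hv | now apply Hu].
  intros H'; apply Hc; unfold vadd; rewrite H, H'; ring.
Qed.
Lemma lives_on_vscal ms a u : lives_on ms u -> lives_on ms (vscal a u).
Proof. intros Hu c Hc; apply Hu; intros H; apply Hc; unfold vscal; rewrite H; ring. Qed.
Lemma lives_on_vzero ms : lives_on ms vzero.
Proof. intros c Hc; now destruct Hc. Qed.
Lemma lives_on_cF ms f u : lives_on ms u -> lives_on ms (cF ms f u).
Proof.
  intros Hu c Hc m Hm.
  destruct (excluded_middle_informative (In m ms)) as [|Hn]; auto.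
  destruct Hc; unfold cF; apply csum_zero; intros m' Hm'.
  destruct (excluded_middle_informative (u (cdecr c m') = 0%C)) as [H | H];
    [unfold cr; rewrite H; ring|].
  destruct Hn; destruct (mode_eqb_spec m' m) as [<- | Hne]; auto.
  apply (Hu _ H); now rewrite cdecr_other.
Qed.
Lemma lives_on_squeezed ms g M es : lives_on ms (squeezed ms g M es).
Proof.
  induction es as [|e es IH].
  - intros c Hc m Hm; unfold squeezed, vac in Hc; destruct excluded_middle_informative as [-> | _];
      [easy | now destruct Hc].
  - cbn [squeezed]; generalize (S M); intros N.
    assert (He : forall n, lives_on ms (excite ms e n (squeezed ms g M es)))
      by (induction n; cbn [excite]; auto using lives_on_vscal, lives_on_cF).
    induction N; cbn [superpose]; auto using lives_on_vzero, lives_on_vadd, lives_on_vscal.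
Qed.

(** At most 3 d^3 squeezed directions hold at most 4 k photons each. In the cube |x_i| <= l the wave
    of A(x) contributes its norm reduced by 170 / k, plus the Taylor error, with 196 = 14^2; the
    common factor is the vacuum expectation of A^2. *)
Lemma squeezed_state L Lam eps l d k : 0 < L -> 0 < Lam -> polarization L eps ->
  0 < l -> 6 * (l * Lam) <= INR d -> (1 <= d)%nat -> (1 <= k)%nat ->
  exists u : vec, finsupp u /\ lives_on (modes L Lam) u /\ 0 < Nsq u /\
    rsum (modes L Lam) (fun m => Nsq (an m u)) <= 12 * INR d ^ 3 * INR k * Nsq u /\
    forall x, (forall i, (i < 3)%nat -> Rabs (vcomp x i) <= l) ->
      rsum (seq 0 3) (fun j => Nsq (field (modes L Lam) (awave L eps j x) u)) <=
      (170 / INR k + 196 * (/ 4) ^ d) *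
        rsum (modes L Lam) (fun m => / (2 * L ^ 3 * knorm L m)) * Nsq u.
Proof.
  intros HL HLam Heps Hl Hd Hd1 Hk.
  destruct (local_waves L Lam eps l d) as [es [HO [Hlen [Hre Happ]]]]; auto.
  destruct (squeeze_profile k Hk) as [g [M [Hg1 [Hg2 [Hnu [Hsq Hmu]]]]]].
  set (ms := modes L Lam) in *.
  pose proof (NoDup_modes L Lam) as Hms; fold ms in Hms.
  exists (squeezed ms g M es).
  pose proof (Nsq_nonneg _ (finsupp_squeezed ms g M es)) as HN.
  assert (Hk0 : 0 < INR k) by (apply lt_0_INR; lia).
  split; [apply finsupp_squeezed|]; split; [apply lives_on_squeezed|]; split; [|split].
  - rewrite Nsq_squeezed by auto; now apply pow_lt.
  - rewrite number_squeezed by auto.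
    apply Rmult_le_compat_r; auto.
    replace (12 * INR d ^ 3 * INR k) with (3 * INR d ^ 3 * (4 * INR k)) by ring.
    apply Rmult_le_compat; auto using pos_INR; [|now apply Rle_div_l].
    apply Rle_div_r; auto; rewrite Rmult_0_l; apply rsum_nonneg; intros; apply pow2_ge_0.
  - intros x Hx.
    assert (HW : rsum (seq 0 3) (fun j => wnsq ms (awave L eps j x)) =
      rsum ms (fun m => / (2 * L ^ 3 * knorm L m))).
    { unfold wnsq; rewrite rsum_exchange; apply rsum_ext; intros m Hm.
      pose proof (knorm_pos L Lam HL m Hm).
      assert (0 < L ^ 3) by now apply pow_lt.
      rewrite (rsum_ext _ _ (fun j => / (2 * L ^ 3 * knorm L m) * vcomp (eps m) j ^ 2)).
      - rewrite rsum_scal, (eps_unit L Lam eps Heps m Hm); ring.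
      - intros j _; unfold awave; rewrite Cmod_mult, Cmod_expi, Cmod_R, Rmult_1_r, pow2_abs.
        unfold acoef, Rdiv; rewrite Rpow_mult_distr, pow_inv, pow2_sqrt by nra; ring. }
    rewrite <- HW, <- rsum_scal, Rmult_comm, <- rsum_scal.
    apply rsum_le; intros j Hj; apply in_seq in Hj.
    destruct (Happ j x) as [w [Hw Herr]]; [lia | auto |].
    eapply Rle_trans; [apply (Nsq_field_squeezed ms Hms g M Hg1 Hg2 (170 / INR k) es _ w); auto|].
    + intros e He; apply Hre; auto; lia.
    + apply Rmult_le_compat_l; [auto | lra].
Qed.

Lemma Ck_scal z : forall k f, Ck k f -> Ck k (fun x => (z * f x)%C).
Proof.
  assert (Hc : forall f : R3 -> C, (forall x, continuous f x) -> forall x,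
    continuous (fun x => (z * f x)%C) x).
  { intros f Hf x.
    assert (H1 : forall x, continuous (fun x => fst (f x)) x)
      by (intros y; apply (continuous_comp f fst); [apply Hf | apply continuous_fst]).
    assert (H2 : forall x, continuous (fun x => snd (f x)) x)
      by (intros y; apply (continuous_comp f snd); [apply Hf | apply continuous_snd]).
    destruct (contC_mult (fun _ => z) f (contC_const z) (conj H1 H2)) as [H3 H4].
    apply (continuous_ext (fun x => (fst (z * f x)%C, snd (z * f x)%C)));
      [intros; now rewrite <- surjective_pairing|].
    apply continuous_pair; [apply H3 | apply H4]. }
  assert (Hd : forall (f : R3 -> C) j x,
    ex_derive (fun t => fst (f (Defs.shift x j t))) 0 ->
    ex_derive (fun t => snd (f (Defs.shift x j t))) 0 ->
    is_derive (fun t => fst (z * f (Defs.shift x j t))%C) 0 (fst (z * pd j f x)%C) /\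
    is_derive (fun t => snd (z * f (Defs.shift x j t))%C) 0 (snd (z * pd j f x)%C)).
  { intros f j x H1 H2; apply Derive_correct in H1, H2; unfold pd; simpl; split.
    - apply (is_derive_minus (fun t => fst z * fst (f (Defs.shift x j t)))
        (fun t => snd z * snd (f (Defs.shift x j t)))); now apply is_derive_scal.
    - apply (is_derive_plus (fun t => fst z * snd (f (Defs.shift x j t)))
        (fun t => snd z * fst (f (Defs.shift x j t)))); now apply is_derive_scal. }
  induction k; intros f Hf; [exact (Hc f Hf)|].
  destruct Hf as [Hf [Hf' Hpd]]; split; [exact (Hc f Hf)|]; split.
  - intros j x Hj; destruct (Hf' j x Hj) as [H1 H2], (Hd f j x H1 H2); split; eexists; eassumption.
  - intros j Hj.
    assert (E : pd j (fun x => (z * f x)%C) = (fun x => (z * pd j f x)%C)).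
    { apply functional_extensionality; intros x; destruct (Hf' j x Hj) as [H1 H2],
        (Hd f j x H1 H2) as [H3 H4].
      apply is_derive_unique in H3, H4; apply C_eq; [exact H3 | exact H4]. }
    rewrite E; auto.
Qed.

Section TrialState.
Variables (alpha L Lam l kappa theta E : R) (eps : mode -> R3) (f : R -> R) (u : vec).
Hypothesis Halpha : 0 < alpha.
Hypothesis HL : 0 < L.
Hypothesis Hl : 0 < l.
Hypothesis Heps : polarization L eps.
Hypothesis Hf : smooth1 f.
Hypothesis Hf0 : forall x, l < Rabs x -> f x = 0 /\ Derive f x = 0.
Notation A := (RIntM l (fun x => f x ^ 2)).
Hypothesis HA : 0 < A.
Hypothesis HB : RIntM l (fun x => Derive f x ^ 2) <= kappa / l ^ 2 * A.
Hypothesis Hu : finsupp u.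
Hypothesis Hum : lives_on (modes L Lam) u.
Hypothesis Hupos : 0 < Nsq u.
Hypothesis HE : rsum (modes L Lam) (fun m => knorm L m * Nsq (an m u)) <= E * Nsq u.
Hypothesis Htheta : forall x, (forall i, (i < 3)%nat -> Rabs (vcomp x i) <= l) ->
  rsum (seq 0 3) (fun j => Nsq (field (modes L Lam) (awave L eps j x) u)) <= theta * Nsq u.

Notation ms := (modes L Lam).
Let phi := product3 f f f.
Let Psi : state := fun c x => (u c * phi x)%C.
Let rphi (x : R3) : R := f (vcomp x 0) * f (vcomp x 1) * f (vcomp x 2).
Let rdphi (j : nat) (x : R3) : R := fst (pd j phi x).

Lemma phi_support x i : (i < 3)%nat -> l < Rabs (vcomp x i) -> rphi x = 0.
Proof.
  intros Hi Hx; destruct (Hf0 _ Hx) as [H0 _]; unfold rphi.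
  destruct i as [|[|[|]]]; [| | |lia]; rewrite H0; ring.
Qed.
Lemma pd_phi j x : (j < 3)%nat -> pd j phi x = RtoC (rdphi j x).
Proof.
  intros Hj; unfold rdphi, phi.
  destruct (pd_product3 f f f Hf Hf Hf) as [H0 [H1 H2]].
  destruct j as [|[|[|]]]; [rewrite H0 | rewrite H1 | rewrite H2 | lia]; reflexivity.
Qed.

Lemma trial_Psi : trial L Lam Psi.
Proof.
  assert (Hne : forall c x, Psi c x <> 0%C -> u c <> 0%C).
  { intros c x H H0; apply H; unfold Psi; rewrite H0; ring. }
  split; [|split].
  - destruct Hu as [S HS]; exists S; intros c [x Hx]; apply HS; eauto.
  - intros c [x Hx] m Hm; apply Hne in Hx; specialize (Hum c Hx m Hm).
    now apply filter_In in Hum.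
  - intros c; split.
    + intros k; apply Ck_scal, smooth_product3; auto.
    + exists l; intros x Hx; unfold Psi, phi, product3.
      assert (E0 : rphi x = 0) by (destruct Hx as [H | [H | H]]; eapply phi_support; try exact H; lia).
      fold (rphi x); rewrite E0; ring.
Qed.

Lemma pd_Psi j c x : (j < 3)%nat -> pd j (Psi c) x = (u c * RtoC (rdphi j x))%C.
Proof.
  intros Hj; rewrite <- pd_phi by auto.
  destruct (smooth_product3 f f f Hf Hf Hf 1%nat) as [_ [Hd _]].
  destruct (Hd j x Hj) as [H1 H2]; apply Derive_correct in H1, H2.
  unfold pd, Psi; apply C_eq; simpl; apply is_derive_unique.
  - apply (is_derive_minus (fun t => fst (u c) * fst (phi (Defs.shift x j t)))
      (fun t => snd (u c) * snd (phi (Defs.shift x j t)))); now apply is_derive_scal.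
  - apply (is_derive_plus (fun t => fst (u c) * snd (phi (Defs.shift x j t)))
      (fun t => snd (u c) * fst (phi (Defs.shift x j t)))); now apply is_derive_scal.
Qed.

Lemma Psi_vec x : (fun c => Psi c x) = vscal (RtoC (rphi x)) u.
Proof. apply functional_extensionality; intros c; unfold Psi, vscal, phi, product3, rphi; ring. Qed.
Lemma Nsq_Psi x : Nsq (fun c => Psi c x) = Nsq u * rphi x ^ 2.
Proof. rewrite Psi_vec, Nsq_scal, Cmod_R, pow2_abs by auto; ring. Qed.
Lemma Nsq_an_Psi m x : Nsq (an m (fun c => Psi c x)) = Nsq (an m u) * rphi x ^ 2.
Proof.
  rewrite Psi_vec.
  replace (an m (vscal (RtoC (rphi x)) u)) with (vscal (RtoC (rphi x)) (an m u))
    by (apply functional_extensionality; intros c; unfold an, vscal; ring).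
  rewrite Nsq_scal, Cmod_R, pow2_abs by auto using finsupp_an; ring.
Qed.

(** The cross term of p and A is estimated away; the factor 2 that this costs is cancelled by the
    1/2 in H. *)
Lemma Nsq_Piop_le j x : (j < 3)%nat ->
  Nsq (fun c => Piop alpha L Lam eps j Psi c x) <=
  2 * Nsq u * rdphi j x ^ 2 +
  2 * alpha * rphi x ^ 2 * Nsq (field ms (awave L eps j x) u).
Proof.
  intros Hj; rewrite Piop_vec, Psi_vec.
  replace (fun c => pd j (Psi c) x) with (vscal (RtoC (rdphi j x)) u)
    by (apply functional_extensionality; intros c; rewrite pd_Psi by auto; unfold vscal; ring).
  replace (field ms (awave L eps j x) (vscal (RtoC (rphi x)) u)) with
    (vscal (RtoC (rphi x)) (field ms (awave L eps j x) u))
    by (unfold field; rewrite aF_scal, cF_scal; vring).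
  eapply Rle_trans; [apply Nsq_add_le; auto 10 using finsupp_vscal, finsupp_field|].
  rewrite !Nsq_scal, Cmod_opp, Cmod_Ci, !Cmod_R, !pow2_abs, pow2_sqrt
    by (auto using finsupp_vscal, finsupp_field; lra).
  right; ring.
Qed.

Lemma integral_phi :
  cc (fun x => rphi x ^ 2) /\ integral3 (fun x => rphi x ^ 2) = A ^ 3 /\
  forall j, (j < 3)%nat -> cc (fun x => rdphi j x ^ 2) /\
    integral3 (fun x => rdphi j x ^ 2) <= kappa / l ^ 2 * A ^ 3.
Proof.
  destruct (smooth1_Derive f Hf) as [_ Hf'].
  assert (Hsq : forall g : R -> R, smooth1 g -> forall x, continuous (fun x => g x ^ 2) x).
  { intros g Hg x; apply continuous_ext with (fun x => g x * g x);
      [intros; simpl; now rewrite Rmult_1_r|].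
    apply (continuous_mult g g); apply (Hg 0%nat). }
  assert (H : forall g h k : R -> R, smooth1 g -> smooth1 h -> smooth1 k ->
    (forall x, l < Rabs x -> g x = 0 /\ h x = 0 /\ k x = 0) ->
    cc (fun x => (g (vcomp x 0) * h (vcomp x 1) * k (vcomp x 2)) ^ 2) /\
    integral3 (fun x => (g (vcomp x 0) * h (vcomp x 1) * k (vcomp x 2)) ^ 2) =
    RIntM l (fun x => g x ^ 2) * RIntM l (fun x => h x ^ 2) * RIntM l (fun x => k x ^ 2)).
  { intros g h k Hg Hh Hk H0.
    assert (E0 : (fun x => (g (vcomp x 0) * h (vcomp x 1) * k (vcomp x 2)) ^ 2) =
      (fun x => g (vcomp x 0) ^ 2 * h (vcomp x 1) ^ 2 * k (vcomp x 2) ^ 2))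
      by (apply functional_extensionality; intros; ring).
    rewrite E0; apply (integral3_product (fun x => g x ^ 2) (fun x => h x ^ 2) (fun x => k x ^ 2)); auto.
    intros x Hx; destruct (H0 x Hx) as [-> [-> ->]]; simpl; lra. }

  destruct (H f f f Hf Hf Hf) as [C1 I1]; [intros x Hx; destruct (Hf0 x Hx); auto|].
  split; [exact C1|]; split; [etransitivity; [exact I1 | ring]|].
  assert (HI : A * A * RIntM l (fun x => Derive f x ^ 2) <= kappa / l ^ 2 * A ^ 3).
  { replace (kappa / l ^ 2 * A ^ 3) with (A * A * (kappa / l ^ 2 * A)) by ring.
    apply Rmult_le_compat_l; [nra | exact HB]. }
  destruct (pd_product3 f f f Hf Hf Hf) as [P0 [P1 P2]].
  intros j Hj; unfold rdphi, phi; destruct j as [|[|[|]]]; [rewrite P0 | rewrite P1 | rewrite P2 | lia];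
    unfold product3, RtoC; cbn [fst].
  - destruct (H (Derive f) f f Hf' Hf Hf) as [C2 I2]; [intros x Hx; destruct (Hf0 x Hx); auto|].
    split; [exact C2 | eapply Rle_trans; [right; exact I2 | lra]].
  - destruct (H f (Derive f) f Hf Hf' Hf) as [C2 I2]; [intros x Hx; destruct (Hf0 x Hx); auto|].
    split; [exact C2 | eapply Rle_trans; [right; exact I2 | lra]].
  - destruct (H f f (Derive f) Hf Hf Hf') as [C2 I2]; [intros x Hx; destruct (Hf0 x Hx); auto|].
    split; [exact C2 | eapply Rle_trans; [right; exact I2 | lra]].
Qed.

Lemma trial_energy : exists r, rayleigh_set alpha L Lam eps r /\
  r <= 3 * kappa / l ^ 2 + alpha * theta + E.
Proof.
  destruct integral_phi as [CP [IP HD]].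
  destruct trial_Psi as [[S HS] [Hal Hreg]].
  destruct (normsq_psi Psi S HS Hreg) as [En Cn].
  destruct (normsq_Piop L Lam eps alpha Psi S HS Hreg 0 ltac:(lia)) as [E0 C0].
  destruct (normsq_Piop L Lam eps alpha Psi S HS Hreg 1 ltac:(lia)) as [E1 C1].
  destruct (normsq_Piop L Lam eps alpha Psi S HS Hreg 2 ltac:(lia)) as [E2 C2].
  pose proof (field_energy_psi L Lam Psi S HS Hreg) as Eh.
  destruct (HD 0%nat ltac:(lia)) as [D0 I0]; destruct (HD 1%nat ltac:(lia)) as [D1 I1];
    destruct (HD 2%nat ltac:(lia)) as [D2 I2].
  assert (HA3 : 0 < A ^ 3) by now apply pow_lt.
  set (n := integral3 (fun x => Nsq (fun c => Psi c x))) in *.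
  assert (Hn : n = Nsq u * A ^ 3).
  { unfold n; rewrite (integral3_ext _ (fun x => Nsq u * rphi x ^ 2)) by apply Nsq_Psi.
    now rewrite integral3_scal, IP. }
  assert (Hn0 : 0 < n) by (rewrite Hn; now apply Rmult_lt_0_compat).
  set (h := integral3 (fun x => rsum ms (fun m => knorm L m * Nsq (an m (fun c => Psi c x))))) in *.
  assert (Hh : h <= E * n).
  { unfold h; rewrite (integral3_ext _ (fun x =>
      rsum ms (fun m => knorm L m * Nsq (an m u)) * rphi x ^ 2)).
    - rewrite integral3_scal, IP, Hn, <- Rmult_assoc by auto.
      apply Rmult_le_compat_r; [lra | exact HE].
    - intros x; rewrite Rmult_comm, <- rsum_scal; apply rsum_ext; intros m _.
      rewrite Nsq_an_Psi; ring. }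
  set (q0 := integral3 (fun x => Nsq (fun c => Piop alpha L Lam eps 0 Psi c x))) in *.
  set (q1 := integral3 (fun x => Nsq (fun c => Piop alpha L Lam eps 1 Psi c x))) in *.
  set (q2 := integral3 (fun x => Nsq (fun c => Piop alpha L Lam eps 2 Psi c x))) in *.
  assert (Hq : q0 + q1 + q2 <= (6 * kappa / l ^ 2 + 2 * alpha * theta) * n).
  { unfold q0, q1, q2; rewrite <- !integral3_plus by auto using cc_plus.
    apply Rle_trans with (integral3 (fun x =>
      2 * Nsq u * (rdphi 0 x ^ 2 + rdphi 1 x ^ 2 + rdphi 2 x ^ 2) +
      2 * alpha * theta * Nsq u * rphi x ^ 2)).
    - apply integral3_le; [auto using cc_plus | auto 10 using cc_plus, cc_scal |].
      intros x.
      pose proof (Nsq_Piop_le 0 x ltac:(lia)); pose proof (Nsq_Piop_le 1 x ltac:(lia));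
        pose proof (Nsq_Piop_le 2 x ltac:(lia)).
      enough (rphi x ^ 2 * rsum (seq 0 3) (fun j => Nsq (field ms (awave L eps j x) u)) <=
        rphi x ^ 2 * (theta * Nsq u)).
      { rewrite rsum_seq3 in *.
        apply Rmult_le_compat_l with (r := 2 * alpha) in H2; [lra | lra]. }
      (* The field estimate is available only in the cube |x_i| <= l; elsewhere the electron factor
         vanishes. *)
      destruct (excluded_middle_informative (forall i, (i < 3)%nat -> Rabs (vcomp x i) <= l))
        as [Hx | Hx].
      + apply Rmult_le_compat_l; [apply pow2_ge_0 | now apply Htheta].
      + enough (E3 : rphi x = 0) by (rewrite E3; lra).
        destruct (excluded_middle_informative (rphi x = 0)) as [|Hne]; auto.
        destruct Hx; intros i Hi; apply Rnot_lt_le; intros Hlt; apply Hne.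
        now apply (phi_support x i).
    - rewrite integral3_plus, !integral3_scal, !integral3_plus, IP by auto 10 using cc_plus, cc_scal.
      rewrite Hn.
      assert (2 * Nsq u * (integral3 (fun x => rdphi 0 x ^ 2) + integral3 (fun x => rdphi 1 x ^ 2) +
        integral3 (fun x => rdphi 2 x ^ 2)) <= 2 * Nsq u * (3 * (kappa / l ^ 2 * A ^ 3)))
        by (apply Rmult_le_compat_l; lra).
      unfold Rdiv in *; lra. }
  exists (((q0 + q1 + q2) / 2 + h) / n); split.
  - exists Psi; split; [exact trial_Psi|]; exists n, q0, q1, q2, h; auto 10.
  - apply Rle_div_l; auto.
    unfold Rdiv in *; lra.
Qed.
End TrialState.

(** * Choice of the parameters *)

(** Weakens the exponentially small Taylor error to a power of the degree, which is then compared
    with the squeezing factor. *)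
Lemma pow4_ge d : INR d ^ 3 <= 2 * 4 ^ d.
Proof.
  assert (H : INR d + 1 <= 2 ^ d /\ INR d ^ 2 <= 2 * 2 ^ d).
  { induction d; [simpl; lra|]; rewrite S_INR; simpl pow in *; pose proof (pos_INR d); nra. }
  replace (4 ^ d) with (2 ^ d * 2 ^ d) by (rewrite <- Rpow_mult_distr; f_equal; ring).
  pose proof (pos_INR d).
  replace (INR d ^ 3) with (INR d * INR d ^ 2) by ring.
  replace (2 * (2 ^ d * 2 ^ d)) with (2 ^ d * (2 * 2 ^ d)) by ring.
  apply Rmult_le_compat; try lra; apply pow2_ge_0.
Qed.

Lemma ceil_nat x : 1 <= x -> exists n, (1 <= n)%nat /\ x <= INR n <= 2 * x.
Proof.
  intros Hx; destruct (nfloor_ex x) as [n [H1 H2]]; [lra|].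
  exists (S n); rewrite S_INR; split; [lia | lra].
Qed.

(* The electron is confined to scale [l = rho / Lam], [rho = (Lam / alpha) ^ (1/7)], and the
   field is squeezed by the factor [k ~ alpha rho ^ 2]. *)
Lemma E0_upper_bound : exists C2, 0 < C2 /\
  forall alpha, 0 < alpha -> forall L, 0 < L -> forall eps, polarization L eps ->
  exists Lam0, forall Lam, Lam0 < Lam ->
    Rbar_lt (E0 alpha L Lam eps) (Finite (C2 * Rpower alpha (2 / 7) * Rpower Lam (12 / 7))).
Proof.
  pose proof PI_RGT_0 as Hpi.
  destruct scaled_bump as [kappa [Hkappa Hbump]].
  set (c := 32 / PI ^ 3).
  assert (Hc : 0 < c) by (apply Rdiv_lt_0_compat; [lra | now apply pow_lt]).
  (* In units of l^-2 the summands bound the kinetic energy, the A^2 term and the photon energy: 366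
     = 170 + 196 and 41472 = 12 * 12^3 * 2. The final 1 makes the inequality strict. *)
  exists (3 * kappa + 366 * c + 41472 + 1); split; [lra|].
  intros alpha Ha L HL eps Heps.
  (* [B] collects what is asked of rho: rho > 1, rho > alpha and alpha rho > 1. As Lam = alpha
     rho^7, rho > B holds once Lam > alpha B^7. *)
  set (B := 1 + alpha + / alpha).
  assert (Hia : 0 < / alpha) by now apply Rinv_0_lt_compat.
  exists (Rmax (Rmax 1 (4 * PI / L)) (alpha * B ^ 7)); intros Lam HLam.
  apply Rmax_Rlt in HLam as [HLam HLB]; apply Rmax_Rlt in HLam as [HL1 HL4].
  set (rho := Rpower (Lam / alpha) (/ 7)).
  assert (Hr0 : 0 < rho) by apply exp_pos.
  assert (Hla : 0 < Lam / alpha) by (apply Rdiv_lt_0_compat; lra).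
  assert (Hr7 : rho ^ 7 = Lam / alpha).
  { rewrite <- Rpower_pow by auto; unfold rho; rewrite Rpower_mult; simpl (INR 7).
    replace (/ 7 * _) with 1 by field; now apply Rpower_1. }
  assert (HLr : Lam = alpha * rho ^ 7) by (rewrite Hr7; field; lra).
  assert (HB : B < rho).
  { apply Rnot_le_lt; intros Hle.
    assert (alpha * rho ^ 7 <= alpha * B ^ 7)
      by (apply Rmult_le_compat_l; [lra|]; apply pow_incr; lra).
    lra. }
  (* [Y] is l^-2, the common order of magnitude of all terms and equal to the power in the
     statement. *)
  set (Y := Lam ^ 2 / rho ^ 2).
  assert (HY : Rpower alpha (2 / 7) * Rpower Lam (12 / 7) = Y).
  { assert (Hl : ln Lam = ln alpha + 7 * ln rho).
    { rewrite HLr at 1; rewrite ln_mult by (auto; now apply pow_lt).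
      rewrite ln_pow by auto; simpl (INR 7); ring. }
    unfold Y; assert (HLam0 : 0 < Lam) by lra.
    rewrite <- (exp_ln (Lam ^ 2 / rho ^ 2)) by (apply Rdiv_lt_0_compat; now apply pow_lt).
    unfold Rpower; rewrite <- exp_plus; f_equal.
    rewrite ln_div, !ln_pow by (auto; now apply pow_lt); simpl (INR 2); rewrite Hl; field. }
  rewrite Rmult_assoc, HY.
  assert (HY0 : 0 < Y) by (apply Rdiv_lt_0_compat; apply pow_lt; lra).
  assert (H1r : 1 < rho) by (unfold B in HB; lra).
  assert (Har : alpha < rho) by (unfold B in HB; lra).
  assert (Hkr : 1 <= alpha * rho ^ 2).
  { assert (1 <= alpha * rho) by (rewrite <- (Rinv_r alpha) by lra;
      apply Rmult_le_compat_l; [lra | unfold B in HB; lra]).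
    nra. }
  destruct (ceil_nat (6 * rho)) as [d [Hd1 Hd]]; [lra|].
  destruct (ceil_nat (alpha * rho ^ 2) Hkr) as [k [Hk1 Hk]].
  set (l := rho / Lam).
  assert (Hl : 0 < l) by (apply Rdiv_lt_0_compat; lra).
  assert (Hll : l * Lam = rho) by (unfold l; field; lra).
  destruct (Hbump l Hl) as [f [Hf [Hf0 [HA HBf]]]].
  destruct (squeezed_state L Lam eps l d k) as [u [Hu [Hum [Hu0 [Hnum Hfield]]]]];
    auto; [lra | rewrite Hll; lra |].
  set (W := rsum (modes L Lam) (fun m => / (2 * L ^ 3 * knorm L m))) in *.
  assert (HW : W <= c * Lam ^ 2).
  { apply sum_inv_knorm; auto; unfold radius.
    apply Rle_div_r; [lra|].
    apply Rmult_lt_compat_r with (r := L) in HL4; auto.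
    replace (4 * PI / L * L) with (4 * PI) in HL4 by (field; lra); lra. }
  assert (Hk0 : 0 < INR k) by lra.
  destruct (trial_energy alpha L Lam l kappa ((170 / INR k + 196 * (/ 4) ^ d) * W)
    (Lam * (12 * INR d ^ 3 * INR k)) eps f u) as [r [Hr Hle]]; auto.
  { apply Rle_trans with (rsum (modes L Lam) (fun m => Lam * Nsq (an m u))).
    - apply rsum_le; intros m Hm; apply modes_allowed in Hm as [_ Hm].
      apply Rmult_le_compat_r; [apply Nsq_nonneg, finsupp_an; auto | lra].
    - rewrite rsum_scal, Rmult_assoc; apply Rmult_le_compat_l; lra. }
  apply Rbar_le_lt_trans with (Finite r); [now apply (Glb_Rbar_correct (rayleigh_set alpha L Lam eps))|].
  simpl; apply Rle_lt_trans with (1 := Hle).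
  assert (T1 : 3 * kappa / l ^ 2 = 3 * kappa * Y) by (unfold l, Y; field; lra).
  assert (T2 : alpha * ((170 / INR k + 196 * (/ 4) ^ d) * W) <= 366 * c * Y).
  { assert (Hs : 170 / INR k + 196 * (/ 4) ^ d <= 366 / (alpha * rho ^ 2)).
    { assert (170 / INR k <= 170 / (alpha * rho ^ 2)).
      { unfold Rdiv; apply Rmult_le_compat_l; [lra|]; apply Rinv_le_contravar; lra. }
      (* 4^d >= d^3 / 2 >= 108 rho^3, and rho^3 >= alpha rho^2 because rho > alpha: the Taylor error
         is no larger than the effect of squeezing. *)
      assert ((/ 4) ^ d <= / (alpha * rho ^ 2)).
      { rewrite pow_inv; apply Rinv_le_contravar; [lra|].
        pose proof (pow4_ge d).
        assert ((6 * rho) ^ 3 <= INR d ^ 3) by (apply pow_incr; lra).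
        assert (alpha * rho ^ 2 <= rho ^ 3).
        { replace (rho ^ 3) with (rho * rho ^ 2) by ring; apply Rmult_le_compat_r; [apply pow2_ge_0 | lra]. }
        assert (0 < rho ^ 3) by now apply pow_lt.
        replace ((6 * rho) ^ 3) with (216 * rho ^ 3) in * by ring; lra. }
      unfold Rdiv in *; lra. }
    replace (366 * c * Y) with (alpha * (366 / (alpha * rho ^ 2) * (c * Lam ^ 2)))
      by (unfold Y; field; lra).
    apply Rmult_le_compat_l; [lra|].
    apply Rmult_le_compat; auto.
    - assert (0 < 170 / INR k) by (apply Rdiv_lt_0_compat; lra).
      assert (0 < (/ 4) ^ d) by (apply pow_lt; lra); lra.
    - apply rsum_nonneg; intros m Hm; pose proof (knorm_pos L Lam HL m Hm).
      assert (0 < L ^ 3) by now apply pow_lt.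
      apply Rlt_le, Rinv_0_lt_compat; repeat apply Rmult_lt_0_compat; lra. }
  assert (T3 : Lam * (12 * INR d ^ 3 * INR k) <= 41472 * Y).
  { replace (41472 * Y) with (Lam * (12 * (12 * rho) ^ 3 * (2 * (alpha * rho ^ 2)))).
    2: { unfold Y; replace (Lam ^ 2) with (Lam * (alpha * rho ^ 7)) by (rewrite <- HLr; ring).
         field; lra. }
    apply Rmult_le_compat_l; [lra|].
    apply Rmult_le_compat; [| lra | | lra].
    - apply Rmult_le_pos; [lra | apply pow_le, pos_INR].
    - apply Rmult_le_compat_l; [lra|]; apply pow_incr; lra. }
  lra.
Qed.

Theorem theorem1 :
  exists C1 C2 : R, 0 < C1 /\ 0 < C2 /\
  forall alpha : R, 0 < alpha ->
  forall L : R, 0 < L ->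
  forall eps : mode -> R3, polarization L eps ->
  exists Lam0 : R, forall Lam : R, Lam0 < Lam ->
    Rbar_lt (Finite (C1 * Rpower alpha (1/2) * Rpower Lam (3/2))) (E0 alpha L Lam eps) /\
    Rbar_lt (E0 alpha L Lam eps) (Finite (C2 * Rpower alpha (2/7) * Rpower Lam (12/7))).
Proof.
  destruct E0_lower_bound as [C1 [HC1 H1]], E0_upper_bound as [C2 [HC2 H2]].
  exists C1, C2; split; [exact HC1|]; split; [exact HC2|].
  intros alpha Ha L HL eps Heps.
  destruct (H1 alpha Ha L HL eps Heps) as [Lam1 HL1].
  destruct (H2 alpha Ha L HL eps Heps) as [Lam2 HL2].
  exists (Rmax Lam1 Lam2); intros Lam HLam; apply Rmax_Rlt in HLam as [HLam1 HLam2]; auto.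
Qed.
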